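(* In the abstract setting of the context, assume (H1)-(H7) and, in addition, $-a<\frac{(d_0\gamma^-)^2}{2}$. Let $(c^\star,\mathbf U)$ be a minimizing solution pair in the sense of the context (such a pair exists). If $\tilde{\mathbf U}\in\mathcal A(\mathbb R)\cap X$ satisfies $\mathbf E_{c^\star}(\tilde{\mathbf U})=0$, then $$\tilde{\mathbf U}''-D_L\mathcal E(\tilde{\mathbf U})=-c^\star\tilde{\mathbf U}'\quad\text{in }\mathbb R\qquad\text{and}\qquad c^\star=\frac{-a}{\int_{\mathbb R}\|\tilde{\mathbf U}'(t)\|_L^2dt}.$$ In particular $\int_{\mathbb R}\|\tilde{\mathbf U}'(t)\|_L^2dt$ is finite. Moreover $$c^\star=\sup\{c>0:\inf_{U\in X}\mathbf E_c(U)=-\infty\}=\inf\{c>0:\inf_{U\in X}\mathbf E_c(U)=0\}$$ and $$c^\star\le\frac{\sqrt{-2a}}{d_0}<\min\Big\{\frac{\sqrt{2\mathcal E^-_{\max}}}{d_0},\ \gamma^-\Big\}.$$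
   Context: Setting. $L$ is a Hilbert space (norm $\|\cdot\|_L$), $H\subset L$ is a Hilbert space with its own norm $\|\cdot\|_H$, $\mathcal E:L\to(-\infty,+\infty]$, and $F^-,F^+\subset L$. $\mathrm{dist}_L(v,F)=\inf_{f\in F}\|v-f\|_L$, $\mathrm{dist}_H$ likewise. For $r>0$, $F^\pm_r=\{v\in L:\mathrm{dist}_L(v,F^\pm)\le r\}$ and $F^\pm_{H,r}=\{v\in H:\mathrm{dist}_H(v,F^\pm)\le r\}$. Conditions with $\pm$ are required for both signs. (H1) $\mathcal E$ is weakly lower semicontinuous in $L$; $F^\pm$ are closed in $L$; there is $a<0$ with $\mathcal E(v)\ge\mathcal E(f)=a$ for all $v\in L$, $f\in F^-$; each $f\in F^+$ is a local minimizer of $\mathcal E$ with $\mathcal E(f)=0$. Write $a^-:=a$, $a^+:=0$. There are $r_0^\pm>0$ with $F^+_{r_0^+}\cap F^-_{r_0^-}=\emptyset$ and $C^\pm>1$ with $(C^\pm)^{-1}\mathrm{dist}_L(v,F^\pm)^2\le\mathcal E(v)-a^\pm$ for all $v\in F^\pm_{r_0^\pm}$. For every $v\in F^\pm_{r_0^\pm}$ there is a unique $P^\pm(v)\in F^\pm$ with $\|v-P^\pm(v)\|_L=\mathrm{dist}_L(v,F^\pm)$, and $P^\pm:F^\pm_{r_0^\pm}\to F^\pm$ is $C^2$ for the $L$-norm. (H2) $H=\{v\in L:\mathcal E(v)<+\infty\}$, $\|\cdot\|_L\le\|\cdot\|_H$ (in particular $F^\pm\subset H$), $\mathcal E$ is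 $C^1$ on $(H,\|\cdot\|_H)$ with differential $D\mathcal E$. There is a smaller space $\tilde H\subset H$ with an inner product and norm $\|\cdot\|_{\tilde H}\ge\|\cdot\|_H$ and a continuous map $D_L\mathcal E:(\tilde H,\|\cdot\|_{\tilde H})\to(L,\|\cdot\|_L)$ with $\langle D_L\mathcal E(v),w\rangle_L=D\mathcal E(v)(w)$ for all $v\in\tilde H$, $w\in H$. (H3) $L$-bounded subsets of $F^\pm$ are (relatively) compact with respect to $H$-convergence. (H4) For each sign, either $F^\pm$ is $L$-bounded, or: for all $(v,f)\in F^\pm_{r_0^\pm}\times F^\pm$ there is a differentiable map $\hat P=\hat P^\pm_{(v,f)}:L\to L$ with $P^\pm(\hat P(v))=f$, and, for all $w\in L$, $\mathrm{dist}_L(\hat P(w),F^\pm)=\mathrm{dist}_L(w,F^\pm)$ and $\mathcal E(\hat P(w))=\mathcal E(w)$, and whose differential satisfies $\|D\hat P(w_1)w_2\|_L=\|w_2\|_L$ for all $w_1,w_2\in L$. (H5) For every $v\in F^\pm_{H,r_0^\pm}$ there is a unique $P_H^\pm(v)\in F^\pm$ with $\|v-P_H^\pm(v)\|_H=\mathrm{dist}_H(v,F^\pm)$; $P_H^\pm$ is $C^1$ for the $H$-norm. With $C^\pm$ from (H1), for all $v\in F^\pm_{H,r_0^\pm}$: $\|P^\pm(v)-P_H^\pm(v)\|_H\le C^\pm\|v-P_H^\pm(v)\|_H$ and $(C^\pm)^{-2}\|v-P_H^\pm(v)\|_H^2\le\mathcal E(v)-a^\pm\le(C^\pm)^2\|v-P_H^\pm(v)\|_H^2$.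 For each $r\in(0,r_0^\pm]$ there is a constant $\beta^\pm(r)>0$ (fixed) such that $v\in F^\pm_{r_0^\pm}$ and $\mathcal E(v)\le a^\pm+\beta^\pm(r)$ imply $v\in F^\pm_{H,r}$. Weighted energy. For an interval $I$, $c>0$, $U\in H^1_{loc}(I,L)$: $\mathbf E_c(U;I)=\int_I\big[\tfrac12\|U'(t)\|_L^2+\mathcal E(U(t))\big]e^{ct}dt$ and $\mathbf E_c(U)=\mathbf E_c(U;\mathbb R)$. $U$ is a local minimizer of $\mathbf E_c(\cdot;I)$ if $\mathbf E_c(U;I)$ is well defined and finite and there is $C>0$ such that for every $\phi\in\mathcal C^1_c(\mathrm{int}(I),(H,\|\cdot\|_H))$ with $\max_I\|\phi(t)\|_H<C$, $\mathbf E_c(U+\phi;I)$ is well defined and not smaller than $\mathbf E_c(U;I)$. For $O\subset\mathbb R$ open, $\mathcal A(O)=\mathcal C^2_{loc}(O,L)\cap\mathcal C^1_{loc}(O,(H,\|\cdot\|_H))\cap\mathcal C^0_{loc}(O,(\tilde H,\|\cdot\|_{\tilde H}))$. (H6) There is $\mathfrak P:L\to L$ such that for all $v,v_1,v_2\in L$: $\mathcal E(\mathfrak P(v))\le\mathcal E(v)$, with equality iff $\mathfrak P(v)=v$; $\|\mathfrak P(v_1)-\mathfrak P(v_2)\|_L\le\|v_1-v_2\|_L$; and $\mathfrak P$ is the identity on $F^-\cup F^+$. If $I\subset\mathbb R$ is a non-empty (possibly unbounded) open interval, $c>0$, and $\mathbf W\in H^1_{loc}(I,L)$ is a local minimizer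 of $\mathbf E_c(\cdot;I)$ with $\mathbf W(t)=\mathfrak P(\mathbf W(t))$ for all $t\in I$, then $\mathbf W\in\mathcal A(I)$ and $\mathbf W''-D_L\mathcal E(\mathbf W)=-c\mathbf W'$ in $I$. Constants. $\kappa^-_r=\inf\{\mathcal E(v):\mathrm{dist}_L(v,F^-)\in[r,r_0^-]\}$ for $r\in(0,r_0^-]$; $\eta_0^-=\min\{\sqrt{e^{-1}\frac{r_0^-}{4}\sqrt{2(\kappa^-_{r_0^-/4}-a)}},\frac{r_0^-}{4}\}$; $\hat r^-=\frac{r_0^-}{C^-+1}$; $$\mathcal E^-_{\max}=\frac{1}{(C^-)^2(C^-+1)}\min\Big\{\tfrac{(\eta_0^-)^2}{4},\ \kappa^-_{\eta_0^-}-a,\ \beta^-(\hat r^-),\ \beta^-(\eta_0^-)\Big\};$$ $\mathsf C^-=\frac12(C^-)^2((C^-)^2+(C^-+1)^2)$, $\gamma^-=\frac1{C^-+\mathsf C^-}$, and $d_0=\inf\{\|v-w\|_L:v\in F^+_{r_0^+/2},w\in F^-_{r_0^-/2}\}>0$. (H7) $-a<\mathcal E^-_{\max}$ and $\{v\in H:\mathcal E(v)<0\}\subset F^-_{r_0^-/2}$. $X$ is the set of $U\in H^1_{loc}(\mathbb R,L)$ for which there is $T\ge1$ with $\mathrm{dist}_L(U(t),F^+)\le r_0^+/2$ for all $t\ge T$ and $\mathrm{dist}_L(U(t),F^-)\le r_0^-/2$ for all $t\le-T$. Minimizing solution pair: $(c^\star,\mathbf U)$ with $c^\star>0$, $\mathbf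 U\in\mathcal A(\mathbb R)\cap X$, $\mathbf U''-D_L\mathcal E(\mathbf U)=-c^\star\mathbf U'$ in $\mathbb R$, $\mathbf E_{c^\star}(\mathbf U)=0=\inf_{U\in X}\mathbf E_{c^\star}(U)$, $\mathbf U(t)=\mathfrak P(\mathbf U(t))$ for all $t$, and $\|\mathbf U(t)-\mathbf v^+\|_L\le M^+e^{-c^\star t}$ for all $t\in\mathbb R$ and some $M^+>0$, $\mathbf v^+\in F^+$. *)

(* Defs.v *)
From HB Require Import structures.
From mathcomp Require Import all_boot all_order all_algebra.
From mathcomp Require Import all_classical all_reals all_analysis.

Set Implicit Arguments.
Unset Strict Implicit.
Unset Printing Implicit Defensive.

Import Order.TTheory GRing.Theory Num.Theory.
Import numFieldNormedType.Exports.

Local Open Scope ring_scope.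
Local Open Scope classical_set_scope.

Section Distance.
Context {R : realType} {V : normedModType R}.

(* Valued in \bar R so that the distance to the empty set is +oo, not 0. *)
Definition dist_to (A : set V) (v : V) : \bar R :=
  ereal_inf [set (`|v - f|)%:E | f in A].

Definition nearest (A : set V) (v p : V) : Prop :=
  A p /\ (`|v - p|)%:E = dist_to A v.

End Distance.

(* The C^k classes for maps defined on a subset D that need not be open, with
   derivatives taken relative to D; for open D this is the usual notion.
   Continuity of derivatives is in operator norm. *)
Section Smoothness.
Context {R : realType} {V W : normedModType R}.

Definition diff_within (D : set V) (f : V -> W) (x : V)
    (df : {linear V -> W}) : Prop :=
  continuous df /\
  forall e : R, 0 < e -> \forall y \near within D (nbhs x),
    `|f y - f x - df (y - x)| <= e * `|y - x|.

Definition C1_on (D : set V) (f : V -> W) : Prop :=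
  exists df : V -> {linear V -> W}, forall x, D x ->
    diff_within D f x (df x) /\
    (forall e : R, 0 < e -> \forall y \near within D (nbhs x),
       forall w, `|df y w - df x w| <= e * `|w|).

Definition C2_on (D : set V) (f : V -> W) : Prop :=
  exists (df : V -> {linear V -> W}) (d2f : V -> {bilinear V -> V -> W}),
  forall x, D x ->
    [/\ diff_within D f x (df x),
        exists M : R, forall h w, `|d2f x h w| <= M * `|h| * `|w|,
        forall e : R, 0 < e -> \forall y \near within D (nbhs x),
          forall w, `|df y w - df x w - d2f x (y - x) w| <= e * `|y - x| * `|w|
      & forall e : R, 0 < e -> \forall y \near within D (nbhs x),
          forall h w, `|d2f y h w - d2f x h w| <= e * `|h| * `|w|].

End Smoothness.

Section Curves.
Context {R : realType} {V : normedModType R}.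

Definition curve_C0 (O : set R) (u : R -> V) : Prop :=
  forall t, O t -> {for t, continuous u}.

Definition curve_C1 (O : set R) (u : R -> V) : Prop :=
  (forall t, O t -> derivable u t 1) /\ curve_C0 O (derive1 u).

Definition curve_C2 (O : set R) (u : R -> V) : Prop :=
  (forall t, O t -> derivable u t 1) /\ curve_C1 O (derive1 u).

Definition compact_support_in (O : set R) (u : R -> V) : Prop :=
  exists K : set R, [/\ compact K, K `<=` O & forall t, ~ K t -> u t = 0].

End Curves.

Definition test_function {R : realType} (O : set R) (phi : R -> R) : Prop :=
  (forall n t, derivable (derive1n n phi) t 1) /\ compact_support_in O phi.

(* Bochner measurability: a.e. limit of measurable finitely-valued functions. *)
Definition strongly_measurable {R : realType} {V : normedModType R}
    (I : set R) (u : R -> V) : Prop :=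
  exists s : nat -> R -> V,
    (forall n, finite_set (range (s n)) /\
       forall v, measurable (s n @^-1` [set v] : set (measurableTypeR R))) /\
    {ae (@lebesgue_measure R), forall t, I t -> s n t @[n --> \oo] --> u t}.

Definition L2loc {R : realType} {V : normedModType R}
    (I : set R) (u : R -> V) : Prop :=
  strongly_measurable I u /\
  forall K : set R, compact K -> K `<=` I ->
    (\int[@lebesgue_measure R]_(t in K) (`|u t| ^+ 2)%:E < +oo)%E.

Variant sign := Minus | Plus.

(* The nested spaces (spT inside spH inside spL) each carry their own norm, so
   the inclusions are injective linear maps incT and incH.  The fields from
   setF on are only data; they are constrained by hypH1, ..., hypH7 below. *)
Record setting (R : realType) := Setting {
  spL : completeNormedModType R;
  ipL : {dot spL for idfun};
  ipL_norm : forall v : spL, ipL v v = `|v| ^+ 2;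
  spH : completeNormedModType R;
  ipH : {dot spH for idfun};
  ipH_norm : forall v : spH, ipH v v = `|v| ^+ 2;
  incH : {linear spH -> spL};
  incH_inj : injective incH;
  spT : normedModType R;
  ipT : {dot spT for idfun};
  ipT_norm : forall v : spT, ipT v v = `|v| ^+ 2;
  incT : {linear spT -> spH};
  incT_inj : injective incT;
  potE : spL -> \bar R;
  potE_gtNy : forall v, (-oo < potE v)%E;
  setF : sign -> set spL;
  levA : R;
  r0 : sign -> R;
  cstC : sign -> R;
  projL : sign -> spL -> spL; (* relevant on the r0-neighbourhood of setF *)
  projH : sign -> spH -> spH; (* relevant on the r0-neighbourhood in spH *)
  beta : sign -> R -> R;
  DLE : spT -> spL;
  projE : spL -> spL          (* the energy-decreasing map, fraktur P *)
}.

Section Setting.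
Context {R : realType} (S : setting R).
Local Notation L := (spL S).
Local Notation H := (spH S).
Local Notation Ht := (spT S).
Local Notation incH := (incH S).
Local Notation incT := (incT S).
Local Notation E := (@potE R S).
Local Notation F := (@setF R S).
Local Notation a := (levA S).
Local Notation r0 := (r0 S).
Local Notation C := (cstC S).
Local Notation P := (@projL R S).
Local Notation PH := (@projH R S).
Local Notation beta := (@beta R S).
Local Notation DLE := (@DLE R S).
Local Notation proj := (@projE R S).
Local Notation "<< u , v >>" := (@ipL R S u v).
Local Notation mu := (@lebesgue_measure R).

Definition lev (s : sign) : R := if s is Minus then a else 0.

Definition nbF (s : sign) (r : R) : set L :=
  [set v | (dist_to (F s) v <= r%:E)%E].

Definition FH (s : sign) : set H := incH @^-1` F s.

Definition nbFH (s : sign) (r : R) : set H :=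
  [set h | (dist_to (FH s) h <= r%:E)%E].

(* Sequential weak lower semicontinuity. *)
Definition weakly_lsc : Prop :=
  forall (u : nat -> L) (v : L),
    (forall w, <<u n, w>> @[n --> \oo] --> <<v, w>>) ->
    (E v <= limn_einf (E \o u))%E.

Definition hypH1 : Prop :=
  weakly_lsc
  /\ (forall s, closed (F s))
  /\ a < 0
  /\ (forall v f, F Minus f -> (E f <= E v)%E /\ E f = a%:E)
  /\ (forall f, F Plus f -> (\forall v \near f, (E f <= E v)%E) /\ E f = 0%E)
  /\ (forall s, 0 < r0 s)
  /\ nbF Plus (r0 Plus) `&` nbF Minus (r0 Minus) = set0
  /\ (forall s, 1 < C s)
  /\ (forall s v, nbF s (r0 s) v ->
        ((C s)^-1%:E * dist_to (F s) v ^+ 2 <= E v - (lev s)%:E)%E)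
  /\ (forall s v, nbF s (r0 s) v ->
        nearest (F s) v (P s v) /\ forall f, nearest (F s) v f -> f = P s v)
  /\ (forall s, C2_on (nbF s (r0 s)) (P s)).

Definition EH : H -> R^o := fun h => fine (E (incH h)).

Definition hypH2 : Prop :=
  range incH = [set v | (E v < +oo)%E]
  /\ (forall h : H, `|incH h| <= `|h|)
  /\ (forall h, differentiable EH h)
  /\ (forall h (e : R), 0 < e -> \forall k \near h,
        forall w, `|'d EH k w - 'd EH h w| <= e * `|w|)
  /\ (forall u : Ht, `|incT u| <= `|u|)
  /\ continuous DLE
  /\ (forall (u : Ht) (w : H), <<DLE u, incH w>> = 'd EH (incT u) w).

Definition hypH3 : Prop :=
  forall s (B : set L), B `<=` F s -> bounded_set B ->
    precompact (incH @^-1` B).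

Definition hypH4 : Prop :=
  forall s, bounded_set (F s) \/
    forall v f, nbF s (r0 s) v -> F s f ->
      exists Phat : L -> L,
        (forall w, differentiable Phat w)
        /\ P s (Phat v) = f
        /\ (forall w, dist_to (F s) (Phat w) = dist_to (F s) w
                      /\ E (Phat w) = E w)
        /\ (forall w1 w2, `|'d Phat w1 w2| = `|w2|).

(* p below is P s (incH v) seen as an element of H. *)
Definition hypH5 : Prop :=
  forall s,
    (forall v, nbFH s (r0 s) v ->
       nearest (FH s) v (PH s v) /\ forall f, nearest (FH s) v f -> f = PH s v)
    /\ C1_on (nbFH s (r0 s)) (PH s)
    /\ (forall v, nbFH s (r0 s) v ->
          (forall p : H, incH p = P s (incH v) ->
             `|p - PH s v| <= C s * `|v - PH s v|)
          /\ ((C s ^- 2 * `|v - PH s v| ^+ 2)%:E <= E (incH v) - (lev s)%:E)%E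
          /\ (E (incH v) - (lev s)%:E <= (C s ^+ 2 * `|v - PH s v| ^+ 2)%:E)%E)
    /\ (forall r, 0 < r <= r0 s ->
          0 < beta s r
          /\ forall v, nbF s (r0 s) v -> (E v <= (lev s + beta s r)%:E)%E ->
               exists2 h, incH h = v & nbFH s r h).

(* Distributional derivative in L2loc; the Bochner-integral identity
   int phi' u = - int phi u' is tested against every w in L. *)
Definition weak_derivative (I : set R) (U V : R -> L) : Prop :=
  L2loc I V /\
  forall phi : R -> R, test_function (interior I) phi -> forall w : L,
    \int[mu]_(t in I) (derive1 phi t * <<U t, w>>) =
    - \int[mu]_(t in I) (phi t * <<V t, w>>).

(* Elements of H^1_loc are identified with their continuous representatives
   (which are automatically L2loc); values outside I are irrelevant. *)
Definition H1loc (I : set R) (U : R -> L) : Prop :=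
  {within I, continuous U} /\ exists V, weak_derivative I U V.

(* Unique almost everywhere in I. *)
Definition wderiv (I : set R) (U : R -> L) : R -> L :=
  xget (fun=> 0) [set V | weak_derivative I U V].

Definition energy_density (I : set R) (c : R) (U : R -> L) (t : R) : \bar R :=
  (((2^-1 * `|wderiv I U t| ^+ 2)%:E + E (U t)) * (expR (c * t))%:E)%E.

Definition energy (I : set R) (c : R) (U : R -> L) : \bar R :=
  (\int[mu]_(t in I) energy_density I c U t)%E.

Definition energy_defined (I : set R) (c : R) (U : R -> L) : Prop :=
  (\int[mu]_(t in I) (energy_density I c U)^\+ t < +oo)%E \/
  (\int[mu]_(t in I) (energy_density I c U)^\- t < +oo)%E.

Definition local_minimizer (I : set R) (c : R) (U : R -> L) : Prop :=
  energy_defined I c U /\ energy I c U \is a fin_num /\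
  exists2 d : R, 0 < d &
    forall phi : R -> H,
      curve_C1 [set: R] phi -> compact_support_in (interior I) phi ->
      (forall t, `|phi t| < d) ->
      let Uphi := fun t => U t + incH (phi t) in
      energy_defined I c Uphi /\ (energy I c U <= energy I c Uphi)%E.

Definition classA (O : set R) (U : R -> L) : Prop :=
  curve_C2 O U
  /\ (exists2 UH : R -> H, forall t, O t -> incH (UH t) = U t & curve_C1 O UH)
  /\ (exists2 UT : R -> Ht, forall t, O t -> incH (incT (UT t)) = U t
                            & curve_C0 O UT).

Definition solves (O : set R) (c : R) (U : R -> L) : Prop :=
  forall t, O t -> exists2 u : Ht, incH (incT u) = U t
                                 & derive1n 2 U t - DLE u = - (c *: derive1 U t).

Definition hypH6 : Prop :=
  (forall v, (E (proj v) <= E v)%E /\ (E (proj v) = E v <-> proj v = v))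
  /\ (forall v1 v2, `|proj v1 - proj v2| <= `|v1 - v2|)
  /\ (forall s f, F s f -> proj f = f)
  /\ (forall (I : set R) (c : R) (W : R -> L),
        I !=set0 -> open I -> is_interval I -> 0 < c ->
        H1loc I W -> local_minimizer I c W ->
        (forall t, I t -> W t = proj (W t)) ->
        classA I W /\ solves I c W).

Definition kappa (r : R) : \bar R :=
  ereal_inf [set E v | v in
    [set v | (r%:E <= dist_to (F Minus) v <= (r0 Minus)%:E)%E]].

Definition eta0 : R :=
  fine (Order.min
    (sqrte ((expR (-1) * (r0 Minus / 4))%:E
            * sqrte (2%:E * (kappa (r0 Minus / 4) - a%:E))))
    (r0 Minus / 4)%:E)%E.

Definition rhat : R := r0 Minus / (C Minus + 1).

Definition Emax : R :=
  (C Minus ^+ 2 * (C Minus + 1))^-1 *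
  fine (Order.min (eta0 ^+ 2 / 4)%:E
       (Order.min (kappa eta0 - a%:E)
       (Order.min (beta Minus rhat)%:E (beta Minus eta0)%:E)))%E.

Definition sfC : R :=
  2^-1 * C Minus ^+ 2 * (C Minus ^+ 2 + (C Minus + 1) ^+ 2).

Definition gamma : R := (C Minus + sfC)^-1.

Definition d0 : R :=
  inf [set `|v - w| | v in nbF Plus (r0 Plus / 2)
                    & w in nbF Minus (r0 Minus / 2)].

Definition hypH7 : Prop :=
  - a < Emax /\
  forall h : H, (E (incH h) < 0)%E -> nbF Minus (r0 Minus / 2) (incH h).

Definition spX : set (R -> L) := [set U |
  H1loc [set: R] U /\
  exists2 T : R, 1 <= T &
    (forall t, T <= t -> nbF Plus (r0 Plus / 2) (U t)) /\
    (forall t, t <= - T -> nbF Minus (r0 Minus / 2) (U t))].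

Definition inf_energy (c : R) : \bar R :=
  ereal_inf [set energy [set: R] c U | U in spX].

Definition minimizing_solution_pair (c : R) (U : R -> L) : Prop :=
  0 < c
  /\ classA [set: R] U
  /\ spX U
  /\ solves [set: R] c U
  /\ energy [set: R] c U = 0%E
  /\ inf_energy c = 0%E
  /\ (forall t, U t = proj (U t))
  /\ (exists M : R, exists2 v, 0 < M /\ F Plus v &
        forall t, `|U t - v| <= M * expR (- c * t)).

End Setting.

(* Main.v *)
(* Along a solution U at speed c, G = E(U) - |U'|^2/2 satisfies G' = c |U'|^2.
   Finite energy forces a <= G <= 0 and G -> 0 at +oo, so the identity
   c = -a / int |U'|^2 amounts to G -> a at -oo.  For this, a curve of X near F^-
   is replaced, left of a time t0, by a segment in H to its projection on F^-
   followed by a constant; the glued curve has nonnegative energy, which bounds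
   the energy of the tail after t0 from below and gives, where |U'| is small,
   (G - a)/c <= C' (G - a) + o(1) with C' < 1/gamma.  Since c < gamma, G -> a.

   The bound c <= sqrt(-2a)/d0 (hence c < gamma) comes from G >= a e^{-2c(t - t0)}
   after the last exit time t0 from the r0/2-neighbourhood of F^-, where E >= 0,
   and from AM-GM applied to int |U'|.

   At speeds c' < c, right translates of U have energy tending to -oo.  At speeds
   c' > c, gluing shows that every tail of the energy at speed c is nonnegative
   for every curve of X, and the energy at speed c' is an average of tails.

   Finally, if Ut has zero energy, so has its image under proj, whose speed and
   potential are no larger; hence Ut = proj Ut is a local minimizer and (H6)
   applies. *)

Require Import Defs.
From HB Require Import structures.
From mathcomp Require Import all_boot all_order all_algebra.
From mathcomp Require Import all_classical all_reals all_analysis.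
From mathcomp Require Import measurable_realfun ring lra zify.

Set Implicit Arguments.
Unset Strict Implicit.
Unset Printing Implicit Defensive.

Import Order.TTheory GRing.Theory Num.Theory.
Import numFieldNormedType.Exports.

Local Open Scope ring_scope.
Local Open Scope classical_set_scope.

(** * Measurability and calculus of Hilbert-valued curves *)

(** The map of (H6) is only 1-Lipschitz, so the image of a smooth curve need not be differentiable,
    and a weak derivative must be produced before its energy can be compared. This is the reason for
    the measurability of Hilbert-valued curves, the martingale of difference quotients and the
    fundamental theorem of calculus for weak derivatives. Moreover, the weak derivative inside
    [energy] is an arbitrary choice, known only almost everywhere. Integrals are therefore shown to
    ignore null sets even for nonmeasurable integrands, and energies are then computed with a
    measurable representative. The energy density of a curve of X has an integrable negative part,
    but its positive part may have infinite integral. Sign conditions on energies are therefore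
    written as comparisons between the integrals of the two parts, a form that survives cutting the
    line at a time and averaging over that time. The bound c < gamma enters through the inequality
    [c * tail_cst S < 1]. *)

Section InnerProduct.
Context {R : realType} {V : normedModType R} (ip : {dot V for idfun}).
Context (ipE : forall v, ip v v = `|v| ^+ 2).

Lemma ipC u v : ip u v = ip v u.
Proof. by have := hermC ip u v; rewrite /= expr0 mul1r. Qed.

Lemma ipDl u v w : ip (u + v) w = ip u w + ip v w.
Proof. exact: linearDl. Qed.
Lemma ipBl u v w : ip (u - v) w = ip u w - ip v w.
Proof. exact: linearBl. Qed.
Lemma ipZl (k : R) u w : ip (k *: u) w = k * ip u w.
Proof. exact: linearZl_LR. Qed.
Lemma ipZr (k : R) u w : ip u (k *: w) = k * ip u w.
Proof. by rewrite ipC ipZl ipC. Qed.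
Lemma ipBr u v w : ip u (v - w) = ip u v - ip u w.
Proof. by rewrite ipC ipBl ipC (ipC w). Qed.
Lemma ip0l w : ip 0 w = 0.
Proof. exact: linear0l. Qed.

Lemma ip_CS u v : `|ip u v| <= `|u| * `|v|.
Proof.
have [->|v0] := eqVneq v 0; first by rewrite ipC ip0l !normr0 mulr0.
have nv : 0 < `|v| by rewrite normr_gt0.
have h : 0 <= ip (u - (ip u v / `|v| ^+ 2) *: v) (u - (ip u v / `|v| ^+ 2) *: v).
  by rewrite ipE exprn_ge0.
rewrite !(ipBl, ipBr, ipZl, ipZr) !ipE (ipC v u) in h.
rewrite -ler_sqr ?nnegrE ?mulr_ge0// real_normK ?num_real// exprMn.
have e : ip u v ^+ 2 = `|v| ^+ 2 * (ip u v / `|v| ^+ 2 * ip u v).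
  by field; rewrite gt_eqF.
have e2 : ip u v / `|v| ^+ 2 * (ip u v / `|v| ^+ 2 * `|v| ^+ 2) =
   ip u v / `|v| ^+ 2 * ip u v by field; rewrite gt_eqF.
rewrite e mulrC ler_pM2r ?exprn_gt0//; lra.
Qed.

Lemma cvg_ip (T : Type) (F : set_system T) (FF : Filter F) (f g : T -> V) u v :
  f @ F --> u -> g @ F --> v -> ip (f x) (g x) @[x --> F] --> ip u v.
Proof.
move=> fu gv.
have h : (fun x => ip (f x) (g x) - ip u v) =
  (fun x => ip (f x - u) (g x - v) + ip (f x - u) v + ip u (g x - v)).
  by apply/funext => x; rewrite !(ipBl, ipBr); lra.
apply/subr_cvg0; rewrite h -[0](_ : 0 + 0 + 0 = _); last by rewrite !addr0.
have fu0 : `|f x - u| @[x --> F] --> (0 : R).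
  by rewrite -(@normr0 _ V); apply: cvg_norm; apply/subr_cvg0.
have gv0 : `|g x - v| @[x --> F] --> (0 : R).
  by rewrite -(@normr0 _ V); apply: cvg_norm; apply/subr_cvg0.
apply: cvgD; first apply: cvgD.
- apply: norm_cvg0; apply: (@squeeze_cvgr _ _ _ _ (fun=> 0) (fun x => `|f x - u| * `|g x - v|)).
  + by apply: nearW => x; rewrite normr_ge0 ip_CS.
  + exact: cvg_cst.
  + by rewrite -[0](mul0r (0:R)); exact: cvgM.
- apply: norm_cvg0; apply: (@squeeze_cvgr _ _ _ _ (fun=> 0) (fun x => `|f x - u| * `|v|)).
  + by apply: nearW => x; rewrite normr_ge0 ip_CS.
  + exact: cvg_cst.
  + by rewrite -[0](mul0r `|v|); apply: cvgMl.
- apply: norm_cvg0; apply: (@squeeze_cvgr _ _ _ _ (fun=> 0) (fun x => `|u| * `|g x - v|)).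
  + by apply: nearW => x; rewrite normr_ge0 ip_CS.
  + exact: cvg_cst.
  + by rewrite -[0](mulr0 `|u|); apply: cvgMr.
Qed.

Lemma is_derive_ip (u v : R -> V) (t : R) (du dv : V) :
  is_derive t (1:R) u du -> is_derive t (1:R) v dv ->
  is_derive t (1:R) (fun s : R => ip (u s) (v s)) (ip du (v t) + ip (u t) dv).
Proof.
move=> [du1 du2] [dv1 dv2].
have cu : h^-1 *: (u (h *: 1 + t) - u t) @[h --> 0^'] --> du.
  by rewrite -du2; apply: du1.
have cv : h^-1 *: (v (h *: 1 + t) - v t) @[h --> 0^'] --> dv.
  by rewrite -dv2; apply: dv1.
have vc : v (h *: 1 + t) @[h --> 0^'] --> v t.
  have vt : {for t, continuous v}.
    exact/differentiable_continuous/derivable1_diffP.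
  apply: (@cvg_comp _ _ _ (fun h : R => h *: (1 : R) + t) v _ (nbhs t)); last exact: vt.
  have ht : (fun h : R => h *: (1 : R) + t) @ (nbhs (0 : R)) --> t.
    rewrite -[X in _ --> X]add0r -[in X in _ --> X](scale0r (1:R)).
    by apply: cvgD; [apply: cvgZl; exact: cvg_id | exact: cvg_cst].
    exact: cvg_trans (cvg_app _ (@nbhs_dnbhs _ _)) ht.
suff H : h^-1 *: (ip (u (h *: 1 + t)) (v (h *: 1 + t)) - ip (u t) (v t)) @[h --> 0^']
  --> ip du (v t) + ip (u t) dv.
  by split; [apply/cvg_ex; eexists; exact: H|apply/cvg_lim => //].
rewrite [X in X @ _](_ : _ = (fun h => ip (h^-1 *: (u (h *: 1 + t) - u t)) (v (h *: 1 + t)) +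
   ip (u t) (h^-1 *: (v (h *: 1 + t) - v t)))); last first.
  by apply/funext => h; rewrite !(ipBl, ipBr, ipZl, ipZr) /GRing.scale /=; ring.
apply: cvgD; first exact: cvg_ip.
by apply: cvg_ip => //; exact: cvg_cst.
Qed.

End InnerProduct.

Section NullSets.
Local Open Scope ereal_scope.
Context d (T : measurableType d) (R : realType) (mu : {measure set T -> \bar R}).
Implicit Types (f g : T -> \bar R) (D N : set T).
Import HBNNSimple.

(* The integrands below need not be measurable: the library's integral is then
   a difference of lower integrals, which still ignores null sets. *)
Lemma ge0_le_integral_nonmeas D f g : (forall x, D x -> 0 <= f x) ->
  (forall x, D x -> f x <= g x) -> \int[mu]_(x in D) f x <= \int[mu]_(x in D) g x.
Proof.
move=> f0 fg.
have g0 x : D x -> 0 <= g x by move=> Dx; exact: le_trans (f0 _ Dx) (fg _ Dx).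
rewrite [leLHS]integral_mkcond [leRHS]integral_mkcond !ge0_integralTE; last 2 first.
- by move=> x; rewrite patchE; case: ifP => // /set_mem; exact: g0.
- by move=> x; rewrite patchE; case: ifP => // /set_mem; exact: f0.
apply: ereal_sup_le => _ [h hf <-].
exists h => // x; apply: le_trans (hf x) _.
by rewrite !patchE; case: ifP => // /set_mem xD; exact: fg.
Qed.

(** The integral of a nonnegative function is a supremum over the simple functions below it. Each of
    these is measurable, so cutting it off on [N] keeps its integral and puts it below the cut-off
    function. *)
Let ge0_integralT_null N f : measurable N -> mu N = 0 -> (forall x, 0 <= f x) ->
  \int[mu]_x ((f \_ (~` N)) x) = \int[mu]_x f x.
Proof.
move=> mN N0 f0.
have fN0 x : 0 <= (f \_ (~` N)) x by rewrite patchE; case: ifP.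
apply/eqP; rewrite eq_le; apply/andP; split.
  by apply: ge0_le_integral_nonmeas => // x _; rewrite patchE; case: ifP.
rewrite [leLHS]ge0_integralTE// [leRHS]ge0_integralTE//.
apply: ge_ereal_sup => _ [h hf <-].
have -> : sintegral mu h = \int[mu]_x (h x)%:E.
  by rewrite integral_nnsfun// patch_setT.
rewrite (ge0_negligible_integral mN)//; last first.
- by move=> x _; rewrite lee_fin.
- exact/measurable_EFinP.
rewrite setTD integral_nnsfun; last exact: measurableC.
apply: ereal_sup_ubound; exists (proj_nnsfun h (measurableC mN)).
  move=> x /=; rewrite mindicE patchE; case: ifP => _; rewrite ?mulr1 ?mulr0//.
by congr (sintegral mu _); apply/esym; exact: mrestrict.
Qed.

Lemma integral_null D N f : measurable N -> mu N = 0 ->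
  \int[mu]_(x in D `\` N) f x = \int[mu]_(x in D) f x.
Proof.
move=> mN N0.
have H g : (forall x, 0 <= g x) ->
    \int[mu]_(x in D `\` N) g x = \int[mu]_(x in D) g x.
  move=> g0; rewrite [RHS]integral_mkcond -(ge0_integralT_null mN N0); last first.
    by move=> x; rewrite patchE; case: ifP.
  by rewrite -patch_setI -integral_mkcond setIC -setDE.
by rewrite [LHS]integralE [RHS]integralE !H.
Qed.

Lemma ae_eq_integral_nonmeas D f g : ae_eq mu D f g ->
  \int[mu]_(x in D) f x = \int[mu]_(x in D) g x.
Proof.
move=> [N [mN N0 subN]].
rewrite -(integral_null D f mN N0) -(integral_null D g mN N0).
apply: eq_integral => x; rewrite in_setD => /andP[/set_mem Dx] /negP Nx.
apply: contrapT => fg; apply: Nx; rewrite inE; apply: subN => /= /(_ Dx).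
exact: fg.
Qed.

End NullSets.

Section StronglyMeasurable.
Context {R : realType}.
Local Notation mu := (@lebesgue_measure R).
Implicit Types (V W : normedModType R).

Definition simple_curve V (s : R -> V) : Prop :=
  finite_set (range s) /\
  forall v, measurable (s @^-1` [set v] : set (measurableTypeR R)).

(* Unlike strongly_measurable, the limit is required at every point, so that
   norms and inner products are Borel functions. *)
Definition smeas V (u : R -> V) : Prop :=
  exists2 s : nat -> R -> V, forall n, simple_curve (s n) &
    forall t, s n t @[n --> \oo] --> u t.

Lemma simple_curve_cst V (v : V) : simple_curve (fun=> v).
Proof.
split=> [|w].
  apply: (@sub_finite_set _ _ [set v]); last exact: finite_set1.
  by move=> _ [t _ <-].
have [->|/eqP vw] := eqVneq v w.
  by rewrite (_ : _ @^-1` _ = setT)//; apply/seteqP; split.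
by rewrite (_ : _ @^-1` _ = set0)//; apply/seteqP; split.
Qed.

Lemma simple_curve_comp2 (A B C : normedModType R) (h : A -> B -> C) s s' :
  simple_curve s -> simple_curve s' -> simple_curve (fun t => h (s t) (s' t)).
Proof.
move=> [fs ms] [fs' ms']; split=> [|v].
  apply: (@sub_finite_set _ _ [set h x y | x in range s & y in range s']).
    by move=> _ [t _ <-]; exists (s t); [exists t|exists (s' t); [exists t|]].
  exact: finite_image2.
rewrite (_ : _ @^-1` _ = \bigcup_(x in range s) \bigcup_(y in range s')
    [set t | [/\ s t = x, s' t = y & h x y = v]]); last first.
  apply/seteqP; split=> [t /= <-|t [x _ [y _ [<- <- <-]]]]//=.
  by exists (s t); [exists t|exists (s' t); [exists t|]].
apply: fin_bigcup_measurable => // x _; apply: fin_bigcup_measurable => // y _.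
have [hv|/eqP hv] := eqVneq (h x y) v.
  rewrite (_ : [set _ | _] = s @^-1` [set x] `&` s' @^-1` [set y]).
    by apply: measurableI.
  by apply/seteqP; split=> [t [? ? _]|t [? ?]].
by rewrite (_ : [set _ | _] = set0)//; apply/seteqP; split=> // t [].
Qed.

Lemma simple_curve_comp V W (h : V -> W) s :
  simple_curve s -> simple_curve (fun t => h (s t)).
Proof. by move=> ss; exact: (@simple_curve_comp2 _ _ _ (fun x _ => h x) _ s). Qed.

Lemma simple_curve_if V (A : set R) (s s' : R -> V) :
  measurable (A : set (measurableTypeR R)) ->
  simple_curve s -> simple_curve s' ->
  simple_curve (fun t => if t \in A then s t else s' t).
Proof.
move=> mA [fs ms] [fs' ms']; split=> [|v].
  apply: (@sub_finite_set _ _ (range s `|` range s')).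
    by move=> _ [t _ <-]; case: ifP => _; [left|right]; exists t.
  by rewrite finite_setU.
rewrite (_ : _ @^-1` _ = (A `&` s @^-1` [set v]) `|` (~` A `&` s' @^-1` [set v])).
  by apply: measurableU; apply: measurableI => //; exact: measurableC.
apply/seteqP; split=> t /=.
  by case: ifPn => [/set_mem|/negP tA] ?; [left|right; split => //; apply: contra_not tA; exact: mem_set].
by case=> -[tA <-]; [rewrite mem_set|rewrite memNset].
Qed.

Lemma simple_curve_measurable V (s : R -> V) (h : V -> R) :
  simple_curve s -> measurable_fun setT (fun t => h (s t) : measurableTypeR R).
Proof.
move=> /(simple_curve_comp (W := R^o) h) [fs ms] _ B mB; rewrite setTI.
rewrite (_ : _ @^-1` _ = \bigcup_(x in range (fun t => h (s t)) `&` B)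
  ((fun t => h (s t)) @^-1` [set x])); last first.
  apply/seteqP; split=> [t /= Bt|t [x [_ Bx] /= tx]]; last by rewrite /= tx.
  by exists (h (s t)) => //; split => //; exists t.
apply: fin_bigcup_measurable => [|x _]; last exact: ms.
by apply: sub_finite_set fs => x [].
Qed.

Lemma smeas_measurable V (u : R -> V) (h : V -> R) : smeas u -> continuous h ->
  measurable_fun setT (fun t => h (u t) : measurableTypeR R).
Proof.
move=> [s ss su] ch.
apply: (measurable_fun_cvg (h := fun n t => h (s n t))) => //.
  by move=> n; exact: simple_curve_measurable.
by move=> t _; apply: (cvg_comp _ _ (su t)); exact: ch.
Qed.

Lemma smeas_comp2 (A B C : normedModType R) (h : A -> B -> C) u v :
  continuous (fun p => h p.1 p.2) -> smeas u -> smeas v -> smeas (fun t => h (u t) (v t)).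
Proof.
move=> ch [s ss su] [s' ss' sv].
exists (fun n t => h (s n t) (s' n t)).
  by move=> n; exact: simple_curve_comp2.
move=> t; apply: (@cvg_comp _ _ _ (fun n => (s n t, s' n t)) (fun p => h p.1 p.2) _ (nbhs (u t, v t))).
  by apply: cvg_pair.
exact: (ch (u t, v t)).
Qed.

Lemma smeasB V (u v : R -> V) : smeas u -> smeas v -> smeas (fun t => u t - v t).
Proof.
apply: (smeas_comp2 (h := fun x y => x - y)) => p.
by apply: cvgB; [exact: cvg_fst|exact: cvg_snd].
Qed.

Lemma smeas_if V (A : set R) (u v : R -> V) :
  measurable (A : set (measurableTypeR R)) -> smeas u -> smeas v ->
  smeas (fun t => if t \in A then u t else v t).
Proof.
move=> mA [s ss su] [s' ss' sv].
exists (fun n t => if t \in A then s n t else s' n t).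
  by move=> n; exact: simple_curve_if.
by move=> t; case: ifP.
Qed.

Lemma smeas_cst V (v : V) : smeas (fun=> v).
Proof. by exists (fun _ _ => v) => [n|t]; [exact: simple_curve_cst|exact: cvg_cst]. Qed.

Lemma smeas_strongly V (I : set R) (u : R -> V) : smeas u -> strongly_measurable I u.
Proof.
move=> [s ss su]; exists s; split => //.
by exists set0; split => // t /= h; exfalso; apply: h => _; exact: su.
Qed.

(** Setting the curve and its approximants to 0 on the exceptional null set turns almost everywhere
    convergence into convergence at every point. *)
Lemma strongly_smeas V (u : R -> V) : strongly_measurable setT u ->
  exists2 u', smeas u' & ae_eq mu setT u u'.
Proof.
move=> [s [ss [N [mN N0 subN]]]].
exists (fun t => if t \in N then 0 else u t).
  exists (fun n t => if t \in N then 0 else s n t).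
    move=> n; apply: simple_curve_if => //; exact: simple_curve_cst.
  move=> t; case: ifPn => [_|/negP tN]; first exact: cvg_cst.
  apply: contrapT => h; apply: tN; apply/mem_set/subN => /= h'.
  by apply: h; exact: h'.
exists N; split => // t /= h; apply: contrapT => tN; apply: h => _.
by rewrite memNset.
Qed.

Lemma strongly_measurable_ae V (u u' : R -> V) : ae_eq mu setT u u' ->
  strongly_measurable setT u -> strongly_measurable setT u'.
Proof.
move=> uu' [s [ss su]]; exists s; split => //.
apply: (negligibleS _ (negligibleU su uu')) => t /= h.
apply: contrapT => /not_orP[/contrapT su_t /contrapT uu'_t]; apply: h => _.
by rewrite -uu'_t//; exact: su_t.
Qed.

End StronglyMeasurable.

Section Dyadic.
Context {R : realType}.

Definition dyadic_floor n (t : R) : R := (Num.floor (2 ^+ n * t))%:~R / 2 ^+ n.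

(** The cut-off makes the range finite, as [simple_curve] demands. The cut-off [N] and the
    generation [n] are kept apart because difference quotients need a fixed generation, or one that
    runs along a subsequence, while [N] tends to infinity. *)
Definition dyadic_clip N n (t : R) : R :=
  if t \in `[- N%:R, N%:R[%classic then dyadic_floor n t else 0.

Lemma pow2_gt0 n : 0 < (2 : R) ^+ n.
Proof. exact: exprn_gt0. Qed.

Lemma dyadic_floor_itv n t :
  dyadic_floor n t <= t < dyadic_floor n t + (2 ^+ n)^-1.
Proof.
have /andP[h1 h2] := floor_itv (2 ^+ n * t).
rewrite /dyadic_floor ler_pdivrMr ?pow2_gt0// [t * _]mulrC h1/=.
by rewrite -[X in _ + X]mul1r -mulrDl ltr_pdivlMr ?pow2_gt0// [t * _]mulrC -[1]/(1%:~R) -intrD.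
Qed.

Lemma dyadic_clip_simple N n : simple_curve (dyadic_clip N n : R -> R^o).
Proof.
have nz : (2 : R) ^+ n != 0 by rewrite gt_eqF ?pow2_gt0.
split=> [|v].
  apply: (@sub_finite_set _ _ ([set 0] `|`
      [set (i%:R - (N * 2 ^ n)%:R) / 2 ^+ n | i in `I_(N * 2 ^ n).*2.+1])); last first.
    by rewrite finite_setU; split; [exact: finite_set1|exact/finite_image/finite_II].
  move=> _ [t _ <-]; rewrite /dyadic_clip; case: ifPn => [|_]; last by left.
  move=> /set_mem; rewrite /= in_itv/= => /andP[t1 t2]; right.
  have e : (N * 2 ^ n)%:R = N%:R * 2 ^+ n :> R by rewrite natrM natrX.
  have f1 : (- (N * 2 ^ n)%:Z <= Num.floor (2 ^+ n * t)).
    rewrite floor_ge_int mulrNz -pmulrn e -mulNr mulrC ler_pM2l ?pow2_gt0//.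
  have f2 : (Num.floor (2 ^+ n * t) < (N * 2 ^ n)%:Z).
    by rewrite floor_lt_int -pmulrn e mulrC ltr_pM2r ?pow2_gt0.
  exists (absz (Num.floor (2 ^+ n * t) + (N * 2 ^ n)%N%:Z)%R).
    rewrite /= -ltz_nat gez0_abs; lia.
  rewrite /dyadic_floor; congr (_ / _).
  by rewrite (pmulrn (R := R)) gez0_abs ?intrD ?addrK//; lia.
have mI : measurable (`[- N%:R, N%:R[%classic : set (measurableTypeR R)).
  exact: measurable_itv.
rewrite (_ : _ @^-1` _ = (`[- N%:R, N%:R[%classic `&`
   [set t | dyadic_floor n t = v]) `|` (~` `[- N%:R, N%:R[%classic `&` [set _ | 0 = v])).
  apply: measurableU; apply: measurableI => //.
  - have [[k kv]|nk] := pselect (exists k : int, k%:~R / 2 ^+ n = v).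
      rewrite (_ : [set _ | _] = `[v, v + (2 ^+ n)^-1[%classic).
        exact: measurable_itv.
      apply/seteqP; split=> t /=.
        by move=> <-; rewrite in_itv/= dyadic_floor_itv.
      rewrite in_itv/= -kv => /andP[t1 t2]; rewrite /dyadic_floor; congr (_%:~R / _).
      apply: floor_def; rewrite mulrC -ler_pdivrMr ?pow2_gt0// t1/=.
      by rewrite -ltr_pdivlMr ?pow2_gt0// intrD mulrDl mul1r.
    rewrite (_ : [set _ | _] = set0)//; apply/seteqP; split => // t /= tv.
    by apply: nk; eexists; exact: tv.
  - exact: measurableC.
  - have [->|/eqP v0] := eqVneq 0 v.
      by rewrite (_ : [set _ | _] = setT)//; apply/seteqP; split.
    by rewrite (_ : [set _ | _] = set0)//; apply/seteqP; split.
apply/seteqP; split=> t; rewrite /dyadic_clip/=.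
  by case: ifPn => [/set_mem|/negP tA] ?; [left|right; split => //; apply: contra_not tA; exact: mem_set].
by case=> -[tA <-]; [rewrite mem_set|rewrite memNset].
Qed.

Lemma pow2V_cvg0 : (2 ^+ n : R)^-1 @[n --> \oo] --> (0 : R).
Proof.
apply/cvgrPdist_lt => e e0; near=> n.
rewrite sub0r normrN ger0_norm ?invr_ge0 ?ltW ?pow2_gt0//.
rewrite -[ltLHS]div1r.
by near: n; exact: (near_infty_natSinv_expn_lt (PosNum e0)).
Unshelve. all: by end_near. Qed.

Lemma dyadic_clip_near (n_ : nat -> nat) t : \forall N \near \oo,
  dyadic_clip N (n_ N) t = dyadic_floor (n_ N) t.
Proof.
near=> N; rewrite /dyadic_clip mem_set//= in_itv/=.
have : `|t| < N%:R by near: N; exact: nbhs_infty_gtr.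
by rewrite ltr_norml => /andP[/ltW -> ->].
Unshelve. all: by end_near. Qed.

Lemma dyadic_floor_cvg t : dyadic_floor n t @[n --> \oo] --> t.
Proof.
apply: (@squeeze_cvgr _ _ _ _ (fun n => t - (2 ^+ n)^-1) (fun=> t)).
- apply: nearW => n; have /andP[h1 h2] := dyadic_floor_itv n t.
  by rewrite h1 andbT lerBlDr ltW.
- by rewrite -[X in _ --> X]subr0; apply: cvgB; [exact: cvg_cst|exact: pow2V_cvg0].
- exact: cvg_cst.
Qed.

Lemma dyadic_clip_cvg t : dyadic_clip n n t @[n --> \oo] --> t.
Proof.
apply: (cvg_trans _ (@dyadic_floor_cvg t)); apply: near_eq_cvg.
by apply: filterS (dyadic_clip_near id t) => n ->.
Qed.

Lemma continuous_smeas (V : normedModType R) (u : R -> V) : continuous u -> smeas u.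
Proof.
move=> cu; exists (fun n t => u (dyadic_clip n n t)).
  by move=> n; exact: (@simple_curve_comp R R^o V u _ (dyadic_clip_simple n n)).
by move=> t; apply: (cvg_comp _ _ (@dyadic_clip_cvg t)); exact: cu.
Qed.

End Dyadic.

Section LocallyIntegrable.
Context {R : realType}.
Local Notation mu := (@lebesgue_measure R).
Implicit Types (f g h : R -> R).

Definition locint f : Prop := forall x y : R, mu.-integrable `[x, y] (EFin \o f).

Let mI (x y : R) : measurable (`[x, y]%classic : set (measurableTypeR R)).
Proof. exact: measurable_itv. Qed.

Lemma continuous_locint f : continuous f -> locint f.
Proof.
move=> cf x y; apply: continuous_compact_integrable; first exact: segment_compact.
exact: continuous_subspaceT.
Qed.

Lemma locintD f g : locint f -> locint g -> locint (fun x => f x + g x).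
Proof.
move=> fi gi x y.
have := integrableD (@mI x y) (fi x y) (gi x y).
by apply: eq_integrable => //; exact: mI.
Qed.

Lemma locintZ (k : R) f : locint f -> locint (fun x => k * f x).
Proof.
move=> fi x y.
have := integrableZl (@mI x y) k (fi x y).
by apply: eq_integrable => //; exact: mI.
Qed.

Lemma locint_norm f : locint f -> locint (fun x => `|f x|).
Proof.
move=> fi x y; have := integrable_abse (fi x y).
by apply: eq_integrable => //; exact: mI.
Qed.

Lemma le_locint f g : measurable_fun setT f -> (forall x, `|f x| <= g x) ->
  locint g -> locint f.
Proof.
move=> mf fg gi x y; apply: le_integrable (gi x y) => //.
- by apply/measurable_EFinP; exact: measurable_funTS.
- move=> z _ /=; rewrite lee_fin (le_trans (fg z))//; exact: ler_norm.
Qed.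

Lemma Rintegral_chasles f x y z : locint f -> x <= y -> y <= z ->
  \int[mu]_(t in `[x, z]) f t = \int[mu]_(t in `[x, y]) f t + \int[mu]_(t in `[y, z]) f t.
Proof.
move=> fi xy yz.
have := @Rintegral_itvB R f (BLeft x) (BRight z) y (fi x z).
rewrite !bnd_simp => /(_ xy yz) => e.
apply/eqP; rewrite addrC -subr_eq e Rintegral_itv_obnd_cbnd//.
apply: (integrableS _ _ _ (fi x z)); [exact: mI|exact: measurable_itv|].
by move=> t; rewrite /= !in_itv/= => /andP[yt ->]; rewrite (le_trans xy)// ltW.
Qed.

Lemma le_locRintegral f g x y : locint f -> locint g ->
  (forall t, x <= t <= y -> f t <= g t) ->
  \int[mu]_(t in `[x, y]) f t <= \int[mu]_(t in `[x, y]) g t.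
Proof.
move=> fi gi fg; apply: le_Rintegral => // t; rewrite /= in_itv/=; exact: fg.
Qed.

Lemma normr_locRintegral f x y : locint f ->
  `|\int[mu]_(t in `[x, y]) f t| <= \int[mu]_(t in `[x, y]) `|f t|.
Proof. by move=> fi; apply: le_normr_Rintegral => //; exact: mI. Qed.

Lemma locRintegralD f g x y : locint f -> locint g ->
  \int[mu]_(t in `[x, y]) (f t + g t) =
  \int[mu]_(t in `[x, y]) f t + \int[mu]_(t in `[x, y]) g t.
Proof. by move=> fi gi; apply: RintegralD => //; exact: mI. Qed.

Lemma locRintegralZ (k : R) f x y : locint f ->
  \int[mu]_(t in `[x, y]) (k * f t) = k * \int[mu]_(t in `[x, y]) f t.
Proof. by move=> fi; apply: RintegralZl => //; exact: mI. Qed.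

Lemma Rintegral_itv_cst (k x y : R) : x <= y ->
  \int[mu]_(t in `[x, y]) k = k * (y - x).
Proof.
move=> xy; rewrite Rintegral_cst; last exact: mI.
congr (_ * _); rewrite -[RHS]/(fine (y - x)%:E); congr fine.
apply: etrans (@lebesgue_measure_itv R (Interval (BLeft x) (BRight y))) _.
by move: xy; rewrite /= lte_fin le_eqVlt => /predU1P[->|->//]; rewrite ltxx subrr.
Qed.

Lemma FTC2 f F x y : x <= y -> continuous f -> (forall t, is_derive t (1:R) F (f t)) ->
  \int[mu]_(t in `[x, y]) f t = F y - F x.
Proof.
rewrite le_eqVlt => /predU1P[->|xy] cf dF.
  by rewrite set_itv1 Rintegral_set1 subrr.
have cF : continuous F.
  by move=> t; apply/differentiable_continuous/derivable1_diffP; case: (dF t).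
rewrite /Rintegral (@continuous_FTC2 _ _ F)//.
- exact: continuous_subspaceT.
- split.
  + by move=> t _; case: (dF t).
  + by apply: cvg_at_right_filter; exact: cF.
  + by apply: cvg_at_left_filter; exact: cF.
- by move=> t _; rewrite derive1E; apply: derive_val.
Qed.

End LocallyIntegrable.

(** * Smooth cut-off functions *)

Section SmoothStep.
Context {R : realType}.
Implicit Types (f g : R -> R) (p q : {poly R}).

(* The derivatives of exp(-1/x), extended by 0 to x <= 0, all have this form. *)
Definition flat p (x : R) : R := if 0 < x then p.[x^-1] * expR (- x^-1) else 0.

Lemma poly_expR_cvg0 p : p.[x] * expR (- x) @[x --> +oo] --> (0 : R).
Proof.
pose n := size p; pose S := \sum_(i < n) `|p`_i|.
have S0 : 0 <= S by apply: sumr_ge0.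
have pS x : 1 <= x -> `|p.[x]| <= S * x ^+ n.
  move=> x1; rewrite horner_coef mulr_suml (le_trans (ler_norm_sum _ _ _))//.
  apply: ler_sum => i _; rewrite normrM ler_wpM2l// ger0_norm ?exprn_ge0//; last lra.
  by rewrite ler_weXn2l// ltnW.
have bnd x : 1 <= x -> `|p.[x] * expR (- x)| <= S * n.+1`!%:R * x^-1.
  move=> x1; have x0 : 0 < x by lra.
  rewrite normrM (ger0_norm (expR_ge0 _)) expRN ler_pdivrMr ?expR_gt0//.
  apply: le_trans (pS _ x1) _; rewrite -!mulrA; apply: ler_wpM2l => //.
  have := @expR_ge1Dxn R x n (ltW x0) => h.
  have {}h : x ^+ n.+1 / n.+1`!%:R <= expR x by lra.
  rewrite ler_pdivrMr ?ltr0n ?fact_gt0// exprS in h.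
  rewrite mulrCA -ler_pdivrMl ?invr_gt0// invrK; apply: le_trans h _.
  by rewrite mulrC.
apply/cvgrPdist_le => e e0; near=> x.
have x1 : 1 <= x by near: x; exact: nbhs_pinfty_ge.
rewrite sub0r normrN (le_trans (bnd _ x1))// ler_pdivrMr; last by lra.
by rewrite -ler_pdivrMl//.
Unshelve. all: by end_near. Qed.

Lemma flat_le0 p x : x <= 0 -> flat p x = 0.
Proof. by rewrite /flat leNgt => /negbTE ->. Qed.

Lemma flat_cvg0 p : flat p h @[h --> (0 : R)^'] --> (0 : R).
Proof.
have /cvgrPdist_lt cp := @poly_expR_cvg0 p.
apply/cvgrPdist_lt => e e0; have [M [_ HM]] := cp _ e0.
near=> h; have [h0|h0] := leP h 0; first by rewrite flat_le0// subrr normr0.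
rewrite /flat h0; apply: HM.
apply: (@le_lt_trans _ _ `|M|); first exact: ler_norm.
have M1 : 0 < `|M| + 1 by apply: ltr_wpDl.
apply: (@lt_trans _ _ (`|M| + 1)); first by rewrite ltrDl.
rewrite -[ltLHS]invrK ltf_pV2 ?posrE ?invr_gt0//.
apply: le_lt_trans (ler_norm _) _.
by near: h; apply: dnbhs0_lt; rewrite invr_gt0.
Unshelve. all: by end_near. Qed.

(** The derivative of [p(1/x) exp(-1/x)] is [x^-2 (p - p')(1/x) exp(-1/x)], and [x^-2] is the value
    of ['X^2] at [1/x]. *)
Lemma flat_derive p x :
  is_derive x (1:R) (flat p) (flat ('X^2 * (p - p^`())) x).
Proof.
have [x0|x0|->] := ltgtP x 0.
- rewrite flat_le0 ?ltW//; apply: (near_eq_is_derive (f := fun=> 0)).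
    by near=> y; rewrite flat_le0// ltW//; near: y; exact: lt_nbhsl.
- apply: (@near_eq_is_derive R R^o R^o (fun y : R => p.[y^-1] * expR (- y^-1)) (flat p)).
  + by near=> y; rewrite /flat ifT//; near: y; exact: lt_nbhsr.
  + have xn0 : x != 0 by rewrite gt_eqF.
    have dV : is_derive x (1:R) (fun y : R => y^-1) (- x ^- 2).
      apply: is_derive_eq (is_deriveV xn0 (is_derive_id _ _)) _.
      by rewrite /GRing.scale/= mulr1.
    have dp : is_derive x^-1 (1:R) (horner p) (p^`()).[x^-1].
      by split; [exact: derivable_horner|rewrite -derive1E derivE].
    have h1 := is_derive1_comp dp dV.
    have h2 : is_derive x (1:R) (fun y : R => - y^-1) (x ^- 2).
      by apply: is_derive_eq (is_deriveN dV) _; rewrite opprK.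
    have h3 := @is_derive1_comp R expR (fun y : R => - y^-1) x _ _ (is_derive_expR (- x^-1)) h2.
    apply: is_derive_eq (is_deriveM h1 h3) _.
    rewrite /flat x0 !hornerE/= /GRing.scale/= -!exprVn; ring.
- rewrite flat_le0//; have f0 := @flat_le0 p 0 (lexx _).
  (* At 0 the difference quotient is itself of the same form, with polynomial ['X * p], and so tends
     to 0. *)
  suff H : h^-1 *: (flat p (h *: (1:R) + 0) - flat p 0) @[h --> (0:R)^'] --> (0 : R).
    by split; [apply/cvg_ex; eexists; exact: H|apply/cvg_lim => //].
  apply: cvg_trans (@flat_cvg0 ('X * p)); apply: near_eq_cvg; near=> h.
  rewrite f0 subr0 addr0 /GRing.scale/= mulr1 /flat; case: ifP => h0; last by rewrite mulr0.
  by rewrite hornerM hornerX mulrA.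
Unshelve. all: by end_near. Qed.

(* A class of functions containing exp(-1/x) and closed under differentiation. *)
Inductive smooth_class : (R -> R) -> Prop :=
| smooth_flat p : smooth_class (flat p)
| smooth_cst c : smooth_class (fun=> c)
| smooth_add f g : smooth_class f -> smooth_class g -> smooth_class (fun x => f x + g x)
| smooth_mul f g : smooth_class f -> smooth_class g -> smooth_class (fun x => f x * g x)
| smooth_affine a b f : smooth_class f -> smooth_class (fun x => f (a * x + b))
| smooth_inv f : smooth_class f -> (forall x, 0 < f x) -> smooth_class (fun x => (f x)^-1).

Lemma smooth_class_derive f : smooth_class f ->
  exists2 g, smooth_class g & forall x, is_derive x (1:R) f (g x).
Proof.
elim=> {f} [p|c|f g _ [f' sf' df] _ [g' sg' dg]|f g sf [f' sf' df] sg [g' sg' dg]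
    |a b f _ [f' sf' df]|f sf [f' sf' df] f0].
- by exists (flat ('X^2 * (p - p^`()))); [exact: smooth_flat|exact: flat_derive].
- by exists (fun=> 0) => [|x]; [exact: smooth_cst|exact: is_derive_cst].
- exists (fun x => f' x + g' x) => [|x]; first exact: smooth_add.
  exact: is_deriveD.
- exists (fun x => f x * g' x + g x * f' x) => [|x].
    by apply: smooth_add; exact: smooth_mul.
  exact: is_deriveM.
- exists (fun x => a * f' (a * x + b)) => [|x].
    by apply: smooth_mul; [exact: smooth_cst|exact: smooth_affine].
  have h : is_derive x (1:R) (fun x : R => a * x + b) a.
    apply: is_derive_eq (is_deriveD (is_deriveZ a (is_derive_id x (1:R))) (is_derive_cst b x (1:R))) _.
    by rewrite addr0 /GRing.scale/= mulr1.
  rewrite mulrC; exact: (@is_derive1_comp _ f (fun x : R => a * x + b) x _ _ (df _) h).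
- exists (fun x => -1 * ((f x)^-1 * (f x)^-1 * f' x)) => [|x].
    apply: smooth_mul; first exact: smooth_cst.
    apply: smooth_mul => //; apply: smooth_mul; exact: smooth_inv.
  have fx0 : f x != 0 by rewrite gt_eqF.
  apply: is_derive_eq (is_deriveV fx0 (df x)) _.
  by rewrite /GRing.scale/= mulN1r mulNr -expr2 exprVn.
Qed.

Lemma smooth_class_derivable f : smooth_class f ->
  forall n t, derivable (derive1n n f) t 1.
Proof.
move=> sf n t; suff sn : smooth_class (derive1n n f).
  by have [g _ dg] := smooth_class_derive sn; case: (dg t).
elim: n => // n IH; have [g sg dg] := smooth_class_derive IH.
rewrite derive1nS (_ : (derive1n n f)^`() = g)//.
by apply/funext => x; rewrite derive1E; exact: derive_val.
Qed.

Definition smooth_step (x : R) : R :=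
  flat 1 x * (flat 1 x + flat 1 (-1 * x + 1))^-1.

Lemma flat1_ge0 x : 0 <= flat 1 x.
Proof. by rewrite /flat; case: ifP => // _; rewrite hornerC mul1r expR_ge0. Qed.

Lemma flat1_gt0 x : 0 < x -> 0 < flat 1 x.
Proof. by rewrite /flat => ->; rewrite hornerC mul1r expR_gt0. Qed.

Lemma flat1_le0 x : x <= 0 -> flat 1 x = 0.
Proof. by rewrite /flat leNgt => /negbTE ->. Qed.

Lemma flat1_sum_gt0 x : 0 < flat 1 x + flat 1 (-1 * x + 1).
Proof.
have [x0|x0] := ltP 0 x; first by rewrite ltr_wpDr ?flat1_ge0 ?flat1_gt0.
by rewrite ltr_wpDl ?flat1_ge0 ?flat1_gt0//; lra.
Qed.

Lemma smooth_step_class : smooth_class smooth_step.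
Proof.
apply: smooth_mul; first exact: smooth_flat.
apply: smooth_inv flat1_sum_gt0; apply: smooth_add; first exact: smooth_flat.
exact/smooth_affine/smooth_flat.
Qed.

Lemma smooth_step0 x : x <= 0 -> smooth_step x = 0.
Proof. by move=> x0; rewrite /smooth_step flat1_le0// mul0r. Qed.

Lemma smooth_step1 x : 1 <= x -> smooth_step x = 1.
Proof.
move=> x1; rewrite /smooth_step (@flat1_le0 (-1 * x + 1)); last by lra.
by rewrite addr0 divff// gt_eqF// flat1_gt0//; lra.
Qed.

Lemma smooth_step_itv x : 0 <= smooth_step x <= 1.
Proof.
rewrite /smooth_step divr_ge0 ?flat1_ge0 ?(ltW (flat1_sum_gt0 _))//=.
by rewrite ler_pdivrMr ?flat1_sum_gt0// mul1r lerDl flat1_ge0.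
Qed.

End SmoothStep.

Section DominatedConvergence.
Context {R : realType}.
Local Notation mu := (@lebesgue_measure R).

Lemma locRintegral_dominated (f_ : nat -> R -> R) (f h : R -> R) (a b : R) :
  (forall n, measurable_fun setT (f_ n)) -> measurable_fun setT f ->
  (forall n x, a <= x <= b -> `|f_ n x| <= h x) -> locint h ->
  {ae mu, forall x, f_ n x @[n --> \oo] --> f x} ->
  \int[mu]_(x in `[a, b]) f_ n x @[n --> \oo] --> \int[mu]_(x in `[a, b]) f x.
Proof.
move=> mf_ mf fh ih cf.
have mD : measurable (`[a, b]%classic : set (measurableTypeR R)).
  exact: measurable_itv.
have H1 n : measurable_fun (`[a, b]%classic : set (measurableTypeR R)) (EFin \o f_ n).
  by apply/measurable_EFinP/measurable_funTS; exact: mf_.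
have H2 : measurable_fun (`[a, b]%classic : set (measurableTypeR R)) (EFin \o f).
  exact/measurable_EFinP/measurable_funTS.
have H3 : {ae mu, forall x, `[a, b]%classic x -> (fun n => (EFin \o f_ n) x) @ \oo --> (EFin \o f) x}.
  move: cf; apply: filterS; first exact: (ae_filter_ringOfSetsType mu).
  move=> x fx _; apply/fine_cvgP; split; first exact: nearW.
  exact: fx.
have H4 : {ae mu, forall x n, `[a, b]%classic x -> (`|(EFin \o f_ n) x| <= (EFin \o h) x)%E}.
  by apply: aeW => x n; rewrite lee_fin /= in_itv/=; exact: fh.
have [ig _ cg] := dominated_convergence mD H1 H2 H3 (ih a b) H4.
have fin := integrable_fin_num mD ig.
by rewrite /Rintegral; apply: fine_cvg; rewrite fineK.
Qed.

End DominatedConvergence.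

(** * Weak derivatives and the fundamental theorem of calculus *)

Section Mollify.
Context {R : realType}.
Local Notation mu := (@lebesgue_measure R).
Implicit Types (f g : R -> R).

Lemma flat1_nondecreasing : {homo (@flat R 1) : x y / x <= y}.
Proof.
move=> x y xy; have [x0|x0] := leP x 0; first by rewrite flat_le0// flat1_ge0.
have y0 : 0 < y by exact: lt_le_trans xy.
by rewrite /flat x0 y0 !hornerC !mul1r ler_expR lerN2 lef_pV2 ?posrE.
Qed.

Lemma smooth_step_nondecreasing : {homo (@smooth_step R) : x y / x <= y}.
Proof.
move=> x y xy; rewrite /smooth_step ler_pdivrMr ?flat1_sum_gt0// mulrAC.
rewrite ler_pdivlMr ?flat1_sum_gt0// !mulrDr mulrC lerD2l.
apply: ler_pM; rewrite ?flat1_ge0 ?flat1_nondecreasing//; lra.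
Qed.

(** A one-sided mollifier: nonnegative, zero outside [[0, 1]], of mass 1 because the step climbs
    from 0 to 1. Its rescalings at [x0] live in [[x0, x0 + 1]], whence the condition [x0 + 1 <= b]
    below. *)
Definition bump : R -> R := derive1 smooth_step.

Lemma is_derive_smooth_step x : is_derive x (1:R) smooth_step (bump x).
Proof.
split; last by rewrite /bump derive1E.
exact: (@smooth_class_derivable _ _ (@smooth_step_class R) 0%N x).
Qed.

Lemma bump_continuous : continuous bump.
Proof.
move=> x; apply/differentiable_continuous/derivable1_diffP.
exact: (@smooth_class_derivable _ _ (@smooth_step_class R) 1%N x).
Qed.

Lemma bump_ge0 x : 0 <= bump x.
Proof.
have [d1 _] := is_derive_smooth_step x.
rewrite /bump derive1E /derive.
apply: limr_ge; first exact: d1.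
near=> h; rewrite /GRing.scale/= mulr1.
have [h0|h0] := leP 0 h.
  by rewrite mulr_ge0 ?invr_ge0// subr_ge0 smooth_step_nondecreasing//; lra.
by apply: mulr_le0; rewrite ?invr_le0 ?subr_le0 ?smooth_step_nondecreasing//; lra.
Unshelve. all: by end_near. Qed.

Lemma bump_out x : x < 0 \/ 1 < x -> bump x = 0.
Proof.
move=> x01; rewrite /bump derive1E.
rewrite (@near_eq_derive R R^o R^o _ (cst (if x < 0 then 0 else 1))) ?derive_cst//.
case: x01 => x0; near=> y.
  by rewrite x0/= smooth_step0// ltW//; near: y; exact: lt_nbhsl.
rewrite ltNge (ltW (lt_trans ltr01 x0))/= smooth_step1// ltW//.
by near: y; exact: lt_nbhsr.
Unshelve. all: by end_near. Qed.

Lemma is_derive_step_scaled (k x0 x : R) :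
  is_derive x (1:R) (fun x => smooth_step (k * (x - x0))) (k * bump (k * (x - x0))).
Proof.
have h : is_derive x (1:R) (fun x : R => k * (x - x0)) k.
  apply: is_derive_eq (is_deriveZ k (is_deriveB (is_derive_id x (1:R)) (is_derive_cst x0 x (1:R)))) _.
  by rewrite subr0 /GRing.scale/= mulr1.
rewrite mulrC.
exact: (@is_derive1_comp R smooth_step (fun x : R => k * (x - x0)) x _ _ (is_derive_smooth_step _) h).
Qed.

Lemma bump_scaled_continuous (k x0 : R) : continuous (fun x => k * bump (k * (x - x0))).
Proof.
move=> x; apply: cvgMr; apply: (@cvg_comp _ _ _ _ bump _ (nbhs (k * (x - x0)))).
  by apply: cvgMr; apply: cvgB; [exact: cvg_id|exact: cvg_cst].
exact: bump_continuous.
Qed.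

Lemma bump_scaled_mass (a b x0 k : R) : 1 <= k -> a <= x0 -> x0 + 1 <= b ->
  \int[mu]_(x in `[a, b]) (k * bump (k * (x - x0))) = 1.
Proof.
move=> k1 ax xb; have ab : a <= b by lra.
rewrite (FTC2 ab (@bump_scaled_continuous k x0) (is_derive_step_scaled k x0)).
rewrite smooth_step1 ?smooth_step0 ?subr0//.
  by rewrite mulr_ge0_le0//; lra.
by rewrite (le_trans k1)// ler_peMr//; lra.
Qed.

Lemma bump_dirac f (a b x0 : R) : continuous f -> a <= x0 -> x0 + 1 <= b ->
  \int[mu]_(x in `[a, b]) (k.+1%:R * bump (k.+1%:R * (x - x0)) * f x) @[k --> \oo] --> f x0.
Proof.
move=> cf ax xb; apply/cvgrPdist_le => e e0.
have := cf x0 => /cvgrPdist_lt/(_ _ e0)[d /= d0 hd].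
near=> k; pose K : R := k.+1%:R.
have K1 : 1 <= K by rewrite ler1n.
have cbf : continuous (fun x => K * bump (K * (x - x0)) * f x).
  by move=> x; apply: cvgM; [exact: bump_scaled_continuous|exact: cf].
have cb0 : continuous (fun x => K * bump (K * (x - x0)) * f x0).
  by move=> x; apply: cvgMl; exact: bump_scaled_continuous.
have -> : f x0 = \int[mu]_(x in `[a, b]) (f x0 * (K * bump (K * (x - x0)))).
  rewrite locRintegralZ ?(bump_scaled_mass K1)// ?mulr1//.
  exact/continuous_locint/bump_scaled_continuous.
have l1 : locint (fun x => f x0 * (K * bump (K * (x - x0)))).
  exact/locintZ/continuous_locint/bump_scaled_continuous.
have l2 : locint (fun x => -1 * (K * bump (K * (x - x0)) * f x)).
  exact/locintZ/continuous_locint.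
rewrite -[X in _ - X]mul1r -mulNr -locRintegralZ; last exact: continuous_locint.
rewrite -locRintegralD//; apply: le_trans (normr_locRintegral _ _ (locintD l1 l2)) _.
rewrite [leRHS](_ : e = \int[mu]_(x in `[a, b]) (e * (K * bump (K * (x - x0))))); last first.
  rewrite locRintegralZ ?(bump_scaled_mass K1)// ?mulr1//.
  exact/continuous_locint/bump_scaled_continuous.
apply: le_locRintegral.
- exact/locint_norm/locintD.
- exact/locintZ/continuous_locint/bump_scaled_continuous.
move=> x _; rewrite mulN1r [_ * f x]mulrC -mulrBl normrM.
rewrite [`|K * _|]ger0_norm ?mulr_ge0 ?bump_ge0//.
have [Kx|Kx] := pselect (0 <= K * (x - x0) <= 1); last first.
  rewrite bump_out ?mulr0//; apply/orP.
  by move/negP: Kx; rewrite negb_and -!ltNge.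
have K0 : 0 < K by lra.
apply: ler_wpM2r; first by rewrite mulr_ge0 ?bump_ge0.
apply/ltW/hd => /=.
have /andP[] := Kx; rewrite pmulr_rge0// => xx0 Kx1.
rewrite distrC ger0_norm//.
have : x - x0 <= K^-1.
  by rewrite -[leRHS]mulr1 ler_pdivlMl.
move=> /le_lt_trans; apply; rewrite /K.
by near: k; exact: near_infty_natSinv_lt (PosNum d0).
Unshelve. all: by end_near. Qed.

End Mollify.

Section WeakDerivative.
Context {R : realType} (S : setting R).
Local Notation L := (spL S).
Local Notation mu := (@lebesgue_measure R).
Local Notation "<< u , v >>" := (@ipL R S u v).
Implicit Types (U V W : R -> L).

Let ipE := @ipL_norm R S.

Lemma continuous_ip (w : L) : continuous (fun v : L => <<v, w>>).
Proof. by move=> v; apply: (cvg_ip ipE); [exact: cvg_id|exact: cvg_cst]. Qed.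

(** The representatives of [L2loc] curves with which all computations are made: norms and inner
    products are measurable functions, so the real integrals built from them are additive. *)
Definition smL2 V : Prop := smeas V /\ locint (fun t => `|V t| ^+ 2).

Lemma smL2_ip V w : smL2 V -> locint (fun t => <<V t, w>>).
Proof.
move=> [mV iV]; apply: (@le_locint _ _ (fun t => `|w| * (1 + `|V t| ^+ 2))).
- exact: (smeas_measurable mV (@continuous_ip w)).
- move=> t; apply: le_trans (ip_CS ipE _ _) _; rewrite mulrC ler_wpM2l//.
  have := sqr_ge0 (`|V t| - 1); rewrite sqrrB1 expr2.
  by have := normr_ge0 (V t); nra.
- apply: locintZ; apply: locintD => //; apply: continuous_locint; exact: cst_continuous.
Qed.

Lemma smL2_L2loc V : smL2 V -> L2loc setT V.
Proof.
move=> [mV iV]; split; first exact: smeas_strongly.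
move=> K /compact_bounded[M [Mr HM]] _.
pose m := `|M| + 1.
have Km : K `<=` `[- m, m].
  move=> t Kt /=; rewrite in_itv/= -ler_norml; apply: HM => //.
  by rewrite /m (le_lt_trans (ler_norm _))// ltrDl.
have /integrableP[_] := iV (- m) m.
apply: le_lt_trans; under [leRHS]eq_integral do rewrite gee0_abs ?lee_fin ?sqr_ge0//.
rewrite [leLHS]integral_mkcond [leRHS]integral_mkcond.
apply: ge0_le_integral_nonmeas => [t _|t _]; rewrite !patchE; case: ifP => //.
  by move=> /set_mem/Km Kt; rewrite mem_set.
by move=> _; case: ifP => _; [rewrite lee_fin sqr_ge0|exact: lexx].
Qed.

Lemma L2loc_smL2 V : L2loc setT V -> exists2 V', smL2 V' & ae_eq mu setT V V'.
Proof.
move=> [/strongly_smeas[V' mV' VV'] iV]; exists V' => //; split => // x y.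
apply/integrableP; split.
  apply/measurable_EFinP/measurable_funTS.
  apply: (smeas_measurable mV' (h := fun v : L => `|v| ^+ 2)) => v.
  apply: (@continuous_comp _ _ _ (@Num.norm _ L) (fun x : R => x ^+ 2)).
    exact: norm_continuous.
  exact: exprn_continuous.
apply: le_lt_trans (iV `[x, y]%classic _ _) => //; last exact: segment_compact.
rewrite le_eqVlt; apply/orP; left; apply/eqP; apply: ae_eq_integral_nonmeas.
apply: filterS VV' => t + _ => /(_ I) ->; rewrite /= ger0_norm ?sqr_ge0//.
Qed.

Lemma L2loc_ae V V' : ae_eq mu setT V V' -> L2loc setT V -> L2loc setT V'.
Proof.
move=> VV' [mV iV]; split; first exact: strongly_measurable_ae mV.
move=> K cK _; apply: le_lt_trans (iV K cK _) => //.
rewrite le_eqVlt; apply/orP; left; apply/eqP; apply: ae_eq_integral_nonmeas.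
by apply: filterS VV' => t + _ => /(_ I) ->.
Qed.

Lemma weak_derivative_ae U V V' : ae_eq mu setT V V' ->
  weak_derivative setT U V -> weak_derivative setT U V'.
Proof.
move=> VV' [iV dV]; split; first exact: L2loc_ae iV.
move=> phi tphi w; rewrite dV//; congr (- fine _).
apply: ae_eq_integral_nonmeas.
by apply: filterS VV' => t + _ => /(_ I) ->.
Qed.

Lemma test_step (s t : R) (k : nat) : s <= t ->
  test_function setT
    (fun x => smooth_step (k.+1%:R * (x - s)) - smooth_step (k.+1%:R * (x - t))).
Proof.
move=> st; split.
  apply: smooth_class_derivable.
  rewrite (_ : (fun x => _) = fun x => smooth_step (k.+1%:R * x + - (k.+1%:R * s)) +
    (-1) * smooth_step (k.+1%:R * x + - (k.+1%:R * t))); last first.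
    by apply/funext => x; rewrite mulN1r !mulrBr.
  apply: smooth_add; first exact/smooth_affine/smooth_step_class.
  by apply: smooth_mul; [exact: smooth_cst|exact/smooth_affine/smooth_step_class].
exists `[s, t + 1]%classic; split => //; first exact: segment_compact.
move=> x /= /negP; rewrite in_itv/= negb_and -!ltNge => /orP[xs|xt].
  by rewrite !smooth_step0 ?subrr// mulr_ge0_le0//; lra.
have k1 : 1 <= k.+1%:R :> R by rewrite ler1n.
by rewrite !smooth_step1 ?subrr// mulr_ege1//; lra.
Qed.

Lemma Rintegral_support (f : R -> R) (D : set R) : (forall x, ~ D x -> f x = 0) ->
  \int[mu]_x f x = \int[mu]_(x in D) f x.
Proof.
move=> f0; rewrite [RHS]Rintegral_mkcond; congr (fine _); apply: eq_integral => x _.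
by rewrite patchE; case: ifPn => // /negP xD; rewrite f0// => Dx; apply: xD; rewrite inE.
Qed.

(** The test functions are smoothed indicators of []s, t]]. Their derivatives are a mollifier at [s]
    minus one at [t], which recover the values of the continuous curve [U]; the other side converges
    by dominated convergence. *)
Lemma weak_derivative_ftc U V : continuous U -> smL2 V -> weak_derivative setT U V ->
  forall w s t, s <= t -> <<U t - U s, w>> = \int[mu]_(x in `[s, t]) <<V x, w>>.
Proof.
move=> cU iV [_ dV] w s t st.
pose phi k x : R := smooth_step (k.+1%:R * (x - s)) - smooth_step (k.+1%:R * (x - t)).
have dphi k x : derive1 (phi k) x = k.+1%:R * bump (k.+1%:R * (x - s)) -
    k.+1%:R * bump (k.+1%:R * (x - t)).
  by rewrite derive1E; apply: derive_val; apply: is_deriveB; exact: is_derive_step_scaled.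
have phi_out k x : ~ `[s, t + 1]%classic x -> phi k x = 0.
  move=> /= /negP; rewrite in_itv/= negb_and -!ltNge => /orP[xs|xt].
    by rewrite /phi !smooth_step0 ?subrr// mulr_ge0_le0//; lra.
  have k1 : 1 <= k.+1%:R :> R by rewrite ler1n.
  by rewrite /phi !smooth_step1 ?subrr// mulr_ege1//; lra.
have dphi_out k x : ~ `[s, t + 1]%classic x -> derive1 (phi k) x = 0.
  have k0 : 0 < k.+1%:R :> R by rewrite ltr0n.
  have k1 : 1 <= k.+1%:R :> R by rewrite ler1n.
  move=> /= /negP; rewrite in_itv/= negb_and -!ltNge dphi => /orP[xs|xt].
    by rewrite !bump_out ?mulr0 ?subrr//; left; rewrite pmulr_rlt0//; lra.
  have kx y : y < x - 1 -> 1 < k.+1%:R * (x - y).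
    move=> yx; apply: (@lt_le_trans _ _ (x - y)); first lra.
    by rewrite ler_peMl//; lra.
  by rewrite !bump_out ?mulr0 ?subrr//; right; apply: kx; lra.
have cU' : continuous (fun x => <<U x, w>>).
  by move=> x; apply: (cvg_ip ipE); [exact: cU|exact: cvg_cst].
have lim1 : \int[mu]_x (derive1 (phi k) x * <<U x, w>>) @[k --> \oo] -->
    <<U s, w>> - <<U t, w>>.
  have s1 : s + 1 <= t + 1 by rewrite lerD2r.
  pose A y k := \int[mu]_(x in `[s, t + 1]) (k.+1%:R * bump (k.+1%:R * (x - y)) * <<U x, w>>).
  have AA : (A s k - A t k) @[k --> \oo] --> <<U s, w>> - <<U t, w>>.
    apply: cvgB.
      exact: (bump_dirac cU' (lexx s) s1).
    exact: (bump_dirac cU' st (lexx (t + 1))).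
  apply: cvg_trans AA; apply: near_eq_cvg; apply: nearW => k; rewrite /A.
  rewrite (@Rintegral_support _ `[s, t + 1]%classic); last first.
    by move=> x /dphi_out ->; rewrite mul0r.
  have lb y : locint (fun x => k.+1%:R * bump (k.+1%:R * (x - y)) * <<U x, w>>).
    apply: continuous_locint => x; apply: cvgM; last exact: cU'.
    exact: bump_scaled_continuous.
  rewrite -[X in _ - X]mul1r -mulNr -locRintegralZ// -locRintegralD//; last exact: locintZ.
  by apply: eq_Rintegral => x _; rewrite dphi mulN1r mulrBl.
have lim2 : \int[mu]_x (phi k x * <<V x, w>>) @[k --> \oo] -->
    \int[mu]_(x in `[s, t]) <<V x, w>>.
  have iVw := smL2_ip w iV.
  pose g x := if x \in `]s, t]%classic then <<V x, w>> else 0.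
  have mVw : measurable_fun setT (fun x => <<V x, w>>).
    by case: (iV) => mV _; exact: (smeas_measurable mV (@continuous_ip w)).
  have phi_cvg x : phi k x @[k --> \oo] --> ((x \in `]s, t]%classic)%:R : R).
    have H y : smooth_step (k.+1%:R * (x - y)) @[k --> \oo] --> ((y < x)%R%:R : R).
      have [yx|xy] := ltP y x.
        apply: cvg_near_cst; near=> k; rewrite smooth_step1//.
        rewrite -ler_pdivrMr ?subr_gt0//; apply: (@le_trans _ _ k%:R).
          by near: k; exact: nbhs_infty_ger.
        by rewrite ler_nat.
      apply: cvg_near_cst; near=> k; rewrite smooth_step0//.
      by rewrite mulr_ge0_le0// subr_le0.
    rewrite (_ : _%:R = (s < x)%R%:R - (t < x)%R%:R); first by apply: cvgB.
    rewrite mem_setE/= in_itv/= !ltNge; case: (leP x t) => xt; case: (leP x s) => xs //=; rewrite ?subr0 ?subrr//.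
    by move: (le_trans xs st); rewrite leNgt xt.
  have phi_bnd k x : `|phi k x| <= 1.
    have /andP[a1 a2] := smooth_step_itv (k.+1%:R * (x - s)).
    have /andP[b1 b2] := smooth_step_itv (k.+1%:R * (x - t)).
    by rewrite ler_norml /phi; lra.
  have cphi k : continuous (phi k).
    by move=> x; apply/differentiable_continuous/derivable1_diffP; case: (test_step k st) => /(_ 0%N x).
  have mphi k : measurable_fun setT (fun x => phi k x * <<V x, w>>).
    by apply: measurable_funM => //; apply: continuous_measurable_fun.
  have gE : g = (fun x => <<V x, w>>) \_ `]s, t]%classic.
    by apply/funext => x; rewrite patchE.
  have cvgg x : (phi k x * <<V x, w>>) @[k --> \oo] --> g x.
    rewrite /g (_ : (if _ then _ else _) = (x \in `]s, t]%classic)%:R * <<V x, w>>); last first.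
      by case: ifP => _; rewrite ?mul1r ?mul0r.
    by apply: cvgM => //; exact: cvg_cst.
  have mg : measurable_fun setT g.
    by apply: (measurable_fun_cvg (h := fun k x => phi k x * <<V x, w>>)).
  have -> : \int[mu]_(x in `[s, t]) <<V x, w>> = \int[mu]_(x in `[s, t + 1]) g x.
    rewrite gE -Rintegral_mkcondr (_ : _ `&` _ = `]s, t]%classic).
      rewrite Rintegral_itv_obnd_cbnd//.
      apply: (integrableS _ _ _ (iVw s t)); [exact: measurable_itv|exact: measurable_itv|].
      by move=> x; rewrite /= !in_itv/= => /andP[/ltW -> ->].
    apply/seteqP; split=> x /=; rewrite !in_itv/=; first by case.
    by move=> /andP[sx xt]; rewrite sx xt ltW//=; split => //; lra.
  rewrite (_ : (fun k => _) = fun k => \int[mu]_(x in `[s, t + 1]) (phi k x * <<V x, w>>)).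
    apply: (locRintegral_dominated (h := fun x => `|<<V x, w>>|)) => //.
    - by move=> k x _; rewrite normrM ler_piMl.
    - exact: locint_norm.
    - exact: aeW.
  apply/funext => k; apply: Rintegral_support => x xD.
  by rewrite phi_out ?mul0r.
have lim3 : \int[mu]_x (derive1 (phi k) x * <<U x, w>>) @[k --> \oo] -->
    - \int[mu]_(x in `[s, t]) <<V x, w>>.
  apply: cvg_trans (cvgN lim2); apply: near_eq_cvg; apply: nearW => k.
  have tk : test_function [set: R]° (phi k) by rewrite interiorT; exact: test_step.
  by rewrite (dV _ tk).
have := cvg_unique _ lim1 lim3; rewrite ipBl => e.
by rewrite -[LHS]opprK opprB e// opprK.
Unshelve. all: by end_near. Qed.

End WeakDerivative.

(** Continuous induction: at the supremum [c] of the points up to which the inequality holds, the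
    local hypothesis steps from a good point just left of [c] to a point beyond [c], unless
    [c = b]. *)
Lemma increments_le {R : realType} (F G : R -> R) (a b : R) : a <= b ->
  (forall x, a <= x <= b -> exists2 d, 0 < d & forall s t, a <= s -> s <= x ->
     x <= t -> t <= b -> t - s < d -> `|F t - F s| <= G t - G s) ->
  `|F b - F a| <= G b - G a.
Proof.
move=> ab loc.
pose A := [set z | a <= z <= b /\ `|F z - F a| <= G z - G a].
have Aa : A a by rewrite /A /= lexx ab !subrr normr0.
have hA : has_sup A by split; [exists a|exists b => z [/andP[]]].
pose c := sup A.
have ac : a <= c by apply: sup_ubound => //; case: hA.
have cb : c <= b by apply: sup_le_ub; [exists a|move=> z [/andP[]]].
have [|d d0 hd] := loc c; first by rewrite ac.
have [z Az cz] := sup_adherent (divr_gt0 d0 (ltr0n _ 2)) hA.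
have zc : z <= c by apply: sup_ubound => //; case: hA.
have [/andP[az zb] Fz] := Az.
pose t := Num.min (c + d / 2) b.
have d2 : 0 < d / 2 by rewrite divr_gt0.
have ct : c <= t by rewrite /t le_min cb lerDl ltW.
have tb : t <= b by rewrite /t ge_min lexx orbT.
have At : A t.
  split; first by rewrite tb (le_trans ac).
  have h : `|F t - F z| <= G t - G z.
    apply: hd => //; have : t <= c + d / 2 by rewrite /t ge_min lexx.
    by move: cz; rewrite -/c; lra.
  by have := ler_normD (F t - F z) (F z - F a); rewrite subrKA; lra.
have tc : t <= c by apply: sup_ubound => //; case: hA.
have -> : b = t; last by case: At.
apply/eqP; rewrite eq_le tb andbT /t le_min lexx andbT.
by move: tc; rewrite /t ge_min => /orP[|bc]; lra.
Qed.

Lemma locintM {R : realType} (f g : R -> R) : continuous f -> locint g ->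
  locint (fun x => f x * g x).
Proof.
move=> cf ig x y; have [xy|yx] := leP x y; last first.
  by rewrite set_itv_ge ?bnd_simp -?ltNge//; exact: integrable_set0.
have cnf : continuous (fun t => `|f t|).
  move=> t; apply: (@continuous_comp _ _ _ f (fun x : R => `|x|)); first exact: cf.
  exact: norm_continuous.
have [c cxy fc] := EVT_max xy (continuous_subspaceT cnf).
have := locintZ `|f c| (locint_norm ig) x y; apply: le_integrable => //.
- apply/measurable_EFinP; apply: measurable_funM.
    by apply: measurable_funTS; exact: continuous_measurable_fun.
  by apply/measurable_EFinP; case/integrableP: (ig x y).
- move=> t txy; rewrite /= lee_fin !normrM !normr_id; apply: ler_wpM2r => //.
  exact: fc.
Qed.

Section WeakDerivativeFTC.
Context {R : realType} (S : setting R).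
Local Notation L := (spL S).
Local Notation mu := (@lebesgue_measure R).
Local Notation "<< u , v >>" := (@ipL R S u v).
Implicit Types (U V W : R -> L).

Let ipE := @ipL_norm R S.

(** Since [f] is only an indefinite integral, the product [phi * f] is not differentiated. Instead
    the defect [F] of the formula has increments over short intervals at most [2 * e] times those of
    the integral of [|phi'| + |g|]; [increments_le] makes this global and [e] is arbitrary. *)
Lemma integral_parts (phi phi' f g : R -> R) (a b : R) : a <= b ->
  continuous phi' -> (forall t, is_derive t (1:R) phi (phi' t)) ->
  continuous f -> locint g ->
  (forall s t, s <= t -> f t - f s = \int[mu]_(x in `[s, t]) g x) ->
  \int[mu]_(x in `[a, b]) (phi' x * f x + phi x * g x) = phi b * f b - phi a * f a.
Proof.
move=> ab cphi' dphi cf ig fg.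
have cphi : continuous phi.
  by move=> t; apply/differentiable_continuous/derivable1_diffP; case: (dphi t).
have lphi' : locint phi' by exact: continuous_locint.
have lphif : locint (fun x => phi' x * f x).
  by apply: continuous_locint => x; apply: cvgM; [exact: cphi'|exact: cf].
have lphig : locint (fun x => phi x * g x) by exact: locintM.
have lh := locintD lphif lphig.
have lN : locint (fun x => `|phi' x| + `|g x|).
  by apply: locintD; exact: locint_norm.
pose F x := \int[mu]_(y in `[a, x]) (phi' y * f y + phi y * g y) - phi x * f x.
pose G x := \int[mu]_(y in `[a, x]) (`|phi' y| + `|g y|).
suff : `|F b - F a| <= 0.
  rewrite normr_le0 subr_eq0 => /eqP; rewrite /F set_itv1 Rintegral_set1; lra.
have incG s t : a <= s -> s <= t -> G t - G s = \int[mu]_(y in `[s, t]) (`|phi' y| + `|g y|).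
  by move=> as_ st; rewrite /G (Rintegral_chasles lN as_ st) addrC addKr.
suff H e : 0 < e -> `|F b - F a| <= 2 * e * (G b - G a).
  apply/ler_addgt0Pr => e e0; rewrite add0r.
  have G0 : 0 <= G b - G a.
    rewrite incG//; apply: Rintegral_ge0 => y _; exact: addr_ge0.
  apply: (le_trans (H (e / (2 * (G b - G a + 1))) _)).
    by rewrite divr_gt0 ?mulr_gt0//; lra.
  rewrite [leLHS](_ : _ = e * ((G b - G a) / (G b - G a + 1))); last first.
    by field; rewrite gt_eqF//; lra.
  apply: ler_piMr; first exact: ltW.
  by rewrite ler_pdivrMr; lra.
move=> e0; rewrite mulrBr.
apply: (@increments_le _ F (fun x => 2 * e * G x)) => // x /andP[ax xb].
have /cvgrPdist_lt/(_ _ e0)[d1 /= d10 h1] := cf x.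
have /cvgrPdist_lt/(_ _ e0)[d2 /= d20 h2] := cphi x.
exists (Num.min d1 d2) => [|s t as_ sx xt tb]; first by rewrite lt_min d10.
rewrite lt_min => /andP[ts1 ts2]; have st := le_trans sx xt.
have near_x y : s <= y <= t -> `|f x - f y| < e /\ `|phi x - phi y| < e.
  move=> /andP[sy yt]; split; [apply: h1|apply: h2] => /=; rewrite ltr_norml; lra.
rewrite -mulrBr incG//.
(* The boundary terms are absorbed by subtracting [f t] from [f] and [phi s] from [phi]; both
   differences are small on a short interval. *)
have -> : F t - F s = \int[mu]_(y in `[s, t])
    (phi' y * f y + phi y * g y + (- f t * phi' y + - phi s * g y)).
  have l1 := locintZ (- f t) lphi'; have l2 := locintZ (- phi s) ig.
  rewrite (locRintegralD _ _ lh (locintD l1 l2)) (locRintegralD _ _ l1 l2) !locRintegralZ// -fg// (FTC2 st cphi' dphi).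
  by rewrite /F (Rintegral_chasles lh as_ st); lra.
have l1 := locintZ (- f t) lphi'; have l2 := locintZ (- phi s) ig.
have lT := locintD lh (locintD l1 l2).
apply: le_trans (normr_locRintegral _ _ lT) _.
rewrite -locRintegralZ//; apply: le_locRintegral.
- exact: locint_norm.
- exact: locintZ.
move=> y sty; have [fy py] := near_x _ sty.
have [ft _] : `|f x - f t| < e /\ `|phi x - phi t| < e by apply: near_x; rewrite st lexx.
have [_ ps] : `|f x - f s| < e /\ `|phi x - phi s| < e by apply: near_x; rewrite st lexx.
rewrite [X in `|X|](_ : _ = phi' y * (f y - f t) + (phi y - phi s) * g y); last by ring.
apply: le_trans (ler_normD _ _) _; rewrite !normrM mulrDr.
have ffy : `|f y - f t| <= 2 * e.
  by move: fy ft; rewrite !ltr_norml ler_norml; lra.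
have ppy : `|phi y - phi s| <= 2 * e.
  by move: py ps; rewrite !ltr_norml ler_norml; lra.
apply: lerD; last exact: ler_wpM2r.
by rewrite mulrC; exact: ler_wpM2r.
Qed.

Lemma ftc_weak_derivative U V : continuous U -> smL2 V ->
  (forall w s t, s <= t -> <<U t - U s, w>> = \int[mu]_(x in `[s, t]) <<V x, w>>) ->
  weak_derivative setT U V.
Proof.
move=> cU iV UV; split; first exact: smL2_L2loc.
move=> phi [sphi [K [/compact_bounded[M [_ HM]] _ phiK]]] w.
pose m := `|M| + 1.
have m0 : 0 <= m by rewrite /m addr_ge0.
have phi0 x : m < `|x| -> phi x = 0.
  move=> mx; apply: phiK => Kx; move: mx; rewrite ltNge => /negP; apply.
  by apply: HM => //; rewrite /m (le_lt_trans (ler_norm _))// ltrDl.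
have dphi t : is_derive t (1:R) phi (derive1 phi t).
  by split; [exact: (sphi 0%N)|rewrite derive1E].
have cphi' : continuous (derive1 phi).
  by move=> t; apply/differentiable_continuous/derivable1_diffP; exact: (sphi 1%N t).
have dphi0 x : m < `|x| -> derive1 phi x = 0.
  move=> mx; rewrite derive1E (@near_eq_derive R R^o R^o _ (cst 0)) ?derive_cst//.
  near=> y; apply: phi0; near: y.
  have /cvgrPdist_lt/(_ (`|x| - m)) := @norm_continuous R R^o x.
  by rewrite subr_gt0 => /(_ mx); apply: filterS => y; rewrite ltr_norml; lra.
have out x : ~ `[- (m + 1), m + 1]%classic x -> m < `|x|.
  move=> /= /negP; rewrite in_itv/= -ler_norml -ltNge; lra.
pose f t := <<U t, w>>; pose g t := <<V t, w>>.
have cf : continuous f by move=> t; apply: (cvg_ip ipE); [exact: cU|exact: cvg_cst].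
have ig : locint g by exact: smL2_ip.
have fg s t : s <= t -> f t - f s = \int[mu]_(x in `[s, t]) g x.
  by move=> st; rewrite -UV// ipBl.
rewrite (@Rintegral_support _ _ `[- (m + 1), m + 1]%classic); last first.
  by move=> x /out/dphi0 ->; rewrite mul0r.
rewrite (@Rintegral_support _ (fun t => phi t * _) `[- (m + 1), m + 1]%classic); last first.
  by move=> x /out/phi0 ->; rewrite mul0r.
have lmm : - (m + 1) <= m + 1 by lra.
have := integral_parts lmm cphi' dphi cf ig fg.
rewrite !phi0 ?mul0r ?subrr; last 2 first.
- by rewrite normrN ger0_norm; lra.
- by rewrite ger0_norm; lra.
rewrite locRintegralD//; first by rewrite /f /g; lra.
  by apply: continuous_locint => x; apply: cvgM; [exact: cphi'|exact: cf].
by apply: locintM => // t; apply/differentiable_continuous/derivable1_diffP; case: (dphi t).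
Unshelve. all: by end_near. Qed.

(** By Lebesgue differentiation [g] is almost everywhere the derivative of its indefinite integral,
    here identically 0. The indefinite integral needs a left end [-n], hence the countable family of
    exceptional sets. *)
Lemma locint_ae0 (g : R -> R) : measurable_fun setT g -> locint g ->
  (forall s t, s <= t -> \int[mu]_(x in `[s, t]) g x = 0) ->
  {ae mu, forall x, g x = 0}.
Proof.
move=> mg ig g0.
have locg : locally_integrable setT g.
  split => //; first exact: openT.
  move=> K _ /compact_bounded[M [_ HM]].
  pose m := `|M| + 1.
  have Km : K `<=` `[- m, m].
    move=> t Kt /=; rewrite in_itv/= -ler_norml; apply: HM => //.
    by rewrite /m (le_lt_trans (ler_norm _))// ltrDl.
  have /integrableP[_] := ig (- m) m; apply: le_lt_trans.
  rewrite [leLHS]integral_mkcond [leRHS]integral_mkcond.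
  apply: ge0_le_integral_nonmeas => [t _|t _]; rewrite !patchE; case: ifP => //.
    by move=> /set_mem/Km Kt; rewrite mem_set.
  by move=> _; case: ifP => _; [rewrite lee_fin|exact: lexx].
pose B n := (fun x : R => - n%:R < x -> g x = 0).
have H n : {ae mu, forall x, B n x}.
  have Hi y : mu.-integrable [set` Interval (BLeft (- n%:R)) (BRight y)] (EFin \o g).
    exact: ig.
  have := FTC1 Hi locg; apply: filterS; first exact: (ae_filter_ringOfSetsType mu).
  move=> x hx nx; have [|_ <-] := hx; first by rewrite /= lte_fin.
  rewrite derive1E (@near_eq_derive R R^o R^o _ (cst 0)) ?derive_cst//.
  near=> y; apply: g0; apply: ltW; near: y; exact: lt_nbhsr.
have : {ae mu, forall x n, B n x} by apply: ae_foralln.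
apply: filterS; first exact: (ae_filter_ringOfSetsType mu).
move=> x Bx; have [n xn] : exists n : nat, `|x| < n%:R.
  by exists (Num.truncn `|x|).+1; exact: truncnS_gt.
by apply: (Bx n); move: xn; rewrite ltr_norml => /andP[].
Unshelve. all: by end_near. Qed.

(** Each test vector [w] has its own exceptional null set and [L] need not be separable. But
    [V1 - V2] is a limit of simple curves, so the countably many values of these suffice as test
    vectors. *)
Lemma ftc_unique V1 V2 : smL2 V1 -> smL2 V2 ->
  (forall w s t, s <= t ->
    \int[mu]_(x in `[s, t]) <<V1 x, w>> = \int[mu]_(x in `[s, t]) <<V2 x, w>>) ->
  ae_eq mu setT V1 V2.
Proof.
move=> i1 i2 V12.
have [s ss sV] := smeasB i1.1 i2.1.
have Hw w : {ae mu, forall x, <<V1 x - V2 x, w>> = 0}.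
  have e x : <<V1 x - V2 x, w>> = <<V1 x, w>> + -1 * <<V2 x, w>>.
    by rewrite ipBl mulN1r.
  have j1 := smL2_ip w i1; have j2 := smL2_ip w i2.
  apply: locint_ae0.
  - exact: (smeas_measurable (smeasB i1.1 i2.1) (@continuous_ip _ _ w)).
  - rewrite (_ : (fun x => _) = fun x => <<V1 x, w>> + -1 * <<V2 x, w>>); last exact/funext.
    exact/locintD/locintZ.
  - move=> x y xy; under eq_Rintegral do rewrite e.
    by rewrite (locRintegralD _ _ j1 (locintZ (-1) j2)) locRintegralZ// V12//; lra.
pose Q := \bigcup_n (range (s n)).
have [q Qq] : exists q : nat -> L, Q `<=` range q.
  have cQ : countable Q.
    by apply: bigcup_countable => // n _; apply: finite_set_countable; case: (ss n).
  have /pfcard_geP[Q0|/unsquash f] := cQ.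
    by exists (fun=> 0) => v; rewrite Q0.
  by exists f => v /(@surj _ _ _ _ f)[n _ <-]; exists n.
have : {ae mu, forall x n, <<V1 x - V2 x, q n>> = 0}.
  by apply: ae_foralln => n; exact: Hw.
apply: filterS; first exact: (ae_filter_ringOfSetsType mu).
move=> x qx _; apply/eqP; rewrite -subr_eq0 -normr_eq0 -sqrf_eq0 -ipE; apply/eqP.
have c1 : <<V1 x - V2 x, s n x>> @[n --> \oo] --> <<V1 x - V2 x, V1 x - V2 x>>.
  by apply: (cvg_ip ipE); [exact: cvg_cst|exact: sV].
have c2 : <<V1 x - V2 x, s n x>> @[n --> \oo] --> (0 : R).
  rewrite (_ : (fun n => _) = fun=> 0); first exact: cvg_cst.
  apply/funext => n; have [|k _ <-] := Qq (s n x); last exact: qx.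
  by exists n => //; exists x.
exact: (cvg_unique _ c1 c2).
Qed.

End WeakDerivativeFTC.

Lemma bounded_locint {R : realType} (f : R -> R) : measurable_fun setT f ->
  (forall a b, exists M, forall t, a <= t <= b -> `|f t| <= M) -> locint f.
Proof.
move=> mf bf x y; have [M HM] := bf x y.
have mD : measurable (`[x, y]%classic : set (measurableTypeR R)) by exact: measurable_itv.
apply: measurable_bounded_integrable => //.
- exact: (compact_finite_measure (@segment_compact R x y)).
- exact: measurable_funTS.
- exists M; split; first by rewrite num_real.
  move=> M' MM' t /=; rewrite in_itv/= => /HM h; exact: le_trans h (ltW MM').
Qed.

Section Curves.
Context {R : realType} (S : setting R).
Local Notation L := (spL S).
Local Notation mu := (@lebesgue_measure R).
Local Notation "<< u , v >>" := (@ipL R S u v).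
Implicit Types (U V W : R -> L).

Let ipE := @ipL_norm R S.

Lemma curve_C1_derive U t : curve_C1 setT U -> is_derive t (1:R) U (derive1 U t).
Proof. by move=> [dU _]; split; [exact: dU|rewrite derive1E]. Qed.

Lemma curve_C1_continuous U : curve_C1 setT U -> continuous U.
Proof.
by move=> [dU _] t; apply/differentiable_continuous/derivable1_diffP; exact: dU.
Qed.

Lemma curve_C1_derive1 U : curve_C1 setT U -> continuous (derive1 U).
Proof. by move=> [_ cU] t; exact: cU. Qed.

Lemma norm2_continuous : continuous (fun v : L => `|v| ^+ 2).
Proof.
move=> v; apply: (@continuous_comp _ _ _ (@Num.norm _ L) (fun x : R => x ^+ 2)).
  exact: norm_continuous.
exact: exprn_continuous.
Qed.

Lemma continuous_norm2 V : continuous V -> continuous (fun t => `|V t| ^+ 2).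
Proof.
move=> cV t; apply: (@continuous_comp _ _ _ V (fun v : L => `|v| ^+ 2)); first exact: cV.
exact: norm2_continuous.
Qed.

Lemma continuous_smL2 V : continuous V -> smL2 V.
Proof.
by move=> cV; split; [exact: continuous_smeas|exact/continuous_locint/continuous_norm2].
Qed.

Lemma smL2B V V' : smL2 V -> smL2 V' -> smL2 (fun t => V t - V' t).
Proof.
move=> [mV iV] [mV' iV']; have sm := smeasB mV mV'; split => //.
apply: (@le_locint _ _ (fun t => 2 * (`|V t| ^+ 2 + `|V' t| ^+ 2))).
- exact: (smeas_measurable sm norm2_continuous).
- move=> t; rewrite ger0_norm ?sqr_ge0//.
  have h := ler_normB (V t) (V' t).
  apply: (@le_trans _ _ ((`|V t| + `|V' t|) ^+ 2)); first by rewrite ler_sqr ?nnegrE ?addr_ge0.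
  by have := sqr_ge0 (`|V t| - `|V' t|); nra.
- exact/locintZ/locintD.
Qed.

Lemma curve_C1_ftc U : curve_C1 setT U -> forall w s t, s <= t ->
  <<U t - U s, w>> = \int[mu]_(x in `[s, t]) <<derive1 U x, w>>.
Proof.
move=> C1U w s t st.
have c : continuous (fun x => <<derive1 U x, w>>).
  by move=> x; apply: (cvg_ip ipE); [exact: curve_C1_derive1|exact: cvg_cst].
have d x : is_derive x (1:R) (fun x => <<U x, w>>) <<derive1 U x, w>>.
  apply: is_derive_eq (is_derive_ip ipE (curve_C1_derive x C1U) (is_derive_cst w x (1:R))) _.
  by rewrite (ipC _ _ 0) ip0l addr0.
by rewrite (FTC2 st c d) ipBl.
Qed.

Lemma curve_C1_weak_derivative U : curve_C1 setT U ->
  weak_derivative setT U (derive1 U).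
Proof.
move=> C1U; apply: ftc_weak_derivative.
- exact: curve_C1_continuous.
- exact/continuous_smL2/curve_C1_derive1.
- exact: curve_C1_ftc.
Qed.

(** The increment of [U] serves as its own test vector. *)
Lemma ftc_norm U V (M : R) s t : smL2 V ->
  (forall w s t, s <= t -> <<U t - U s, w>> = \int[mu]_(x in `[s, t]) <<V x, w>>) ->
  s <= t -> (forall x, s <= x <= t -> `|V x| <= M) -> `|U t - U s| <= M * (t - s).
Proof.
move=> iV ftc st VM; set w := U t - U s.
have [->|w0] := eqVneq w 0.
  by rewrite normr0 mulr_ge0 ?subr_ge0// (le_trans _ (VM s _))// lexx.
have wp : 0 < `|w| by rewrite normr_gt0.
rewrite -(ler_pM2l wp) -expr2 -ipE ftc// mulrA -Rintegral_itv_cst//.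
apply: le_locRintegral; first exact: smL2_ip.
  by apply: continuous_locint; exact: cst_continuous.
move=> x xst; apply: le_trans (ler_norm _) _; apply: le_trans (ip_CS ipE _ _) _.
by rewrite mulrC ler_wpM2l// VM.
Qed.

End Curves.

(** * Contractions of smooth curves *)

Section DyadicQuotient.
Context {R : realType} (S : setting R).
Local Notation L := (spL S).
Local Notation mu := (@lebesgue_measure R).
Local Notation "<< u , v >>" := (@ipL R S u v).
Context (W : R -> L).

Let ipE := @ipL_norm R S.

Definition dyadic_quotient n (t : R) : L :=
  2 ^+ n *: (W (dyadic_floor n t + (2 ^+ n)^-1) - W (dyadic_floor n t)).

Lemma dyadic_quotient_smeas n : smeas (dyadic_quotient n).
Proof.
pose h (x : R^o) : L := 2 ^+ n *: (W (x + (2 ^+ n)^-1) - W x).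
exists (fun N t => h (dyadic_clip N n t)).
  by move=> N; exact: (simple_curve_comp h (dyadic_clip_simple N n)).
move=> t; apply: cvg_near_cst.
by have := dyadic_clip_near (fun=> n) t; apply: filterS => N ->.
Qed.

Lemma dyadic_floor_eq n (k : int) (t : R) :
  k%:~R / 2 ^+ n <= t < (k + 1)%:~R / 2 ^+ n -> dyadic_floor n t = k%:~R / 2 ^+ n.
Proof.
move=> /andP[t1 t2]; rewrite /dyadic_floor; congr (_%:~R / _).
apply: floor_def; rewrite mulrC -ler_pdivrMr ?pow2_gt0// t1/=.
by rewrite -ltr_pdivlMr ?pow2_gt0.
Qed.

Context (lipW : forall a b, exists M, forall s t, a <= s -> s <= t -> t <= b ->
  `|W t - W s| <= M * (t - s)).

Lemma dyadic_quotient_bounded a b : exists2 M, 0 <= M & forall n t, a <= t <= b ->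
  `|dyadic_quotient n t| <= M.
Proof.
(* The dyadic cell of a point of [[a, b]] may stick out of it, by at most [2 ^- n <= 1]. *)
have [M HM] := lipW (a - 1) (b + 1).
exists `|M| => // n t /andP[at_ tb].
have /andP[h1 h2] := dyadic_floor_itv n t.
have p0 := @pow2_gt0 R n.
have p1 : (2 ^+ n : R)^-1 <= 1 by rewrite invf_le1// exprn_ege1// ler1n.
have pV : 0 < (2 ^+ n : R)^-1 by rewrite invr_gt0.
rewrite /dyadic_quotient normrZ (gtr0_norm p0) mulrC -ler_pdivlMr//.
apply: (le_trans (HM _ _ _ _ _)); [lra|lra|lra|].
rewrite addrAC subrr add0r; apply: ler_wpM2r; first exact: ltW.
exact: ler_norm.
Qed.

Lemma dyadic_quotient_smL2 n : smL2 (dyadic_quotient n).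
Proof.
have sm := dyadic_quotient_smeas n; split => //.
apply: bounded_locint.
  apply: (smeas_measurable sm (h := fun v : L => `|v| ^+ 2)).
  exact: norm2_continuous.
move=> a b; have [M M0 HM] := dyadic_quotient_bounded a b; exists (M ^+ 2) => t tab.
by rewrite ger0_norm ?sqr_ge0// ler_sqr ?nnegrE//; exact: HM.
Qed.

Lemma dyadic_quotient_cell n (k : int) w :
  \int[mu]_(t in `[k%:~R / 2 ^+ n, (k + 1)%:~R / 2 ^+ n]) <<dyadic_quotient n t, w>> =
  <<W ((k + 1)%:~R / 2 ^+ n) - W (k%:~R / 2 ^+ n), w>>.
Proof.
set p := _ / _; set q := _ / _.
have pq : q = p + (2 ^+ n)^-1 by rewrite /q /p intrD mulrDl mul1r.
have pV : 0 < (2 ^+ n : R)^-1 by rewrite invr_gt0 pow2_gt0.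
have ii := smL2_ip w (dyadic_quotient_smL2 n).
have io f : locint f -> mu.-integrable `[p, q[ (EFin \o f).
  move=> fi; apply: (integrableS _ _ _ (fi p q)).
  - exact: measurable_itv.
  - exact: measurable_itv.
  - by move=> x; rewrite /= !in_itv/= => /andP[-> /ltW].
(* The right end is dropped because there the quotient already has the value of the next cell. *)
rewrite -Rintegral_itv_bndo_bndc; last exact: io.
rewrite (_ : Rintegral _ _ _ = \int[mu]_(t in `[p, q[) (2 ^+ n * <<W q - W p, w>>)); last first.
  apply: eq_Rintegral => t; rewrite inE/= in_itv/= => tpq.
  by rewrite /dyadic_quotient (dyadic_floor_eq tpq) -/p -pq ipZl.
rewrite Rintegral_itv_bndo_bndc; last first.
  by apply: io; apply: continuous_locint; exact: cst_continuous.
rewrite Rintegral_itv_cst; last by rewrite pq; lra.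
by rewrite pq addrAC subrr add0r mulrAC divff ?mul1r// gt_eqF ?pow2_gt0.
Qed.

Lemma dyadic_quotient_cells n (k : int) (r : nat) w :
  \int[mu]_(t in `[k%:~R / 2 ^+ n, (k + r%:Z)%:~R / 2 ^+ n]) <<dyadic_quotient n t, w>> =
  <<W ((k + r%:Z)%:~R / 2 ^+ n) - W (k%:~R / 2 ^+ n), w>>.
Proof.
have ii := smL2_ip w (dyadic_quotient_smL2 n).
elim: r => [|r IH]; first by rewrite addr0 subrr ip0l set_itv1 Rintegral_set1.
have -> : (k + r.+1%:Z)%R = (k + r%:Z) + 1 by lia.
have le1 : k%:~R / 2 ^+ n <= (k + r%:Z)%:~R / 2 ^+ n :> R.
  by rewrite ler_pM2r ?invr_gt0 ?pow2_gt0// ler_int; lia.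
have le2 : (k + r%:Z)%:~R / 2 ^+ n <= (k + r%:Z + 1)%:~R / 2 ^+ n :> R.
  by rewrite ler_pM2r ?invr_gt0 ?pow2_gt0// ler_int; lia.
rewrite (Rintegral_chasles ii le1 le2) IH dyadic_quotient_cell -ipDl.
by congr (ipL _ _); rewrite addrC subrKA.
Qed.

(** A cell of generation [n] is a union of [2 ^ (m - n)] cells of generation [m], over which the
    increments of [W] telescope. *)
Lemma dyadic_quotient_refine n m (k : int) w : (n <= m)%N ->
  \int[mu]_(t in `[k%:~R / 2 ^+ n, (k + 1)%:~R / 2 ^+ n]) <<dyadic_quotient m t, w>> =
  <<W ((k + 1)%:~R / 2 ^+ n) - W (k%:~R / 2 ^+ n), w>>.
Proof.
move=> nm; have e (j : int) : j%:~R / 2 ^+ n = (j * (2 ^ (m - n))%N%:Z)%:~R / 2 ^+ m :> R.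
  have e2 : (2 : R) ^+ m = 2 ^+ n * 2 ^+ (m - n) by rewrite -exprD subnKC.
  have n0 k' : (2 : R) ^+ k' != 0 by rewrite gt_eqF ?pow2_gt0.
  by rewrite intrM -pmulrn natrX e2; field; rewrite !n0.
by rewrite !e mulrDl mul1r dyadic_quotient_cells.
Qed.

Lemma cells_integral0 n (f : R -> R) : locint f ->
  (forall k : int, \int[mu]_(t in `[k%:~R / 2 ^+ n, (k + 1)%:~R / 2 ^+ n]) f t = 0) ->
  forall N : nat, \int[mu]_(t in `[- N%:R, N%:R]) f t = 0.
Proof.
move=> fi f0 N.
have H (k : int) (r : nat) :
    \int[mu]_(t in `[k%:~R / 2 ^+ n, (k + r%:Z)%:~R / 2 ^+ n]) f t = 0.
  elim: r => [|r IH]; first by rewrite addr0 set_itv1 Rintegral_set1.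
  have -> : (k + r.+1%:Z)%R = (k + r%:Z) + 1 by lia.
  have le1 : k%:~R / 2 ^+ n <= (k + r%:Z)%:~R / 2 ^+ n :> R.
    by rewrite ler_pM2r ?invr_gt0 ?pow2_gt0// ler_int; lia.
  have le2 : (k + r%:Z)%:~R / 2 ^+ n <= (k + r%:Z + 1)%:~R / 2 ^+ n :> R.
    by rewrite ler_pM2r ?invr_gt0 ?pow2_gt0// ler_int; lia.
  by rewrite (Rintegral_chasles fi le1 le2) IH f0 addr0.
have := H (- (N * 2 ^ n)%N%:Z) (N * 2 ^ n + N * 2 ^ n)%N.
rewrite PoszD addKr mulrNz -pmulrn natrM natrX mulNr mulfK//.
Qed.

(* On each cell of generation n, dyadic_quotient n is the mean of
   dyadic_quotient m: the quotients form a martingale. *)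
Lemma dyadic_quotient_pythagoras n m (N : nat) : (n <= m)%N ->
  \int[mu]_(t in `[- N%:R, N%:R]) `|dyadic_quotient m t - dyadic_quotient n t| ^+ 2 =
  \int[mu]_(t in `[- N%:R, N%:R]) `|dyadic_quotient m t| ^+ 2 -
  \int[mu]_(t in `[- N%:R, N%:R]) `|dyadic_quotient n t| ^+ 2.
Proof.
move=> nm.
have im := dyadic_quotient_smL2 m; have in_ := dyadic_quotient_smL2 n.
have [_ l1] := im; have [_ l2] := in_; have [_ l3] := smL2B im in_.
have l4 := locintD l3 (locintD (locintZ (-1) l1) l2).
have := @cells_integral0 n _ l4 _ N.
rewrite (locRintegralD _ _ l3 (locintD (locintZ (-1) l1) l2)).
rewrite (locRintegralD _ _ (locintZ (-1) l1) l2) locRintegralZ// => H.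
suff : forall k : int, \int[mu]_(t in `[k%:~R / 2 ^+ n, (k + 1)%:~R / 2 ^+ n])
    (`|dyadic_quotient m t - dyadic_quotient n t| ^+ 2 +
     (-1 * `|dyadic_quotient m t| ^+ 2 + `|dyadic_quotient n t| ^+ 2)) = 0.
  by move=> /H; lra.
move=> k; set p := _ / _; set q := _ / _.
pose d := 2 ^+ n *: (W q - W p).
have pq : q = p + (2 ^+ n)^-1 by rewrite /q /p intrD mulrDl mul1r.
have io f : locint f -> mu.-integrable `[p, q[ (EFin \o f).
  move=> fi; apply: (integrableS _ _ _ (fi p q)).
  - exact: measurable_itv.
  - exact: measurable_itv.
  - by move=> x; rewrite /= !in_itv/= => /andP[-> /ltW].
have jm := smL2_ip d im; have jn := smL2_ip d in_.
have lr := locintD (locintZ (-2) jm) (locintZ 2 jn).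
rewrite -Rintegral_itv_bndo_bndc; last exact: io.
(* On this cell the quotient of generation [n] is the constant [d], so the combination of squares is
   linear in the two quotients, whose integrals against [d] agree. *)
rewrite (_ : Rintegral _ _ _ = \int[mu]_(t in `[p, q[)
    (-2 * <<dyadic_quotient m t, d>> + 2 * <<dyadic_quotient n t, d>>)); last first.
  apply: eq_Rintegral => t; rewrite inE/= in_itv/= => tpq.
  have e : dyadic_quotient n t = d.
    by rewrite /dyadic_quotient (dyadic_floor_eq tpq) -/p -pq.
  rewrite e -!ipE !(ipBl, ipBr) (ipC _ d (dyadic_quotient m t)); lra.
rewrite Rintegral_itv_bndo_bndc; last exact: io.
rewrite (locRintegralD _ _ (locintZ (-2) jm) (locintZ 2 jn)) !locRintegralZ//.
by rewrite dyadic_quotient_refine// dyadic_quotient_cell; lra.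
Qed.

End DyadicQuotient.

Lemma geometric_increments_cvg {R : realType} (L : completeNormedModType R)
    (x : nat -> L) (J : nat) :
  (forall j, (J <= j)%N -> `|x j.+1 - x j| <= (2 ^+ j.+1)^-1) -> cvgn x.
Proof.
move=> xJ.
have H j r : (J <= j)%N -> `|x (j + r)%N - x j| <= (2 ^+ j)^-1 - (2 ^+ (j + r))^-1.
  move=> Jj; elim: r => [|r IH]; first by rewrite addn0 !subrr normr0.
  rewrite addnS; have := ler_normD (x (j + r).+1 - x (j + r)%N) (x (j + r)%N - x j).
  rewrite subrKA; have := xJ (j + r)%N (leq_trans Jj (leq_addr _ _)).
  have e : (2 ^+ (j + r) : R)^-1 = 2 * (2 ^+ (j + r).+1)^-1.
    by rewrite exprS invfM mulrA divff ?mul1r// pnatr_eq0.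
  by move: IH; rewrite e; lra.
apply/cauchy_cvgP/cauchy_exP => e e0.
have [k [Jk ke]] : exists k, (J <= k)%N /\ (2 ^+ k : R)^-1 < e.
  have [N _ HN] := near_infty_natSinv_expn_lt (PosNum e0).
  exists (maxn J N); rewrite leq_maxl; split => //.
  by have := HN (maxn J N) (leq_maxr _ _); rewrite /= div1r.
exists (x k); exists k => // m /= km; rewrite -ball_normE/= distrC.
have := H k (m - k)%N Jk; rewrite subnKC// => /le_lt_trans; apply.
by rewrite (le_lt_trans _ ke)// lerBlDr lerDl invr_ge0 ltW ?pow2_gt0.
Qed.

Lemma bounded_increasing_cauchy {R : realType} (q : nat -> R) (M e : R) :
  (forall n m, (n <= m)%N -> q n <= q m) -> (forall n, q n <= M) -> 0 < e ->
  exists n0, forall n m, (n0 <= n)%N -> (n <= m)%N -> q m - q n <= e.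
Proof.
move=> qi qM e0.
have hs : has_sup (range q) by split; [exists (q 0%N); exists 0%N|exists M => _ [n _ <-]].
have [_ [n0 _ <-] hn0] := sup_adherent e0 hs.
exists n0 => n m nn nm.
have h1 : q m <= sup (range q) by apply: sup_ubound; [case: hs|exists m].
by have h2 := qi _ _ nn; lra.
Qed.

Section Limit.
Context {R : realType} (S : setting R).
Local Notation L := (spL S).
Local Notation mu := (@lebesgue_measure R).
Local Notation "<< u , v >>" := (@ipL R S u v).
Context (W : R -> L).
Context (lipW : forall a b, exists M, forall s t, a <= s -> s <= t -> t <= b ->
  `|W t - W s| <= M * (t - s)).
Local Notation D := (dyadic_quotient W).

Let Q N n := \int[mu]_(t in `[- N%:R, N%:R]) `|D n t| ^+ 2.

Let Q_le N n m : (n <= m)%N -> Q N n <= Q N m.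
Proof.
move=> nm; rewrite -subr_ge0 /Q -dyadic_quotient_pythagoras//.
by apply: Rintegral_ge0 => t _; exact: sqr_ge0.
Qed.

Let Q_bounded (N : nat) : exists M, forall n, Q N n <= M.
Proof.
have [M M0 HM] := dyadic_quotient_bounded lipW (- N%:R) N%:R.
exists (M ^+ 2 * (N%:R - - N%:R)) => n.
have NN : - N%:R <= N%:R :> R by have := ler0n R N; lra.
rewrite -Rintegral_itv_cst// /Q; apply: le_locRintegral.
- by case: (dyadic_quotient_smL2 lipW n).
- by apply: continuous_locint; exact: cst_continuous.
- by move=> t tN; rewrite ler_sqr ?nnegrE// HM.
Qed.

(** The integrals of the squared quotients increase with the generation and are bounded, hence
    Cauchy, and Pythagoras turns their increments into squared distances. The rate [8 ^- k.+1]
    leaves, at height [2 ^- k.+1], an exceptional set of measure at most [2 ^- k.+1] by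
    Chebyshev. *)
Lemma dyadic_quotient_subsequence : exists n_ : nat -> nat,
  (forall k, (k <= n_ k)%N) /\ forall k,
  \int[mu]_(t in `[- k%:R, k%:R]) `|D (n_ k.+1) t - D (n_ k) t| ^+ 2 <= (8 ^+ k.+1)^-1.
Proof.
have H k : exists n0, forall n m, (n0 <= n)%N -> (n <= m)%N ->
    Q k m - Q k n <= (8 ^+ k.+1)^-1.
  have [M HM] := Q_bounded k; apply: (@bounded_increasing_cauchy _ (Q k) M) => //.
    by move=> n m; exact: Q_le.
have [f Hf] := choice H.
(* The sum makes the subsequence nondecreasing while keeping it above both [f k] and [k]. *)
pose n_ k := (\sum_(i < k.+1) (f i + i))%N.
have nS k : (n_ k <= n_ k.+1)%N by rewrite /n_ [leqRHS]big_ord_recr/= leq_addr.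
exists n_; split=> [k|k].
  by rewrite /n_ big_ord_recr/= addnA leq_addl.
rewrite dyadic_quotient_pythagoras//; apply: Hf => //.
by rewrite /n_ big_ord_recr/= addnA addnAC leq_addl.
Qed.

(** Chebyshev and Borel-Cantelli: almost every [t] lies in finitely many of the sets [A k] where the
    increment exceeds [2 ^- k.+1], and then the quotients converge geometrically. The last clause,
    valid at every [t], serves to bound [V] pointwise. *)
Lemma dyadic_quotient_limit : exists V (n_ : nat -> nat), [/\ smeas V,
  forall k, (k <= n_ k)%N,
  {ae mu, forall t, D (n_ k) t @[k --> \oo] --> V t} &
  forall t, D (n_ k) t @[k --> \oo] --> V t \/ V t = 0].
Proof.
have [n_ [n_k Hn]] := dyadic_quotient_subsequence.
pose Del k t := D (n_ k.+1) t - D (n_ k) t.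
have iDel k : smL2 (Del k).
  by apply: smL2B; exact: dyadic_quotient_smL2.
pose A k := `[- k%:R, k%:R]%classic `&` [set t | (2 ^+ k.+1)^-1 < `|Del k t|].
have mB k : measurable (`[- k%:R, k%:R]%classic : set (measurableTypeR R)).
  exact: measurable_itv.
have mA k : measurable (A k : set (measurableTypeR R)).
  apply: measurableI => //.
  have mDel : measurable_fun setT (fun t => `|Del k t|).
    by case: (iDel k) => sm _; apply: (smeas_measurable sm); exact: norm_continuous.
  have := mDel measurableT `](2 ^+ k.+1)^-1, +oo[%classic (measurable_itv _).
  by rewrite setTI; congr measurable; apply/seteqP; split=> t /=; rewrite in_itv/= andbT.
have muA k : (mu (A k) <= (1 / (2 ^ k.+1)%:R)%:E)%E.
  rewrite natrX.
  pose c : R := (2 ^+ k.+1)^-1 ^+ 2.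
  have c0 : 0 < c by rewrite exprn_gt0// invr_gt0 pow2_gt0.
  have [_ lD] := iDel k; have iD := lD (- k%:R) k%:R.
  have e1 : (\int[mu]_(t in A k) c%:E <= \int[mu]_(t in `[(- k%:R)%R, k%:R]) (`|Del k t| ^+ 2)%:E)%E.
    apply: (@le_trans _ _ (\int[mu]_(t in A k) (`|Del k t| ^+ 2)%:E)%E).
      apply: ge0_le_integral_nonmeas => t [_ /= tA]; rewrite lee_fin ?ltW//.
      by rewrite ltr_sqr ?nnegrE// invr_ge0 ltW ?pow2_gt0.
    apply: ge0_subset_integral => //.
    - by case/integrableP: iD.
    - by move=> t [].
  rewrite integral_cst// in e1.
  have e2 : (\int[mu]_(t in `[(- k%:R)%R, k%:R]) (`|Del k t| ^+ 2)%:E <= ((8 ^+ k.+1)^-1)%:E)%E.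
    by rewrite -[leLHS]fineK ?lee_fin; [exact: Hn|exact: integrable_fin_num iD].
  have := le_trans e1 e2; rewrite -lee_pdivlMl// => /le_trans; apply.
  rewrite -EFinM lee_fin /c le_eqVlt; apply/orP; left; apply/eqP.
  have -> : (8 : R) = 2 ^+ 3 by rewrite -natrX.
  rewrite -exprM mulnC exprM.
  set x := 2 ^+ k.+1; have x0 : x != 0 by rewrite gt_eqF// /x pow2_gt0.
  by field.
have N0 : mu (lim_sup_set A) = 0%E.
  apply: lim_sup_set_cvg0 => //.
  apply: (@le_lt_trans _ _ (\sum_(k <oo) (1 / (2 ^ k.+1)%:R)%:E)%E).
    by apply: lee_nneseries => k _ *; [exact: measure_ge0|exact: muA].
  by apply: le_lt_trans (epsilon_trick0 xpredT ler01) _; rewrite ltry.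
have mN : measurable (lim_sup_set A : set (measurableTypeR R)).
  by apply: bigcap_measurable => // k _; exact: bigcup_measurable.
have cv t : ~ lim_sup_set A t -> cvgn (fun k => D (n_ k) t).
  move=> tN.
  have [J HJ] : exists J, forall j, (J <= j)%N -> ~ A j t.
    apply: contrapT => h; apply: tN => J _; apply: contrapT => h'.
    by apply: h; exists J => j Jj Aj; apply: h'; exists j.
  pose K := (Num.truncn `|t|).+1.
  have tK : `|t| < K%:R by exact: truncnS_gt.
  apply: (@geometric_increments_cvg _ _ _ (maxn J K)) => j.
  rewrite geq_max => /andP[Jj Kj].
  have := HJ j Jj; rewrite /A => /not_andP[|/negP]; last by rewrite -leNgt.
  rewrite /= in_itv/= -ler_norml => h; exfalso; apply: h.
  by rewrite ltW// (lt_le_trans tK)// ler_nat.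
pose V t := if t \in lim_sup_set A then 0 else limn (fun k => D (n_ k) t).
have cV t : ~ lim_sup_set A t -> D (n_ k) t @[k --> \oo] --> V t.
  by move=> tN; rewrite /V memNset//; exact: cv.
exists V, n_; split => //.
(* The clipped quotients are simple curves; at a fixed [t] the cut-off is eventually inactive, so
   the limit is unchanged. *)
- pose h k (x : R^o) : L := 2 ^+ (n_ k) *: (W (x + (2 ^+ (n_ k))^-1) - W x).
  exists (fun k t => if t \in lim_sup_set A then 0 else h k (dyadic_clip k (n_ k) t)).
    move=> k; apply: simple_curve_if => //; first exact: simple_curve_cst.
    exact: (simple_curve_comp (h k) (dyadic_clip_simple k (n_ k))).
  move=> t; rewrite /V; case: ifPn => [_|/negP tN]; first exact: cvg_cst.
  have {}tN : ~ lim_sup_set A t by move=> ?; apply: tN; rewrite inE.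
  have := cv t tN; apply: cvg_trans; apply: near_eq_cvg.
  by have := dyadic_clip_near n_ t; apply: filterS => k ->.
- exists (lim_sup_set A); split => // t /= h; apply: contrapT => tN; apply: h.
  exact: cV.
- move=> t; have [tN|tN] := pselect (lim_sup_set A t); last by left; exact: cV.
  by right; rewrite /V mem_set.
Qed.

(** Between the dyadic floors of [s] and [t] the integral of the quotient telescopes exactly; moving
    the ends costs a multiple of the mesh by the Lipschitz bound. The integrals converge by
    dominated convergence. *)
Lemma lipschitz_ftc (V : R -> L) (n_ : nat -> nat) : smL2 V ->
  (forall k, (k <= n_ k)%N) ->
  {ae mu, forall t, D (n_ k) t @[k --> \oo] --> V t} ->
  forall w s t, s <= t -> <<W t - W s, w>> = \int[mu]_(x in `[s, t]) <<V x, w>>.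
Proof.
move=> iV n_k DV w s t st.
have iD k := smL2_ip w (dyadic_quotient_smL2 lipW (n_ k)).
have [M M0 HM] := dyadic_quotient_bounded lipW (s - 1) t.
have ipE := @ipL_norm R S.
have DM n x : s - 1 <= x <= t -> `|<<D n x, w>>| <= M * `|w|.
  by move=> xst; apply: le_trans (ip_CS ipE _ _) _; apply: ler_wpM2r => //; exact: HM.
have c1 : \int[mu]_(x in `[s, t]) <<D (n_ k) x, w>> @[k --> \oo] -->
    \int[mu]_(x in `[s, t]) <<V x, w>>.
  apply: (locRintegral_dominated (h := fun=> M * `|w|)).
  - move=> k; exact: (smeas_measurable (dyadic_quotient_smeas W (n_ k)) (@continuous_ip _ _ w)).
  - by case: iV => sV _; exact: (smeas_measurable sV (@continuous_ip _ _ w)).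
  - by move=> k x xst; apply: DM; move: xst; lra.
  - by apply: continuous_locint; exact: cst_continuous.
  - move: DV; apply: filterS; first exact: (ae_filter_ringOfSetsType mu).
    by move=> x h; apply: (cvg_ip ipE); [exact: h|exact: cvg_cst].
have c2 : \int[mu]_(x in `[s, t]) <<D (n_ k) x, w>> @[k --> \oo] --> <<W t - W s, w>>.
  have [M2 HM2] := lipW (s - 1) t.
  (* At each of the two ends there is one error in the integral, controlled by [M], and one in the
     increment of [W], controlled by [M2]. *)
  pose c := 2 * (M * `|w|) + 2 * (`|M2| * `|w|).
  have bnd k : `|<<W t - W s, w>> - \int[mu]_(x in `[s, t]) <<D (n_ k) x, w>>| <=
      c * (2 ^+ k)^-1.
    set n := n_ k.
    have pk : (2 ^+ n : R)^-1 <= (2 ^+ k)^-1.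
      by rewrite lef_pV2 ?posrE ?pow2_gt0// ler_weXn2l ?ler1n// n_k.
    have p1 : (2 ^+ n : R)^-1 <= 1 by rewrite invf_le1 ?pow2_gt0// exprn_ege1// ler1n.
    have c0 : 0 <= c by rewrite addr_ge0 ?mulr_ge0.
    apply: (@le_trans _ _ (c * (2 ^+ n)^-1)); last exact: ler_wpM2l.
    have /andP[ps sp] := dyadic_floor_itv n s.
    have /andP[qt tq] := dyadic_floor_itv n t.
    set p := dyadic_floor n s in ps sp *; set q := dyadic_floor n t in qt tq *.
    have fst : Num.floor (2 ^+ n * s) <= Num.floor (2 ^+ n * t).
      by apply: le_floor; rewrite ler_pM2l ?pow2_gt0.
    have pq : p <= q.
      by rewrite /p /q /dyadic_floor ler_pM2r ?invr_gt0 ?pow2_gt0// ler_int.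
    have ipq : \int[mu]_(x in `[p, q]) <<D n x, w>> = <<W q - W p, w>>.
      have e : Num.floor (2 ^+ n * s) + (absz (Num.floor (2 ^+ n * t) - Num.floor (2 ^+ n * s)))%:Z
          = Num.floor (2 ^+ n * t).
        by rewrite gez0_abs ?subr_ge0// addrCA subrr addr0.
      have := dyadic_quotient_cells lipW n (Num.floor (2 ^+ n * s))
        (absz (Num.floor (2 ^+ n * t) - Num.floor (2 ^+ n * s))) w.
      by rewrite e.
    have ch1 := Rintegral_chasles (iD k) ps st.
    have ch2 := Rintegral_chasles (iD k) pq qt.
    rewrite -/n in ch1 ch2.
    have small x y : s - 1 <= x -> x <= y -> y <= t ->
        `|\int[mu]_(z in `[x, y]) <<D n z, w>>| <= M * `|w| * (y - x).
      move=> sx xy yt; apply: le_trans (normr_locRintegral _ _ (iD k)) _.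
      rewrite -Rintegral_itv_cst//; apply: le_locRintegral.
      - exact/locint_norm/iD.
      - by apply: continuous_locint; exact: cst_continuous.
      - by move=> z /andP[xz zy]; apply: DM; rewrite (le_trans sx)//= (le_trans zy).
    have lw x y : s - 1 <= x -> x <= y -> y <= t ->
        `|<<W y - W x, w>>| <= `|M2| * `|w| * (y - x).
      move=> sx xy yt; apply: le_trans (ip_CS ipE _ _) _; rewrite mulrAC.
      apply: ler_wpM2r => //; apply: le_trans (HM2 _ _ sx xy yt) _.
      by apply: ler_wpM2r; [rewrite subr_ge0|exact: ler_norm].
    have sp1 : s - 1 <= p by lra.
    have sq1 : s - 1 <= q by lra.
    have s1 := small _ _ sp1 ps st; have s2 := small _ _ sq1 qt (lexx t).
    have l1 := lw _ _ sp1 ps st; have l2 := lw _ _ sq1 qt (lexx t).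
    have eW : <<W t - W s, w>> = <<W q - W p, w>> + <<W t - W q, w>> - <<W s - W p, w>>.
      by rewrite !ipBl; lra.
    have k1 : M * `|w| * (s - p) <= M * `|w| * (2 ^+ n)^-1.
      by apply: ler_wpM2l; [exact: mulr_ge0|lra].
    have k2 : M * `|w| * (t - q) <= M * `|w| * (2 ^+ n)^-1.
      by apply: ler_wpM2l; [exact: mulr_ge0|lra].
    have k3 : `|M2| * `|w| * (s - p) <= `|M2| * `|w| * (2 ^+ n)^-1.
      by apply: ler_wpM2l; [exact: mulr_ge0|lra].
    have k4 : `|M2| * `|w| * (t - q) <= `|M2| * `|w| * (2 ^+ n)^-1.
      by apply: ler_wpM2l; [exact: mulr_ge0|lra].
    rewrite eW -ipq /c; rewrite -/n in s1 s2 *.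
    clear -s1 s2 l1 l2 k1 k2 k3 k4 ch1 ch2.
    move: s1 s2 l1 l2; rewrite !ler_norml => /andP[? ?] /andP[? ?] /andP[? ?] /andP[? ?].
    apply/andP; split; lra.
  apply/subr_cvg0; apply: norm_cvg0.
  apply: (@squeeze_cvgr _ _ _ _ (fun=> 0) (fun k => c * (2 ^+ k)^-1)).
  - by apply: nearW => k; rewrite normr_ge0/= distrC.
  - exact: cvg_cst.
  - by rewrite -[X in _ --> X](mulr0 c); apply: cvgMr; exact: pow2V_cvg0.
exact: (cvg_unique _ c2 c1).
Qed.

End Limit.

(* The Radon-Nikodym property of Hilbert spaces; V is the limit of the dyadic
   difference quotients of W, a martingale bounded in L2. *)
Lemma contraction_weak_derivative {R : realType} (S : setting R) (U W : R -> spL S) :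
  curve_C1 setT U -> (forall s t, `|W t - W s| <= `|U t - U s|) ->
  exists V, [/\ weak_derivative setT W V, smL2 V & forall t, `|V t| <= `|derive1 U t|].
Proof.
move=> C1U WU.
have cU' := curve_C1_derive1 C1U.
have iU' := continuous_smL2 cU'.
have ipE := @ipL_norm R S.
have WU' (M s t : R) : s <= t -> (forall x, s <= x <= t -> `|derive1 U x| <= M) ->
    `|W t - W s| <= M * (t - s).
  move=> st HM; apply: le_trans (WU s t) _.
  exact: (ftc_norm iU' (curve_C1_ftc C1U) st HM).
have lipW a b : exists M, forall s t, a <= s -> s <= t -> t <= b ->
    `|W t - W s| <= M * (t - s).
  have [ab|ba] := leP a b; last first.
    by exists 0 => s t as_ st tb; exfalso; move: (le_trans as_ (le_trans st tb)); rewrite leNgt ba.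
  have cn : continuous (fun t => `|derive1 U t|).
    move=> t; apply: (@continuous_comp _ _ _ (derive1 U) (@Num.norm _ _)); first exact: cU'.
    exact: norm_continuous.
  have [c _ Hc] := EVT_max ab (continuous_subspaceT cn).
  exists `|derive1 U c| => s t as_ st tb; apply: WU' => // x /andP[sx xt].
  by apply: Hc; rewrite in_itv/= (le_trans as_)// (le_trans xt).
have [V [n_ [sV n_k DV DV0]]] := dyadic_quotient_limit lipW.
have VU t : `|V t| <= `|derive1 U t|.
  have [cV|->] := DV0 t; last by rewrite normr0.
  (* The cell containing [t] shrinks to [t], and on it the slope of [W] is at most the supremum of
     the speed of [U], which is within [e] of its value at [t] by continuity. *)
  apply/ler_addgt0Pr => e e0.
  have /cvgrPdist_lt/(_ _ e0)[d /= d0 hd] := cU' t.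
  apply: (cvgr_to_le (cvg_norm cV)); near=> k; set n := n_ k.
  have pk : (2 ^+ n : R)^-1 <= (2 ^+ k)^-1.
    by rewrite lef_pV2 ?posrE ?pow2_gt0// ler_weXn2l ?ler1n// n_k.
  have kd : (2 ^+ k : R)^-1 < d.
    by rewrite -div1r; near: k; exact: (near_infty_natSinv_expn_lt (PosNum d0)).
  have /andP[pt tp] := dyadic_floor_itv n t.
  have pV : 0 < (2 ^+ n : R)^-1 by rewrite invr_gt0 pow2_gt0.
  rewrite /dyadic_quotient normrZ (gtr0_norm (pow2_gt0 _)) mulrC -ler_pdivlMr ?pow2_gt0//.
  apply: le_trans (WU' (`|derive1 U t| + e) _ _ _ _) _.
  - by rewrite lerDl ltW.
  - move=> x /andP[px xp].
    have /hd/= : ball_ [eta Num.norm] t d x by rewrite /= ltr_norml; apply/andP; split; lra.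
    rewrite distrC => h; have := ler_normD (derive1 U t) (derive1 U x - derive1 U t).
    by rewrite addrC subrK; lra.
  - by rewrite addrAC subrr add0r.
have iV : smL2 V.
  split => //; apply: (@le_locint _ _ (fun t => `|derive1 U t| ^+ 2)).
  - exact: (smeas_measurable sV (@norm2_continuous _ _)).
  - by move=> t; rewrite ger0_norm ?sqr_ge0// ler_sqr ?nnegrE.
  - exact/continuous_locint/continuous_norm2.
exists V; split => //; apply: ftc_weak_derivative => //.
  move=> t; apply/cvgrPdist_lt => e e0.
  have cU := curve_C1_continuous C1U; have /cvgrPdist_lt/(_ _ e0) := cU t.
  by apply: filterS => x; apply: le_lt_trans.
exact: (lipschitz_ftc lipW iV n_k DV).
Unshelve. all: by end_near. Qed.

(** * The weighted energy on X *)

Section Distance.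
Context {R : realType} {V : normedModType R}.
Implicit Types (A : set V) (v : V) (r : R).

Lemma dist_to_ge0 A v : (0 <= dist_to A v)%E.
Proof. by apply: le_ereal_inf_tmp => _ [f _ <-]; rewrite lee_fin. Qed.

Lemma dist_to_le A v f : A f -> (dist_to A v <= (`|v - f|)%:E)%E.
Proof. by move=> Af; apply: ereal_inf_lbound; exists f. Qed.

Lemma dist_to_nonempty A v r : (dist_to A v <= r%:E)%E -> A !=set0.
Proof.
move=> h; apply/set0P/negP => /eqP A0; move: h.
by rewrite /dist_to A0 image_set0 ereal_inf0 leye_eq.
Qed.

Lemma dist_to_le_dist A v w : (dist_to A v <= dist_to A w + (`|v - w|)%:E)%E.
Proof.
rewrite -leeBlDr//; apply: le_ereal_inf_tmp => _ [f Af <-]; rewrite leeBlDr//.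
apply: le_trans (dist_to_le v Af) _; rewrite -EFinD lee_fin.
by have := ler_normD (v - w) (w - f); rewrite subrKA; lra.
Qed.

Lemma dist_to_closed A (r : R) : closed [set v | (dist_to A v <= r%:E)%E].
Proof.
move=> v clv; apply/lee_addgt0Pr => e e0.
have [w [/= wr vw]] := clv _ (nbhsx_ballx v _ e0).
apply: le_trans (dist_to_le_dist A v w) _; apply: leeD => //.
by rewrite lee_fin ltW//; move: vw; rewrite -ball_normE.
Qed.

End Distance.

Lemma ae_imp {R : realType} (P Q : R -> Prop) :
  {ae (@lebesgue_measure R), forall x, P x} -> (forall x, P x -> Q x) ->
  {ae (@lebesgue_measure R), forall x, Q x}.
Proof. by move=> aeP PQ; apply: negligibleS aeP => x /= nQ /PQ. Qed.

Section RealIntegrals.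
Context {R : realType}.
Local Notation mu := (@lebesgue_measure R).

Lemma ge0_integral_growing (f : R -> R) (u v : nat -> R) (D : set R) :
  (forall t, 0 <= f t) -> measurable_fun setT f ->
  (forall n m, (n <= m)%N -> u m <= u n) -> (forall n m, (n <= m)%N -> v n <= v m) ->
  D = \bigcup_n `[u n, v n]%classic ->
  (\int[mu]_(t in `[u n, v n]) (f t)%:E)%E @[n --> \oo] --> (\int[mu]_(t in D) (f t)%:E)%E.
Proof.
move=> f0 mf du dv ->.
apply: ge0_nondecreasing_set_cvg_integral.
- move=> i j ij; apply/subsetPset => t /=; rewrite !in_itv/= => /andP[ut tv].
  by rewrite (le_trans (du _ _ ij))// (le_trans tv)// dv.
- by move=> i; exact: measurable_itv.
- by move=> i; apply/measurable_EFinP; exact: measurable_funTS.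
- by move=> i t _; rewrite lee_fin.
Qed.

Lemma FTC2_integral (f F : R -> R) x y : x <= y -> continuous f ->
  (forall t, is_derive t (1:R) F (f t)) ->
  (\int[mu]_(t in `[x, y]) (f t)%:E = (F y - F x)%:E)%E.
Proof.
move=> xy cf dF; rewrite -(FTC2 xy cf dF) /Rintegral fineK//.
apply: integrable_fin_num; first exact: measurable_itv.
exact: continuous_locint.
Qed.

Lemma expR_natN_cvg0 (c : R) : 0 < c -> expR (- (c * n%:R)) @[n --> \oo] --> (0 : R).
Proof.
move=> c0; apply/cvgrPdist_lt => e e0; near=> n.
rewrite sub0r normrN ger0_norm ?expR_ge0// expRN.
have n0 : 0 < n%:R :> R by near: n; exact: nbhs_infty_gtr.
have cn : 0 < c * n%:R by rewrite mulr_gt0.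
rewrite -[ltRHS]invrK ltf_pV2 ?posrE ?expR_gt0 ?invr_gt0//.
apply: (lt_le_trans _ (expR_ge1Dx _)); apply: (@lt_trans _ _ (c * n%:R)); last lra.
rewrite mulrC -ltr_pdivrMr//.
by near: n; exact: nbhs_infty_gtr.
Unshelve. all: by end_near. Qed.

Lemma is_derive_expR_scaled (c x : R) :
  is_derive x (1:R) (fun t => expR (c * t)) (c * expR (c * x)).
Proof.
have h : is_derive x (1:R) (fun t : R => c * t) c.
  apply: is_derive_eq (is_deriveZ c (is_derive_id x (1:R))) _.
  by rewrite /GRing.scale/= mulr1.
rewrite mulrC; exact: (@is_derive1_comp R expR (fun t : R => c * t) x _ _ (is_derive_expR _) h).
Qed.

Lemma continuous_expR_scaled (c : R) : continuous (fun t : R => expR (c * t)).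
Proof.
move=> x; apply/differentiable_continuous/derivable1_diffP.
by case: (is_derive_expR_scaled c x).
Qed.

Lemma improper_cvg (f F : R -> R) (u v : nat -> R) (D : set R) (l m : R) :
  (forall t, 0 <= f t) -> continuous f -> (forall t, is_derive t (1:R) F (f t)) ->
  (forall n m, (n <= m)%N -> u m <= u n) -> (forall n m, (n <= m)%N -> v n <= v m) ->
  u 0%N <= v 0%N -> D = \bigcup_n `[u n, v n]%classic ->
  F (u n) @[n --> \oo] --> l -> F (v n) @[n --> \oo] --> m ->
  (\int[mu]_(t in D) (f t)%:E = (m - l)%:E)%E.
Proof.
move=> f0 cf dF du dv uv DE Fl Fm.
have mf : measurable_fun setT f by exact: continuous_measurable_fun.
have c1 := ge0_integral_growing f0 mf du dv DE.
have c2 : (\int[mu]_(t in `[u n, v n]) (f t)%:E)%E @[n --> \oo] --> (m - l)%:E.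
  rewrite (_ : (fun n => _) = fun n => (F (v n) - F (u n))%:E).
    apply/fine_cvgP; split; first exact: nearW.
    by apply: cvgB.
  apply/funext => n; apply: FTC2_integral => //.
  by rewrite (le_trans (du _ _ (leq0n n)))// (le_trans uv)// dv.
exact: (cvg_unique _ c1 c2).
Qed.

Lemma integral_expR_Ny (c b : R) : 0 < c ->
  (\int[mu]_(t in `]-oo, b]) (expR (c * t))%:E = (c^-1 * expR (c * b))%:E)%E.
Proof.
move=> c0; rewrite -[X in (X)%:E]subr0.
apply: (@improper_cvg _ (fun t => c^-1 * expR (c * t)) (fun n => b - n%:R) (fun=> b)) => //.
- exact: continuous_expR_scaled.
- move=> t; apply: is_derive_eq (is_deriveZ c^-1 (is_derive_expR_scaled c t)) _.
  by rewrite /GRing.scale/= mulrA mulVf ?mul1r// gt_eqF.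
- by move=> n m nm; rewrite lerD2l lerN2 ler_nat.
- by rewrite subr0.
- apply/seteqP; split=> [t /=|t [n _ /=]]; rewrite in_itv/= => tb.
    exists (Num.truncn (b - t)).+1 => //=; rewrite in_itv/= tb andbT.
    by have := truncnS_gt (b - t); lra.
  by move: tb => /andP[].
- rewrite (_ : (fun n => _) = fun n => c^-1 * expR (c * b) * expR (- (c * n%:R))).
    rewrite -[X in _ --> X](mulr0 (c^-1 * expR (c * b))); apply: cvgMr.
    exact: expR_natN_cvg0.
  by apply/funext => n; rewrite mulrBr expRD mulrA.
- exact: cvg_cst.
Qed.

Lemma ge0_improper_FTC (f F : R -> R) (l m : R) : (forall t, 0 <= f t) ->
  continuous f -> (forall t, is_derive t (1:R) F (f t)) ->
  F (- n%:R) @[n --> \oo] --> l -> F n%:R @[n --> \oo] --> m ->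
  (\int[mu]_t (f t)%:E = (m - l)%:E)%E.
Proof.
move=> f0 cf dF Fl Fm.
apply: (@improper_cvg f F (fun n => - n%:R) (fun n => n%:R)) => //.
- by move=> n k nk; rewrite lerN2 ler_nat.
- by move=> n k nk; rewrite ler_nat.
- by rewrite oppr0.
- apply/seteqP; split=> // t _; exists (Num.truncn `|t|).+1 => //=.
  by rewrite in_itv/= -ler_norml ltW// truncnS_gt.
Qed.

Lemma integrable_expR_Ny (c b : R) : 0 < c ->
  mu.-integrable `]-oo, b] (fun t => (expR (c * t))%:E).
Proof.
move=> c0; apply/integrableP; split.
  apply/measurable_EFinP; apply: measurable_funTS; apply: continuous_measurable_fun.
  exact: continuous_expR_scaled.
under eq_integral do rewrite gee0_abs ?lee_fin ?expR_ge0//.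
by rewrite integral_expR_Ny// ltry.
Qed.

End RealIntegrals.

Section Energy.
Context {R : realType} (S : setting R).
Local Notation L := (spL S).
Local Notation E := (@potE R S).
Local Notation mu := (@lebesgue_measure R).
Implicit Types (U V W : R -> L).

(** The integrand of [energy] with an explicit weak derivative [V] in place of the choice [wderiv];
    for continuous [U] and a representative [V] in [smL2] it is measurable. *)
Definition density (c : R) U V (t : R) : \bar R :=
  (((2^-1 * `|V t| ^+ 2)%:E + E (U t)) * (expR (c * t))%:E)%E.

Lemma weak_derivative_unique U V1 V2 : continuous U ->
  weak_derivative setT U V1 -> weak_derivative setT U V2 -> ae_eq mu setT V1 V2.
Proof.
move=> cU d1 d2.
have [W1 i1 e1] := L2loc_smL2 d1.1; have [W2 i2 e2] := L2loc_smL2 d2.1.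
have f1 := weak_derivative_ftc cU i1 (weak_derivative_ae e1 d1).
have f2 := weak_derivative_ftc cU i2 (weak_derivative_ae e2 d2).
have W12 : ae_eq mu setT W1 W2.
  by apply: ftc_unique => // w s t st; rewrite -f1// -f2.
exact: ae_eq_trans e1 (ae_eq_trans W12 (ae_eq_sym e2)).
Qed.

Lemma energy_density_ae c U V : continuous U -> weak_derivative setT U V ->
  ae_eq mu setT (energy_density setT c U) (density c U V).
Proof.
move=> cU dV.
have dW : weak_derivative setT U (wderiv setT U).
  exact: (xgetPex (fun=> 0) (ex_intro _ V dV)).
apply: (ae_imp (weak_derivative_unique cU dW dV)) => t h ?.
by rewrite /energy_density /density h.
Qed.

Lemma energyE c U V : continuous U -> weak_derivative setT U V ->
  energy setT c U = (\int[mu]_t density c U V t)%E.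
Proof. by move=> cU dV; apply: ae_eq_integral_nonmeas; exact: energy_density_ae. Qed.

Lemma energy_definedE c U V : continuous U -> weak_derivative setT U V ->
  (\int[mu]_t (density c U V)^\- t < +oo)%E -> energy_defined setT c U.
Proof.
move=> cU dV h; right.
rewrite (_ : (\int[mu]_(t in setT) _)%E = (\int[mu]_t (density c U V)^\- t)%E)//.
apply: ae_eq_integral_nonmeas; apply: (ae_imp (energy_density_ae c cU dV)) => t e /e.
by rewrite !funenegE => ->.
Qed.

End Energy.

Section Coercivity.
Context {R : realType} (S : setting R).
Local Notation L := (spL S).
Local Notation E := (@potE R S).
Local Notation F := (@setF R S).
Local Notation a := (levA S).
Local Notation mu := (@lebesgue_measure R).
Local Notation "<< u , v >>" := (@ipL R S u v).
Implicit Types (U V W : R -> L).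
Context (h1 : hypH1 S).

Lemma nbF_mono s (r r' : R) v : r <= r' -> nbF s r v -> @nbF R S s r' v.
Proof. by move=> rr' /le_trans; apply; rewrite lee_fin. Qed.

Lemma nbF_half s v : nbF s (r0 S s / 2) v -> @nbF R S s (r0 S s) v.
Proof.
apply: nbF_mono; have [_ [_ [_ [_ [_ [r0p _]]]]]] := h1.
by have := r0p s; lra.
Qed.

Lemma potE_Plus_ge0 v : nbF Plus (r0 S Plus) v -> (0 <= E v)%E.
Proof.
have [_ [_ [_ [_ [_ [_ [_ [C1 [coer _]]]]]]]]] := h1 => nv.
have := coer Plus v nv; rewrite /lev sube0; apply: le_trans.
apply: mule_ge0; last by rewrite expe_ge0 ?dist_to_ge0.
by rewrite lee_fin invr_ge0; have := C1 Plus; lra.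
Qed.

Lemma potE_ge v f : F Minus f -> (a%:E <= E v)%E.
Proof.
by have [_ [_ [_ [EF _]]]] := h1 => Ff; have [h <-] := EF v f Ff.
Qed.

Lemma potE_Minus f : F Minus f -> E f = a%:E.
Proof. by have [_ [_ [_ [EF _]]]] := h1 => Ff; have [_] := EF f f Ff. Qed.

Lemma levA_lt0 : a < 0.
Proof. by have [_ [_ []]] := h1. Qed.

(** Along a sequence of times converging to [t] the curve converges strongly, hence weakly, and weak
    lower semicontinuity applies. Since [E] may be infinite along a curve of X, this is the source
    of the measurability of the density. *)
Lemma potE_lsc U : continuous U -> lower_semicontinuous (fun t => E (U t)).
Proof.
move=> cU t b bE; apply: contrapT => h.
have Hn n : exists y, ball t n.+1%:R^-1 y /\ (E (U y) <= b%:E)%E.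
  apply: contrapT => h'; apply: h; exists (ball t n.+1%:R^-1).
    by apply: nbhsx_ballx; rewrite invr_gt0.
  by move=> y ty; rewrite ltNge; apply/negP => Ey; apply: h'; exists y.
have [y Hy] := choice Hn.
have yt : y n @[n --> \oo] --> t.
  apply/cvgrPdist_lt => e e0; near=> n; have [+ _] := Hy n.
  rewrite -ball_normE/= => /lt_trans; apply.
  by near: n; exact: (near_infty_natSinv_lt (PosNum e0)).
have Uy : U (y n) @[n --> \oo] --> U t by apply: (cvg_comp _ _ yt); exact: cU.
have [wlsc _] := h1.
have := wlsc (fun n => U (y n)) (U t) _.
have wk w : <<U (y n), w>> @[n --> \oo] --> <<U t, w>>.
  by apply: (cvg_ip (@ipL_norm R S)) => //; exact: cvg_cst.
move=> /(_ wk); apply/negP; rewrite -ltNge; apply: le_lt_trans bE.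
rewrite limn_einf_lim; apply: lime_le; first exact: is_cvg_einfs.
apply: nearW => n; apply: le_trans (proj2 (Hy n)).
by apply: ereal_inf_lbound; exists n => /=.
Unshelve. all: by end_near. Qed.

Lemma potE_measurable U : continuous U ->
  measurable_fun setT (fun t => E (U t) : \bar R).
Proof. by move=> cU; apply: lower_semicontinuous_measurable; exact: potE_lsc. Qed.

Lemma density_measurable c U V : continuous U -> smeas V ->
  measurable_fun setT (density c U V).
Proof.
move=> cU sV; apply: emeasurable_funM.
  apply: emeasurable_funD; last exact: potE_measurable.
  apply/measurable_EFinP; apply: measurable_funM; first exact: measurable_cst.
  exact: (smeas_measurable sV (@norm2_continuous _ _)).
apply/measurable_EFinP; apply: continuous_measurable_fun.
exact: continuous_expR_scaled.
Qed.

Lemma spX_continuous U : spX U -> continuous U.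
Proof. by case=> [[cU _] _]; apply/continuous_subspace_setT. Qed.

Lemma spX_weak_derivative U : spX U -> exists2 V, weak_derivative setT U V & smL2 V.
Proof.
case=> [[_ [V dV]] _]; have [V' i' e'] := L2loc_smL2 dV.1.
by exists V' => //; exact: weak_derivative_ae dV.
Qed.

Lemma spX_F_nonempty U s : spX U -> exists f, F s f.
Proof.
move=> [_ [T T1 [TP TM]]].
case: s; [have := TM (- T) (lexx _)|have := TP T (lexx _)]; exact: dist_to_nonempty.
Qed.

Lemma spX_lower U : spX U -> (forall t, (a%:E <= E (U t))%E) /\
  exists2 T, 1 <= T & forall t, T <= t -> (0 <= E (U t))%E.
Proof.
move=> XU; have [f Ff] := spX_F_nonempty Minus XU; split.
  by move=> t; exact: potE_ge Ff.
have [_ [T T1 [TP _]]] := XU; exists T => // t Tt.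
by apply: potE_Plus_ge0; apply: nbF_half; exact: TP.
Qed.

Lemma density_ge c U V t (b : R) : b <= 0 -> (b%:E <= E (U t))%E ->
  ((b * expR (c * t))%:E <= density c U V t)%E.
Proof.
move=> b0 bE; rewrite EFinM; apply: lee_wpmul2r; first by rewrite lee_fin expR_ge0.
by apply: le_trans bE _; rewrite leeDr// lee_fin mulr_ge0// exprn_ge0.
Qed.

Lemma density_funeneg_le c U V t (b : R) : b <= 0 -> (b%:E <= E (U t))%E ->
  ((density c U V)^\- t <= (- b * expR (c * t))%:E)%E.
Proof.
move=> b0 bE; rewrite funenegE ge_max; apply/andP; split.
  by rewrite mulNr EFinN leeN2; exact: density_ge.
by rewrite lee_fin mulr_ge0 ?expR_ge0// oppr_ge0.
Qed.

(** The negative part is at most [- a * expR (c * t)] up to the time [T] after which the curve stays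
    near [F Plus], and it vanishes afterwards. *)
Lemma density_funeneg_integral c U V : 0 < c -> spX U ->
  (\int[mu]_t (density c U V)^\- t < +oo)%E.
Proof.
move=> c0 XU; have [Ea [T T1 ET]] := spX_lower XU.
have a0 := levA_lt0.
apply: (@le_lt_trans _ _ (\int[mu]_(t in `]-oo, T]) (- a * expR (c * t))%:E)%E).
  rewrite [leRHS]integral_mkcond; apply: ge0_le_integral_nonmeas => [t _|t _].
    exact: funeneg_ge0.
  rewrite patchE; case: ifPn => [_|/negP tT].
    by apply: density_funeneg_le; [exact: ltW|exact: Ea].
  have Tt : T <= t.
    by rewrite leNgt; apply/negP => /ltW h; apply: tT; rewrite inE/= in_itv/= h.
  by have := @density_funeneg_le c U V t 0 (lexx _) (ET t Tt); rewrite oppr0 mul0r.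
under eq_integral do rewrite EFinM.
rewrite ge0_integralZl_EFin//.
- by rewrite integral_expR_Ny// -EFinM ltry.
- apply/measurable_EFinP; apply: measurable_funTS; apply: continuous_measurable_fun.
  exact: continuous_expR_scaled.
- by rewrite oppr_ge0 ltW.
Qed.

Lemma spX_energy_defined c U : 0 < c -> spX U -> energy_defined setT c U.
Proof.
move=> c0 XU; have [V dV iV] := spX_weak_derivative XU.
apply: energy_definedE dV _; first exact: spX_continuous.
exact: density_funeneg_integral.
Qed.

(** The right-hand form involves no subtraction of possibly infinite integrals and can be split at a
    time. *)
Lemma energy_ge0P c U V : 0 < c -> spX U -> weak_derivative setT U V ->
  (0 <= energy setT c U)%E <->
  (\int[mu]_t (density c U V)^\- t <= \int[mu]_t (density c U V)^\+ t)%E.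
Proof.
move=> c0 XU dV; rewrite (energyE c (spX_continuous XU) dV) integralE sube_ge0//.
apply/orP; left; rewrite ge0_fin_numE; first exact: density_funeneg_integral.
by apply: integral_ge0 => t _; exact: funeneg_ge0.
Qed.

Lemma inf_energy_ge0 c U : inf_energy S c = 0%E -> spX U -> (0 <= energy setT c U)%E.
Proof. by move=> <- XU; apply: ereal_inf_lbound; exists U. Qed.

End Coercivity.

(** * Gluing a curve to the set of global minimizers *)

Section Gluing.
Context {R : realType} (S : setting R).
Local Notation L := (spL S).
Local Notation mu := (@lebesgue_measure R).
Local Notation "<< u , v >>" := (@ipL R S u v).
Implicit Types (U V W : R -> L).

Definition ftc_on (I : R -> Prop) U V : Prop := forall w s t, I s -> I t -> s <= t ->
  <<U t - U s, w>> = \int[mu]_(x in `[s, t]) <<V x, w>>.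

Lemma ftc_on_glue (I : R -> Prop) m U V : (forall w, locint (fun t => <<V t, w>>)) ->
  I m -> ftc_on (fun t => I t /\ t <= m) U V -> ftc_on (fun t => I t /\ m <= t) U V ->
  ftc_on I U V.
Proof.
move=> iV Im fl fr w s t Is It st.
have [tm|mt] := leP t m; first by apply: fl => //; split=> //; exact: le_trans tm.
have [sm|ms] := leP s m; last by apply: fr => //; split=> //; exact: ltW.
have mt' := ltW mt.
rewrite (Rintegral_chasles (iV w) sm mt') -(fl w s m)// -(fr w m t)// -ipDl.
by rewrite [U m - U s + _]addrC subrKA.
Qed.

Lemma Rintegral_eq_open (f g : R -> R) (s t : R) : locint f -> locint g ->
  (forall x, s < x <= t -> f x = g x) ->
  \int[mu]_(x in `[s, t]) f x = \int[mu]_(x in `[s, t]) g x.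
Proof.
move=> fi gi fg.
have io h : locint h -> mu.-integrable `]s, t] (EFin \o h).
  move=> hi; apply: (integrableS _ _ _ (hi s t)).
  - exact: measurable_itv.
  - exact: measurable_itv.
  - by move=> x; rewrite /= !in_itv/= => /andP[/ltW -> ->].
rewrite -Rintegral_itv_obnd_cbnd; last exact: io.
rewrite -[RHS]Rintegral_itv_obnd_cbnd; last exact: io.
by apply: eq_Rintegral => x; rewrite inE/= in_itv/=; exact: fg.
Qed.

(* The curve t |-> U t for t >= t0, continued to the left of t0 by the segment
   from U t0 to U t0 - d, run through in unit time, and then by a constant. *)
Definition ramp (t0 t : R) : R := Num.max (t - t0) (-1).

Definition gluing (t0 : R) (d : L) U (t : R) : L :=
  U (Num.max t t0) + ramp t0 (Num.min t t0) *: d.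

Definition glue_derivative (t0 : R) (d : L) V (t : R) : L :=
  if t \in `]t0, +oo[%classic then V t
  else if t \in `]t0 - 1, t0]%classic then d else 0.

Lemma glue_right t0 d U t : t0 <= t -> gluing t0 d U t = U t.
Proof.
move=> tt; rewrite /gluing /ramp (max_l tt) (min_r tt) subrr max_l ?scale0r ?addr0//.
Qed.

Lemma glue_left t0 d U t : t <= t0 -> gluing t0 d U t = U t0 + ramp t0 t *: d.
Proof. by move=> tt; rewrite /gluing (max_r tt) (min_l tt). Qed.

Lemma glue_continuous t0 d U : continuous U -> continuous (gluing t0 d U).
Proof.
have c1 (k : R) : continuous (fun t : R => k) by move=> t; exact: cst_continuous.
have c2 : continuous (fun t : R => t) by move=> t; exact: cvg_id.
move=> cU t; apply: cvgD.
  apply: (@continuous_comp _ _ _ (fun t : R => Num.max t t0) U); last exact: cU.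
  by apply: (@continuous_max _ _ (fun t : R => t) (fun=> t0)); [exact: c2|exact: c1].
apply: cvgZr_tmp; apply: (@continuous_max _ _ (fun t : R => Num.min t t0 - t0) (fun=> -1)); last exact: c1.
apply: cvgB; last exact: c1.
by apply: (@continuous_min _ _ (fun t : R => t) (fun=> t0)); [exact: c2|exact: c1].
Qed.

Lemma glue_derivative_right t0 d V t : t0 < t -> glue_derivative t0 d V t = V t.
Proof. by move=> tt; rewrite /glue_derivative mem_set//= in_itv/= tt. Qed.

Lemma glue_derivative_mid t0 d V t : t0 - 1 < t <= t0 -> glue_derivative t0 d V t = d.
Proof.
move=> tt; have /andP[_ tt0] := tt; rewrite /glue_derivative memNset/=; last first.
  by rewrite in_itv/= andbT ltNge tt0.
by rewrite mem_set//= in_itv.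
Qed.

Lemma glue_derivative_left t0 d V t : t <= t0 - 1 -> glue_derivative t0 d V t = 0.
Proof.
move=> tt; rewrite /glue_derivative memNset/=; last first.
  by rewrite in_itv/= andbT => h; move: tt; apply/negP; rewrite -ltNge; lra.
by rewrite memNset//= in_itv/= => /andP[h _]; move: tt; apply/negP; rewrite -ltNge.
Qed.

Lemma glue_derivative_smL2 t0 d V : smL2 V -> smL2 (glue_derivative t0 d V).
Proof.
move=> [sV iV].
have sG : smeas (glue_derivative t0 d V).
  have m1 : measurable (`]t0, +oo[%classic : set (measurableTypeR R)).
    exact: measurable_itv.
  have m2 : measurable (`]t0 - 1, t0]%classic : set (measurableTypeR R)).
    exact: measurable_itv.
  apply: smeas_if; [exact: m1|exact: sV|].
  by apply: smeas_if; [exact: m2|exact: smeas_cst|exact: smeas_cst].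
split => //; apply: (@le_locint _ _ (fun t => `|V t| ^+ 2 + `|d| ^+ 2)).
- exact: (smeas_measurable sG (@norm2_continuous _ _)).
- move=> t; rewrite ger0_norm ?sqr_ge0// /glue_derivative.
  case: ifP => _; first by rewrite lerDl sqr_ge0.
  case: ifP => _; first by rewrite lerDr sqr_ge0.
  by rewrite normr0 expr0n/= addr_ge0 ?sqr_ge0.
- by apply: locintD => //; apply: continuous_locint; exact: cst_continuous.
Qed.

Lemma glue_weak_derivative t0 d U V : continuous U -> smL2 V ->
  weak_derivative setT U V ->
  weak_derivative setT (gluing t0 d U) (glue_derivative t0 d V).
Proof.
move=> cU iV dV.
have iG := glue_derivative_smL2 t0 d iV.
have ftcV := weak_derivative_ftc cU iV dV.
apply: ftc_weak_derivative => //; first exact: glue_continuous.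
move=> w s t st.
have lG w' := smL2_ip w' iG.
have lc (k : R) : locint (fun=> k) by apply: continuous_locint; exact: cst_continuous.
suff : ftc_on (fun=> True) (gluing t0 d U) (glue_derivative t0 d V) by apply.
apply: (@ftc_on_glue _ (t0 - 1)) => // {w s t st} w s t [_ sm] [_ tm] st.
  rewrite !glue_left; [|lra|lra].
  have rm x : x <= t0 - 1 -> ramp t0 x = -1 by move=> xt; rewrite /ramp max_r//; lra.
  rewrite !rm// subrr ip0l.
  rewrite (_ : Rintegral _ _ _ = \int[mu]_(x in `[s, t]) (fun=> 0) x).
    by rewrite Rintegral_itv_cst// mul0r.
  apply: eq_Rintegral => x; rewrite inE/= in_itv/= => /andP[sx xt].
  by rewrite glue_derivative_left ?ip0l//; lra.
suff : ftc_on (fun t => t0 - 1 <= t) (gluing t0 d U) (glue_derivative t0 d V) by apply.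
apply: (@ftc_on_glue _ t0) => //; first lra; move=> {w s t sm tm st} w s t [s1 s2] [t1 t2] st.
  rewrite !glue_left// /ramp !max_l; [|lra|lra].
  rewrite opprD addrACA subrr add0r -scalerBl ipZl.
  rewrite (_ : t - t0 - (s - t0) = t - s); last lra.
  rewrite (@Rintegral_eq_open _ (fun=> << d, w >>))//; first by rewrite Rintegral_itv_cst// mulrC.
  by move=> x /andP[sx xt]; rewrite glue_derivative_mid//; apply/andP; split; lra.
rewrite !glue_right// ftcV//; apply: Rintegral_eq_open => //.
- exact: smL2_ip.
- by move=> x /andP[sx xt]; rewrite glue_derivative_right//; lra.
Qed.

End Gluing.
(** Meant for [x] and [y] the integrals of the negative and positive parts to the left of a time,
    [p] and [q] those to its right. The latter may be infinite, whence the case analysis. *)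
Lemma tail_arith {R : realType} (x y p q : \bar R) (k : R) :
  x \is a fin_num -> y \is a fin_num -> (0 <= p)%E -> (0 <= q)%E ->
  (y - x <= k%:E)%E -> (x + p <= y + q)%E -> (p <= q + k%:E)%E.
Proof.
case: x => [x| |]//; case: y => [y| |]//; case: p => [p| |]//; case: q => [q| |]// _ _ _ _.
- by rewrite -EFinB -!EFinD !lee_fin; lra.
- by move=> _ _; rewrite leey.
Qed.

Section Tail.
Context {R : realType} (S : setting R).
Local Notation L := (spL S).
Local Notation E := (@potE R S).
Local Notation F := (@setF R S).
Local Notation a := (levA S).
Local Notation incH := (incH S).
Local Notation PH := (@projH R S Minus).
Local Notation C := (cstC S Minus).
Local Notation mu := (@lebesgue_measure R).
Implicit Types (U V W : R -> L) (h : spH S).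
Context (h1 : hypH1 S) (h2 : hypH2 S) (h5 : hypH5 S).

(** With [d = h - PH h], the unit-time segment along [d] has kinetic energy at most half of [|d|^2]
    and potential excess at most [C ^+ 2] times it; the outer [C ^+ 2] bounds [|d|^2] by the excess
    of energy of [h] over [a]. *)
Definition tail_cst : R := C ^+ 2 * (2^-1 + C ^+ 2).

Lemma cstC_gt1 s : 1 < cstC S s.
Proof. by have [_ [_ [_ [_ [_ [_ [_ [C1 _]]]]]]]] := h1. Qed.

Lemma incH_le h : `|incH h| <= `|h|.
Proof. by have [_ []] := h2. Qed.

Lemma projH_nearest h : nbFH Minus (r0 S Minus) h -> nearest (@FH R S Minus) h (PH h).
Proof. by have [p _] := h5 Minus => /p[]. Qed.

Lemma projH_dist_le h : nbFH Minus (r0 S Minus) h -> `|h - PH h| <= r0 S Minus.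
Proof.
by move=> nh; have [_ e] := projH_nearest nh; rewrite -lee_fin e.
Qed.

(** No point of the segment is farther from the minimizers, in the norm of [H], than its start [h],
    so the upper quadratic bound of (H5) applies all along it. *)
Lemma segment_potE h s : nbFH Minus (r0 S Minus) h -> 0 <= s <= 1 ->
  (E (incH (h - s *: (h - PH h))%R) <= (a + C ^+ 2 * `|h - PH h| ^+ 2)%:E)%E.
Proof.
move=> nh /andP[s0 s1]; set d := h - PH h; set k := h - s *: d.
have [Fp hp] := projH_nearest nh.
have kp : (dist_to (@FH R S Minus) k <= `|d|%:E)%E.
  apply: le_trans (dist_to_le k Fp) _; rewrite lee_fin.
  rewrite (_ : k - PH h = (1 - s) *: d).
    by rewrite normrZ ger0_norm ?subr_ge0// ler_piMl// lerBlDr lerDl.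
  by rewrite scalerBl scale1r /k /d addrAC.
have nk : nbFH Minus (r0 S Minus) k.
  by apply: le_trans kp _; rewrite lee_fin; exact: projH_dist_le.
have [_ [_ [/(_ k nk)[_ [_ up]] _]]] := h5 Minus.
have [_ ek] := projH_nearest nk.
rewrite EFinD -leeBlDl//; apply: le_trans up _; rewrite lee_fin.
apply: ler_wpM2l; first exact: sqr_ge0.
by rewrite ler_sqr ?nnegrE// -lee_fin ek.
Qed.

Lemma projH_coercive h e : nbFH Minus (r0 S Minus) h -> E (incH h) = e%:E ->
  `|h - PH h| ^+ 2 <= C ^+ 2 * (e - a).
Proof.
move=> nh he; have [_ [_ [/(_ h nh)[_ [lo _]] _]]] := h5 Minus.
have C0 : 0 < C ^+ 2 by have := cstC_gt1 Minus; nra.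
by move: lo; rewrite he -EFinD lee_fin/= mulrC ler_pdivrMr// mulrC.
Qed.

Lemma glue_end U t0 h : U t0 = incH h -> U t0 + -1 *: incH (h - PH h) = incH (PH h).
Proof. by move=> ->; rewrite scaleN1r linearB opprB addrC subrK. Qed.

Lemma glue_spX t0 U V h : spX U -> smL2 V -> weak_derivative setT U V ->
  nbFH Minus (r0 S Minus) h -> U t0 = incH h -> spX (gluing t0 (incH (h - PH h)) U).
Proof.
move=> XU iV dV nh Uh; have cU := spX_continuous XU; split.
  split; first by apply/continuous_subspaceT; exact: glue_continuous.
  by exists (glue_derivative t0 (incH (h - PH h)) V); exact: glue_weak_derivative.
have [_ [T T1 [TP TM]]] := XU.
have t0n := ler_norm t0; have := ler_norm (- t0); rewrite normrN => t0n'.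
exists (Num.max T (`|t0| + 1)); first by rewrite le_max T1.
split=> t.
  rewrite ge_max => /andP[Tt tt]; rewrite glue_right; last by lra.
  exact: TP.
rewrite lerNr ge_max => /andP[_ tt]; rewrite glue_left; last lra.
rewrite /ramp max_r; last lra.
rewrite (glue_end Uh).
have [Fp _] := projH_nearest nh.
apply: le_trans (@dist_to_le _ _ (F Minus) _ _ Fp) _; rewrite subrr normr0 lee_fin.
by have [_ [_ [_ [_ [_ [r0p _]]]]]] := h1; have := r0p Minus; lra.
Qed.

(** The first term is the density of a constant global minimizer. The second is the surplus [b] of
    the segment, with the weight frozen at its largest value on the unit interval. *)
Definition glue_bound (c t0 b t : R) : R :=
  a * expR (c * t) + b * expR (c * t0) * \1_(`]t0 - 1, t0]%classic : set R) t.

Lemma glue_density_le c t0 U V h : 0 < c -> nbFH Minus (r0 S Minus) h ->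
  U t0 = incH h -> let d := h - PH h in forall t, t <= t0 ->
  (density c (gluing t0 (incH d) U) (glue_derivative t0 (incH d) V) t <=
   (glue_bound c t0 ((2^-1 + C ^+ 2) * `|d| ^+ 2) t)%:E)%E.
Proof.
move=> c0 nh Uh d t tt; rewrite /density /glue_bound glue_left//.
have [tm|mt] := leP t (t0 - 1).
  rewrite glue_derivative_left// /ramp max_r; last lra.
  rewrite (glue_end Uh).
  have [Fp _] := projH_nearest nh.
  rewrite (potE_Minus h1 Fp) normr0 expr0n/= mulr0 add0e -EFinM lee_fin.
  by rewrite lerDl !mulr_ge0 ?expR_ge0 ?addr_ge0 ?sqr_ge0 ?invr_ge0.
have mt' : t0 - 1 < t <= t0 by rewrite mt.
rewrite glue_derivative_mid// /ramp max_l; last lra.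
rewrite indicE mem_set ?mulr1; last by rewrite /= in_itv/= mt'.
have seg : (E (U t0 + (t - t0) *: incH d)%R <= (a + C ^+ 2 * `|d| ^+ 2)%:E)%E.
  rewrite Uh -linearZ -linearD -(opprB t0 t) scaleNr; apply: segment_potE => //.
  by apply/andP; split; lra.
apply: (@le_trans _ _ (((2^-1 * `|incH d| ^+ 2)%:E + (a + C ^+ 2 * `|d| ^+ 2)%:E) * (expR (c * t))%:E)%E).
  by apply: lee_wpmul2r; [rewrite lee_fin expR_ge0|exact: leeD].
rewrite -EFinD -EFinM lee_fin.
have i2 : `|incH d| ^+ 2 <= `|d| ^+ 2 by rewrite ler_sqr ?nnegrE// incH_le.
have et : expR (c * t) <= expR (c * t0) by rewrite ler_expR; apply: ler_wpM2l => //; exact: ltW.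
have e0 := expR_ge0 (c * t).
set B := (2^-1 + C ^+ 2) * `|d| ^+ 2.
have B0 : 0 <= B by rewrite /B mulr_ge0 ?addr_ge0 ?sqr_ge0 ?invr_ge0.
apply: (@le_trans _ _ ((a + B) * expR (c * t))).
  by apply: ler_wpM2r => //; rewrite /B; lra.
by rewrite mulrDl lerD2l; apply: ler_wpM2l.
Qed.

Lemma glue_bound_integral c t0 b : 0 < c -> 0 <= b ->
  mu.-integrable `]-oo, t0] (fun t => (glue_bound c t0 b t)%:E) /\
  (\int[mu]_(t in `]-oo, t0]) (glue_bound c t0 b t)%:E =
    (expR (c * t0) * (a / c + b))%:E)%E.
Proof.
move=> c0 b0.
have mD : measurable (`]-oo, t0]%classic : set (measurableTypeR R)).
  exact: measurable_itv.
have mI : measurable (`]t0 - 1, t0]%classic : set (measurableTypeR R)).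
  exact: measurable_itv.
have i1 : mu.-integrable `]-oo, t0] (fun t => (a * expR (c * t))%:E).
  exact: (integrableZl mD a (integrable_expR_Ny t0 c0)).
have muI : mu (`]t0 - 1, t0]%classic : set (measurableTypeR R)) = 1%E.
  rewrite lebesgue_measure_itv/= lte_fin ifT; last lra.
  by rewrite -EFinD; congr (_%:E); lra.
have i2 : mu.-integrable `]-oo, t0] (fun t => (\1_(`]t0 - 1, t0]%classic : set R) t)%:E).
  apply: (integrableS measurableT) => //; exact: (@integrable_indic_itv R (t0 - 1) t0 false false).
have i3 : mu.-integrable `]-oo, t0]
    (fun t => (b * expR (c * t0) * \1_(`]t0 - 1, t0]%classic : set R) t)%:E).
  exact: (integrableZl mD (b * expR (c * t0)) i2).
split.
  exact: (integrableD mD i1 i3).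
under eq_integral do rewrite EFinD.
rewrite integralD//.
under eq_integral do rewrite EFinM.
rewrite integralZl//; last exact: integrable_expR_Ny.
rewrite integral_expR_Ny//.
under [X in (_ + X)%E]eq_integral do rewrite EFinM.
rewrite integralZl// integral_indic// setIidl; last first.
  by move=> t /=; rewrite !in_itv/= => /andP[].
rewrite [X in (_ + _ * X)%E](_ : _ = 1%E); last exact: muI.
by rewrite mule1 -EFinM -EFinD; congr (_%:E); field; rewrite gt_eqF.
Qed.

(* The gluing of U at t0 has nonnegative energy, and its energy on ]-oo, t0] is
   at most expR (c * t0) times the bracket below. *)
Lemma tail_density c U V t0 h e : 0 < c -> inf_energy S c = 0%E ->
  spX U -> smL2 V -> weak_derivative setT U V ->
  nbFH Minus (r0 S Minus) h -> U t0 = incH h -> E (U t0) = e%:E ->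
  (\int[mu]_(t in `]t0, +oo[) (density c U V)^\- t <=
   \int[mu]_(t in `]t0, +oo[) (density c U V)^\+ t +
     (expR (c * t0) * (a / c + tail_cst * (e - a)))%:E)%E.
Proof.
move=> c0 infc XU iV dV nh Uh he.
have XW := glue_spX XU iV dV nh Uh.
have cU := spX_continuous XU.
have dW := glue_weak_derivative t0 (incH (h - PH h)) cU iV dV.
have iW := glue_derivative_smL2 t0 (incH (h - PH h)) iV.
have le := glue_density_le V c0 nh Uh.
set W := gluing _ _ _ in XW dW le; set VW := glue_derivative _ _ _ in dW iW le.
have /(energy_ge0P h1 c0 XW dW) := inf_energy_ge0 infc XW.
have mW : measurable_fun setT (density c W VW).
  by apply: density_measurable => //; [exact: glue_continuous|exact: iW.1].
have mD : measurable (`]-oo, t0]%classic : set (measurableTypeR R)).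
  exact: measurable_itv.
have mD' : measurable (`]t0, +oo[%classic : set (measurableTypeR R)).
  exact: measurable_itv.
have DD : [set: R] = `]-oo, t0]%classic `|` `]t0, +oo[%classic.
  by apply/seteqP; split=> // t _ /=; rewrite !in_itv/= andbT; have [|] := leP t t0; [left|right].
have dj : [disjoint `]-oo, t0]%classic & (`]t0, +oo[%classic : set R)].
  apply/disj_setPS => t [/=]; rewrite !in_itv/= andbT => tt.
  by rewrite ltNge tt.
rewrite DD !ge0_integral_setU//; last 2 first.
- by rewrite -DD; exact: measurable_funepos.
- by rewrite -DD; exact: measurable_funeneg.
have eqD t : t \in `]t0, +oo[%classic -> density c W VW t = density c U V t.
  rewrite inE/= in_itv/= andbT => tt.
  by rewrite /density /W /VW glue_right ?ltW// glue_derivative_right.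
have eN : (\int[mu]_(t in `]t0, +oo[) (density c W VW)^\- t =
           \int[mu]_(t in `]t0, +oo[) (density c U V)^\- t)%E.
  by apply: eq_integral => t /eqD; rewrite !funenegE => ->.
have eP : (\int[mu]_(t in `]t0, +oo[) (density c W VW)^\+ t =
           \int[mu]_(t in `]t0, +oo[) (density c U V)^\+ t)%E.
  by apply: eq_integral => t /eqD; rewrite !funeposE => ->.
rewrite eN eP.
set b := (2^-1 + C ^+ 2) * `|h - PH h| ^+ 2 in le.
have b0 : 0 <= b by rewrite /b mulr_ge0 ?addr_ge0 ?sqr_ge0 ?invr_ge0.
have [ig eg] := glue_bound_integral t0 c0 b0.
have lo t : ((a * expR (c * t))%:E <= density c W VW t)%E.
  by apply: density_ge; [exact: ltW (levA_lt0 h1)|exact: (spX_lower h1 XW).1].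
have iD : mu.-integrable `]-oo, t0] (density c W VW).
  have ih : mu.-integrable `]-oo, t0] (fun t =>
      (expR (c * t0) * b * \1_(`]t0 - 1, t0]%classic : set R) t + (- a) * expR (c * t))%:E).
    have [i _] := glue_bound_integral t0 c0 b0.
    have i1 := @integrable_expR_Ny R c t0 c0.
    (* Adding [-2a] times the exponential flips the sign of the first term of [glue_bound] and makes
       it a nonnegative majorant of the absolute density. *)
    have := integrableD mD i (integrableZl mD (- a *+ 2) i1).
    apply: eq_integrable => // t _; rewrite /= -EFinM -EFinD /glue_bound; congr (_%:E).
    by rewrite mulr2n; lra.
  apply: le_integrable ih => //; first exact: measurable_funTS.
  move=> t; rewrite /= in_itv/= => tt.
  have up : (density c W VW t <= (glue_bound c t0 b t)%:E)%E := le t tt; have lw := lo t.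
  move: up lw; case: (density c W VW t) => [r| |]//.
  rewrite !lee_fin /glue_bound; set i := \1_ _ _; set x := expR (c * t) => up lw.
  have x0 : 0 <= x by exact: expR_ge0.
  have ax : a * x <= 0 by rewrite mulr_le0_ge0// ltW// (levA_lt0 h1).
  have i0 : 0 <= expR (c * t0) * b * i by apply: mulr_ge0; [rewrite mulr_ge0 ?expR_ge0|rewrite /i indicE].
  rewrite [leRHS]ger0_norm; last by rewrite addr_ge0// mulNr oppr_ge0.
  by rewrite ler_norml; apply/andP; split; lra.
have leI : (\int[mu]_(t in `]-oo, t0]) density c W VW t <=
            (expR (c * t0) * (a / c + b))%:E)%E.
  rewrite -eg; apply: le_integral => // t; rewrite inE/= in_itv/=; exact: le.
have bT : ((expR (c * t0) * (a / c + b))%:E <= (expR (c * t0) * (a / c + tail_cst * (e - a)))%:E)%E.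
  rewrite lee_fin; apply: ler_wpM2l; first exact: expR_ge0.
  rewrite lerD2l /b /tail_cst; rewrite Uh in he.
  have := projH_coercive nh he; set x := `|_| ^+ 2 => hx.
  have : 0 <= 2^-1 + C ^+ 2 by rewrite addr_ge0 ?sqr_ge0 ?invr_ge0.
  move=> hC; rewrite [C ^+ 2 * _]mulrC -mulrA; exact: ler_wpM2l.
have IW := le_trans leI bT; rewrite integralE in IW.
apply: (tail_arith _ _ _ _ IW).
- exact: integrable_neg_fin_num.
- exact: integrable_pos_fin_num.
- by apply: integral_ge0 => t _; exact: funeneg_ge0.
- by apply: integral_ge0 => t _; exact: funepos_ge0.
Qed.

End Tail.

(** * Nonnegative tails and energies at larger speeds *)

Section LayerCake.
Context {R : realType}.
Local Notation mu := (@lebesgue_measure R).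

(** Write [expR (k * t)] as the integral of its derivative over []-oo, t[] and exchange the
    integrals by Tonelli. *)
Lemma expR_tail_integral (f : R -> \bar R) (k : R) : 0 < k ->
  measurable_fun setT f -> (forall t, 0 <= f t)%E ->
  (\int[mu]_t (f t * (expR (k * t))%:E) =
   \int[mu]_s ((k * expR (k * s))%:E * \int[mu]_(t in `]s, +oo[) f t))%E.
Proof.
move=> k0 mf f0.
have mk : measurable_fun setT (fun s : R => (k * expR (k * s))%:E).
  apply/measurable_EFinP; apply: measurable_funM; first exact: measurable_cst.
  by apply: continuous_measurable_fun; exact: continuous_expR_scaled.
have k0' s : (0 <= (k * expR (k * s))%:E)%E by rewrite lee_fin mulr_ge0 ?expR_ge0 ?ltW.
pose g (p : R * R) : \bar R :=
  (f p.1 * ((k * expR (k * p.2))%:E * (\1_(`]-oo, p.1[%classic : set R) p.2)%:E))%E.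
have ind (t s : R) : \1_(`]-oo, t[%classic : set R) s = \1_(`]s, +oo[%classic : set R) t :> R.
  rewrite !indicE (_ : (s \in _) = (t \in `]s, +oo[%classic))//.
  by apply/idP/idP; rewrite !inE/= !in_itv/= andbT.
have mg : measurable_fun setT g.
  apply: emeasurable_funM; first exact: measurableT_comp measurable_fst.
  apply: emeasurable_funM; first exact: (measurableT_comp mk measurable_snd).
  apply/measurable_EFinP.
  rewrite (_ : (fun _ => _) = (fun p : R * R => (p.2 < p.1)%R%:R)); last first.
    apply/funext => -[t s]/=; rewrite indicE; congr ((nat_of_bool _)%:R).
    by apply/idP/idP; rewrite inE/= in_itv/=.
  apply: (@measurableT_comp _ _ _ _ _ _ (fun b : bool => b%:R : R) _ (fun p : R * R => p.2 < p.1)) => //.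
  by apply: measurable_fun_ltr; [exact: measurable_snd|exact: measurable_fst].
have g0 p : (0 <= g p)%E by rewrite /g mule_ge0// mule_ge0// lee_fin indicE.
transitivity (\int[mu]_t \int[mu]_s g (t, s))%E.
  apply: eq_integral => t _; apply/esym; rewrite /g/= ge0_integralZl//; first last.
  - by move=> s _; rewrite mule_ge0// lee_fin indicE.
  - apply: emeasurable_funM => //.
    by apply/measurable_EFinP; apply: measurable_indic; exact: measurable_itv.
  congr (_ * _)%E.
  have E1 : (\int[mu]_(s in `]-oo, t[) (k * expR (k * s))%:E = (expR (k * t))%:E)%E.
    rewrite integral_itv_bndo_bndc//; last exact: measurable_funTS.
    under eq_integral do rewrite EFinM.
    rewrite ge0_integralZl_EFin ?integral_expR_Ny ?ltW//; first last.
    - apply/measurable_EFinP; apply: measurable_funTS.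
      by apply: continuous_measurable_fun; exact: continuous_expR_scaled.
    by rewrite -EFinM mulrA mulfV ?mul1r// gt_eqF.
  rewrite -[RHS]E1 [RHS]integral_mkcond; apply: eq_integral => s _; rewrite patchE indicE.
  by case: ifP => _; rewrite ?mule1 ?mule0.
apply: (eq_trans (@fubini_tonelli _ _ _ _ R mu mu g mg g0)); apply: eq_integral => s _.
have mD : measurable (`]s, +oo[%classic : set (measurableTypeR R)).
  exact: measurable_itv.
apply/esym; apply: (eq_trans (esym (ge0_integralZl mu mD (measurable_funTS mf) (fun t _ => f0 t) (k0' s)))).
rewrite integral_mkcond; apply: eq_integral => t _.
rewrite /g/= ind patchE indicE muleC.
by case: ifP => _; rewrite ?mule1 ?mule0 ?mul0e.
Qed.

End LayerCake.

Section Faster.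
Context {R : realType} (S : setting R).
Local Notation L := (spL S).
Local Notation E := (@potE R S).
Local Notation a := (levA S).
Local Notation incH := (incH S).
Local Notation C := (cstC S Minus).
Local Notation mu := (@lebesgue_measure R).
Implicit Types (U V W : R -> L) (h : spH S).
Context (h1 : hypH1 S) (h2 : hypH2 S) (h5 : hypH5 S) (h7 : hypH7 S).

Lemma r0_gt0 s : 0 < r0 S s.
Proof. by have [_ [_ [_ [_ [_ [r0p _]]]]]] := h1. Qed.

Lemma rhat_le_r0 : 0 < rhat S <= r0 S Minus.
Proof.
have C1 := cstC_gt1 h1 Minus; have r1 := r0_gt0 Minus.
by rewrite /rhat divr_gt0//=; [rewrite ler_pdivrMr; nra|lra].
Qed.

Lemma Emax_le_beta : Emax S <= beta S Minus (rhat S).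
Proof.
have [_ [_ [_ /(_ _ rhat_le_r0)[b0 _]]]] := h5 Minus.
have C1 := cstC_gt1 h1 Minus.
rewrite /Emax; set K := C ^+ 2 * (C + 1); set m := (X in fine X).
have mb : (m <= (beta S Minus (rhat S))%:E)%E by rewrite /m !ge_min lexx !orbT.
have mb' : fine m <= beta S Minus (rhat S).
  (* Were the minimum [-oo], [fine] would turn it into 0, which is still below the positive
     [beta]. *)
  by move: mb; case: m => [r| |]//= _; exact: ltW.
have K1 : 1 <= K by rewrite /K; nra.
have Ki : K^-1 <= 1 by rewrite invf_le1//; lra.
have Ki0 : 0 <= K^-1 by rewrite invr_ge0; lra.
have [m0|m0] := leP 0 (fine m); first by apply: le_trans mb'; exact: ler_piMl.
by apply: (@le_trans _ _ 0); [apply: mulr_ge0_le0 => //; exact: ltW|exact: ltW].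
Qed.

Lemma low_energy_nbFH v : nbF Minus (r0 S Minus) v -> (E v <= (a + Emax S)%:E)%E ->
  exists2 h, incH h = v & nbFH Minus (r0 S Minus) h.
Proof.
move=> nv Ev; have [_ [_ [_ /(_ _ rhat_le_r0)[b0 H]]]] := h5 Minus.
have [h hv nh] : exists2 h, incH h = v & nbFH Minus (rhat S) h.
  by apply: H => //; apply: le_trans Ev _; rewrite lee_fin lerD2l Emax_le_beta.
exists h => //; apply: le_trans nh _; rewrite lee_fin.
by have /andP[] := rhat_le_r0.
Qed.

(** Both halves of (H7) are used: negative energy places [v] near [F Minus] in [L], and [- a < Emax]
    makes its energy low enough for (H5) to improve this to nearness in [H]. *)
Lemma neg_energy_nbFH v : (E v < 0)%E ->
  exists2 h, incH h = v & nbFH Minus (r0 S Minus) h.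
Proof.
move=> Ev; have [aE H7] := h7; have [rg _] := h2.
have : [set v | (E v < +oo)%E] v by rewrite /= (lt_trans Ev)// ltry.
rewrite -rg => -[h _ hv]; apply: low_energy_nbFH.
  by apply: (nbF_half h1); rewrite -hv; apply: H7; rewrite hv.
by apply: le_trans (ltW Ev) _; rewrite lee_fin; lra.
Qed.

Lemma tail_cst_gt0 : 0 < tail_cst S.
Proof. by have := cstC_gt1 h1 Minus; rewrite /tail_cst; nra. Qed.

(** With [x = c * tail_cst S <= 1] and [e] the negative energy at [s], [c] times the bracket of
    [tail_density] equals [a * (1 - x) + x * e], which is nonpositive. *)
Lemma tail_density_neg c U V s : 0 < c -> c * tail_cst S <= 1 ->
  inf_energy S c = 0%E -> spX U -> smL2 V -> weak_derivative setT U V ->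
  (E (U s) < 0)%E ->
  (\int[mu]_(t in `]s, +oo[) (density c U V)^\- t <=
   \int[mu]_(t in `]s, +oo[) (density c U V)^\+ t)%E.
Proof.
move=> c0 cT infc XU iV dV Es.
have [h hs nh] := neg_energy_nbFH Es.
have Ea := (spX_lower h1 XU).1 s.
have [e Ee] : exists e, E (U s) = e%:E.
  by move: Es Ea; case: (E (U s)) => [e| |]//; exists e.
rewrite Ee !lte_fin in Es Ea.
apply: (le_trans (tail_density h1 h2 h5 c0 infc XU iV dV nh (esym hs) Ee)).
rewrite -[leRHS]adde0; apply: leeD => //.
rewrite lee_fin mulr_ge0_le0 ?expR_ge0//.
have T0 := tail_cst_gt0; have a0 := levA_lt0 h1.
rewrite -(@ler_pM2l _ c)// mulr0 mulrDr mulrCA divff ?gt_eqF// mulr1 mulrA.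
set x := c * tail_cst S in cT *.
have x0 : 0 < x by rewrite mulr_gt0.
rewrite (_ : a + x * (e - a) = a * (1 - x) + x * e); last ring.
have := mulr_ge0_le0 (ltW x0) (ltW Es).
have : a * (1 - x) <= 0 by rewrite mulr_le0_ge0 ?subr_ge0// ltW.
lra.
Qed.

(** Between [s] and the infimum [m] of the later times of negative potential the density is
    nonnegative. The potential, being only lower semicontinuous along the curve, need not be
    negative at [m], so [tail_density_neg] is applied at a time [t0] slightly after [m], at a cost
    of at most [e] on [[m, t0]]. *)
Lemma tail_density_ge0 c U V s : 0 < c -> c * tail_cst S <= 1 ->
  inf_energy S c = 0%E -> spX U -> smL2 V -> weak_derivative setT U V ->
  (\int[mu]_(t in `]s, +oo[) (density c U V)^\- t <=
   \int[mu]_(t in `]s, +oo[) (density c U V)^\+ t)%E.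
Proof.
move=> c0 cT infc XU iV dV.
have [neg|pos] := pselect (exists2 t, s < t & (E (U t) < 0)%E); last first.
  rewrite [leLHS](_ : _ = 0%E); first by apply: integral_ge0 => t _; exact: funepos_ge0.
  apply: integral0_eq => t; rewrite /= in_itv/= andbT => st.
  have Et : (0 <= E (U t))%E by rewrite leNgt; apply/negP => Et; apply: pos; exists t.
  have := density_funeneg_le c V (lexx 0) Et; rewrite oppr0 mul0r => h.
  by apply/eqP; rewrite eq_le h funeneg_ge0.
have a0 := levA_lt0 h1.
pose A : set R := [set t | s < t /\ (E (U t) < 0)%E].
have hA : has_inf A.
  by split; [case: neg => t st Et; exists t|exists s => t [/ltW]].
pose m := inf A.
have sm : s <= m by apply: lb_le_inf => [|t [/ltW//]]; exact: hA.1.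
pose K := - a * expR (c * (m + 1)).
have K0 : 0 < K by rewrite /K mulr_gt0 ?expR_gt0// oppr_gt0.
apply/lee_addgt0Pr => e e0.
(* The bound by 1 keeps [t0] below [m + 1], where [K] bounds the negative part; the other one makes
   [K * (t0 - m)] at most [e]. *)
pose d := Num.min 1 (e / K).
have d0 : 0 < d by rewrite lt_min ltr01 divr_gt0.
have [t0 [st0 Et0] t0m] := inf_adherent d0 hA; rewrite -/m in t0m.
have mt0 : m <= t0 by apply: inf_lbound => //; exact: hA.2.
have mD1 : measurable (`]s, t0]%classic : set (measurableTypeR R)).
  exact: measurable_itv.
have mD2 : measurable (`]t0, +oo[%classic : set (measurableTypeR R)).
  exact: measurable_itv.
have mf : measurable_fun setT (density c U V).
  by apply: density_measurable => //; [exact: spX_continuous|exact: iV.1].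
have DD : `]s, +oo[%classic = `]s, t0]%classic `|` `]t0, +oo[%classic.
  apply/seteqP; split=> t /=; rewrite !in_itv/= !andbT.
    by move=> ->; have [|] := leP t t0; [left|right].
  by case=> [/andP[]//|]; exact: lt_trans.
have dj : [disjoint `]s, t0]%classic & (`]t0, +oo[%classic : set R)].
  apply/disj_setPS => t [/=]; rewrite !in_itv/= andbT => /andP[_ tt].
  by rewrite ltNge tt.
have N1 : (\int[mu]_(t in `]s, t0]) (density c U V)^\- t <= e%:E)%E.
  apply: (@le_trans _ _ (\int[mu]_(t in `[m, t0]) K%:E)%E).
    rewrite [leLHS]integral_mkcond [leRHS]integral_mkcond.
    apply: ge0_le_integral_nonmeas => [t _|t _].
      by rewrite patchE; case: ifP => // _; exact: funeneg_ge0.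
    rewrite !patchE; case: ifP => [|_]; last by case: ifP => // _; rewrite lee_fin ltW.
    rewrite inE/= in_itv/= => /andP[st tt0].
    have [mt|tm] := leP m t.
      rewrite mem_set/= ?in_itv/= ?mt//.
      apply: le_trans (density_funeneg_le c V (ltW a0) ((spX_lower h1 XU).1 t)) _.
      rewrite lee_fin; apply: ler_wpM2l; first by rewrite oppr_ge0 ltW.
      rewrite ler_expR; apply: ler_wpM2l; first exact: ltW.
      apply: (le_trans tt0); apply: (le_trans (ltW t0m)).
      by rewrite lerD2l /d ge_min lexx.
    have Et : (0 <= E (U t))%E.
      rewrite leNgt; apply/negP => Et; move: tm; apply/negP; rewrite -leNgt.
      by apply: inf_lbound; [exact: hA.2|split].
    have := density_funeneg_le c V (lexx 0) Et; rewrite oppr0 mul0r => /le_trans; apply.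
    by case: ifP => // _; rewrite lee_fin ltW.
  have mD3 : measurable (`[m, t0]%classic : set (measurableTypeR R)).
    exact: measurable_itv.
  rewrite integral_cst//.
  rewrite [X in (_ * X)%E](_ : _ = (t0 - m)%:E); last first.
    rewrite [LHS]lebesgue_measure_itv/= lte_fin; case: ltP => tm.
      by rewrite EFinB.
    by rewrite (_ : t0 - m = 0)//; lra.
  rewrite -EFinM lee_fin mulrC -ler_pdivlMr// lerBlDl ltW//.
  by apply: (lt_le_trans t0m); rewrite lerD2l /d ge_min lexx orbT.
have N2 := tail_density_neg c0 cT infc XU iV dV Et0.
rewrite DD !ge0_integral_setU//; last 2 first.
- by apply: measurable_funTS; exact: measurable_funepos.
- by apply: measurable_funTS; exact: measurable_funeneg.
rewrite [leRHS]addeC; apply: leeD => //; apply: (le_trans N2).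
by rewrite leeDr// integral_ge0// => t _; exact: funepos_ge0.
Qed.

(* All tails of the energy at speed c are nonnegative, and the energy at speed c'
   is an average of them with weights (c' - c) e^{(c' - c) s}. *)
Lemma inf_energy_faster c c' : 0 < c -> c < c' -> c * tail_cst S <= 1 ->
  inf_energy S c = 0%E -> (0 <= inf_energy S c')%E.
Proof.
move=> c0 cc cT infc; apply: le_ereal_inf_tmp => _ [U XU <-].
have [V dV iV] := spX_weak_derivative XU.
have c'0 := lt_trans c0 cc.
have k0 : 0 < c' - c by rewrite subr_gt0.
apply/(energy_ge0P h1 c'0 XU dV).
have mf : measurable_fun setT (density c U V).
  by apply: density_measurable => //; [exact: spX_continuous|exact: iV.1].
have de t : density c' U V t = (density c U V t * (expR ((c' - c) * t))%:E)%E.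
  rewrite /density -muleA -EFinM -expRD; congr (_ * (expR _)%:E)%E; lra.
have e0 t : 0 <= expR ((c' - c) * t) :> R by exact: expR_ge0.
have eN : (\int[mu]_t (density c' U V)^\- t =
    \int[mu]_t ((density c U V)^\- t * (expR ((c' - c) * t))%:E))%E.
  apply: eq_integral => t _; rewrite !funenegE de -mulNe maxe_pMl//.
  by rewrite mul0e.
have eP : (\int[mu]_t (density c' U V)^\+ t =
    \int[mu]_t ((density c U V)^\+ t * (expR ((c' - c) * t))%:E))%E.
  apply: eq_integral => t _; rewrite !funeposE de maxe_pMl//.
  by rewrite mul0e.
rewrite eN eP !expR_tail_integral//; first last.
- exact: measurable_funeneg.
- exact: measurable_funepos.
apply: ge0_le_integral_nonmeas => s _.
  apply: mule_ge0; first by rewrite lee_fin mulr_ge0 ?expR_ge0 ?ltW.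
  by apply: integral_ge0 => t _; exact: funeneg_ge0.
apply: lee_wpmul2l; first by rewrite lee_fin mulr_ge0 ?expR_ge0 ?ltW.
exact: tail_density_ge0.
Qed.

End Faster.
(** * The profile of a travelling wave *)

Section RealDerivatives.
Context {R : realType}.
Local Notation mu := (@lebesgue_measure R).

Lemma is_derive_diff_comp (V W : normedModType R) (g : V -> W) (f : R -> V) (t : R) df :
  is_derive t (1:R) f df -> differentiable g (f t) ->
  is_derive t (1:R) (g \o f) ('d g (f t) df).
Proof.
move=> [dvf <-] dg; have df' : differentiable f t by apply/derivable1_diffP.
have dgf : differentiable (g \o f) t by exact: differentiable_comp.
split; first by apply/derivable1_diffP.
by rewrite !deriveE// diff_comp.
Qed.

Lemma is_derive_shift (V : normedModType R) (f : R -> V) (t k : R) df :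
  is_derive (t - k) (1:R) f df -> is_derive t (1:R) (fun s => f (s - k)) df.
Proof.
move=> [dvf <-].
have e : (fun h : R => h^-1 *: ((fun s => f (s - k)) (h *: (1:R) + t) - f (t - k))) =
         (fun h : R => h^-1 *: (f (h *: (1:R) + (t - k)) - f (t - k))).
  by apply/funext => h; rewrite addrA.
split; first by rewrite /derivable/= e.
by rewrite /derive/= e.
Qed.

Lemma is_derive_le (f f' : R -> R) x y : x <= y -> continuous f' ->
  (forall t, is_derive t (1:R) f (f' t)) ->
  (forall t, x <= t <= y -> 0 <= f' t) -> f x <= f y.
Proof.
move=> xy cf df f0; rewrite -subr_ge0 -(FTC2 xy cf df).
by apply: Rintegral_ge0 => t; rewrite /= in_itv/=; exact: f0.
Qed.

(** Since [g] changes sign, only its positive part is passed to the limit, by monotone convergence;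
    the negative part is at once replaced by its integral over all of [D], which may be infinite. *)
Lemma integral_le_growing (g : R -> R) (u v : nat -> R) (D : set R) (B : R) :
  continuous g -> (forall n m, (n <= m)%N -> u m <= u n) ->
  (forall n m, (n <= m)%N -> v n <= v m) -> D = \bigcup_n `[u n, v n]%classic ->
  (forall n, \int[mu]_(t in `[u n, v n]) g t <= B) ->
  (\int[mu]_(t in D) (EFin \o g)^\+ t <= \int[mu]_(t in D) (EFin \o g)^\- t + B%:E)%E.
Proof.
move=> cg du dv DE gB.
have c0 : continuous (fun t : R => (0 : R)) by move=> t; exact: cst_continuous.
pose p t := Num.max (g t) 0; pose m t := Num.max (- g t) 0.
have cp : continuous p.
  by move=> t; apply: (@continuous_max _ _ g (fun=> 0)); [exact: cg|exact: c0].
have cm : continuous m.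
  move=> t; apply: (@continuous_max _ _ (fun t => - g t) (fun=> 0)); last exact: c0.
  by apply: cvgN; exact: cg.
have p0 t : 0 <= p t by rewrite /p le_max lexx orbT.
have m0 t : 0 <= m t by rewrite /m le_max lexx orbT.
have pE : p = fun t => g t + m t.
  apply/funext => t; rewrite /p /m; have [g0|g0] := leP 0 (g t).
    by rewrite max_r ?addr0// oppr_le0.
  by rewrite max_l ?subrr// oppr_ge0 ltW.
have -> : (EFin \o g)^\+%E = fun t => (p t)%:E.
  by apply/funext => t; rewrite funeposE/= EFin_max.
have -> : (EFin \o g)^\-%E = fun t => (m t)%:E.
  by apply/funext => t; rewrite funenegE/= EFin_max.
have c1 := ge0_integral_growing p0 (continuous_measurable_fun cp) du dv DE.
rewrite -(cvg_lim _ c1)//; apply: lime_le; first exact: cvgP c1.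
apply: nearW => n.
have iE f : continuous f ->
    (\int[mu]_(t in `[u n, v n]) (f t)%:E = (\int[mu]_(t in `[u n, v n]) f t)%:E)%E.
  move=> cf; rewrite /Rintegral fineK//; apply: integrable_fin_num.
    exact: measurable_itv.
  exact: (continuous_locint cf).
rewrite iE// pE locRintegralD; [|exact: continuous_locint|exact: continuous_locint].
rewrite EFinD addeC; apply: leeD; last by rewrite lee_fin.
rewrite -iE// [leLHS]integral_mkcond [leRHS]integral_mkcond.
apply: ge0_le_integral_nonmeas => t _; rewrite !patchE; case: ifPn => tI.
- by rewrite lee_fin.
- by [].
- by rewrite mem_set// DE; exists n => //; rewrite inE in tI.
- by case: ifP => // _; rewrite lee_fin.
Qed.

End RealDerivatives.

Section Increment.
Context {R : realType} (S : setting R).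
Local Notation L := (spL S).

Lemma curve_increment_le (U : R -> L) (N N' : R -> R) x y : x <= y ->
  curve_C1 setT U -> continuous N' -> (forall t, is_derive t (1:R) N (N' t)) ->
  (forall t, x <= t <= y -> `|derive1 U t| <= N' t) -> `|U y - U x| <= N y - N x.
Proof.
move=> xy C1U cN dN UN; set w := U y - U x.
have N0 : N x <= N y.
  by apply: is_derive_le dN _ => // t /UN; exact: le_trans.
have h : `|w| ^+ 2 <= `|w| * (N y - N x).
  rewrite -(@ipL_norm R S) -/w [leLHS](curve_C1_ftc C1U)// -(FTC2 xy cN dN).
  rewrite -locRintegralZ; last exact: continuous_locint.
  apply: le_locRintegral.
  - by apply: smL2_ip; apply: continuous_smL2; exact: curve_C1_derive1.
  - by apply: locintZ; exact: continuous_locint.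
  - move=> t /UN ut; apply: (le_trans (ler_norm _)).
    apply: (le_trans (ip_CS (@ipL_norm R S) _ _)); rewrite mulrC.
    exact: ler_wpM2l.
have [->|w0] := eqVneq w 0; first by rewrite normr0 subr_ge0.
by rewrite expr2 in h; rewrite -(@ler_pM2l _ `|w|)// normr_gt0.
Qed.

Lemma curve_C1_shift (U : R -> L) k : curve_C1 setT U ->
  curve_C1 setT (fun t => U (t - k)) /\
  (forall t, derive1 (fun t => U (t - k)) t = derive1 U (t - k)).
Proof.
move=> C1U.
have dU t : is_derive t (1:R) (fun t => U (t - k)) (derive1 U (t - k)).
  by apply: is_derive_shift; exact: curve_C1_derive.
have e t : derive1 (fun t => U (t - k)) t = derive1 U (t - k).
  by rewrite derive1E; case: (dU t).
split=> //; split; first by move=> t _; case: (dU t).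
rewrite (funext e) => t _.
apply: (@continuous_comp _ _ _ (fun t : R => t - k) (derive1 U)); last exact: curve_C1_derive1.
by apply: cvgB; [exact: cvg_id|exact: cvg_cst].
Qed.

End Increment.
Section IntegralParts.
Context {R : realType}.
Local Notation mu := (@lebesgue_measure R).

Lemma sube_eq0 (p q : \bar R) : (0 <= q)%E -> (q < +oo)%E -> (p - q = 0)%E ->
  exists M : R, [/\ p = M%:E, q = M%:E & 0 <= M].
Proof.
case: q => [q| |]//; case: p => [p| |]//.
by rewrite lee_fin -EFinB => q0 _ -[/eqP]; rewrite subr_eq0 => /eqP ->; exists q.
Qed.

Lemma integral_le_funepos (D : set R) (f : R -> \bar R) :
  (\int[mu]_(t in D) f t <= \int[mu]_(t in D) f^\+ t)%E.
Proof.
rewrite integralE -[leRHS]sube0; apply: leeB => //.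
by apply: integral_ge0 => t _; exact: funeneg_ge0.
Qed.

End IntegralParts.

Section Solution.
Context {R : realType} (S : setting R).
Local Notation L := (spL S).
Local Notation E := (@potE R S).
Local Notation a := (levA S).
Local Notation incH := (incH S).
Local Notation incT := (incT S).
Local Notation mu := (@lebesgue_measure R).
Local Notation "<< u , v >>" := (@ipL R S u v).
Context (h1 : hypH1 S) (h2 : hypH2 S) (h5 : hypH5 S) (h7 : hypH7 S).
Context (c : R) (c0 : 0 < c) (U : R -> L) (AU : classA setT U) (XU : spX U)
  (sU : solves setT c U).

Definition pot (t : R) : R := fine (E (U t)).
Definition speed2 (t : R) : R := `|derive1 U t| ^+ 2.
(* The mechanical energy of the equation seen as a damped oscillator in time;
   along a solution its derivative is c |U'|^2. *)
Definition hamilton (t : R) : R := pot t - 2^-1 * speed2 t.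
Local Notation n2 := speed2.
Local Notation G := hamilton.

Lemma incH_continuous : continuous incH.
Proof.
apply/linear_bounded_continuous/linear_boundedP; exists 1; split=> // r r1 x.
by apply: le_trans (incH_le h2 x) _; rewrite ler_peMl// ltW.
Qed.

Lemma solution_C1' : curve_C1 setT (derive1 U).
Proof. by have [[_]] := AU. Qed.

Lemma solution_C1 : curve_C1 setT U.
Proof.
have [[dU _] _] := AU; split=> // t _.
exact: (curve_C1_continuous solution_C1').
Qed.

Lemma solution_potE t : E (U t) = (pot t)%:E.
Proof.
have [_ [[UH HU _] _]] := AU; rewrite /pot fineK// fin_numElt potE_gtNy/=.
have [rg _] := h2; have : range incH (incH (UH t)) by exists (UH t).
by rewrite rg /= HU.
Qed.

(** The chain rule is applied in [H], where the energy is differentiable, and (H2) rewrites the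
    differential as an inner product in [L]. *)
Lemma pot_derive t : exists u, incH (incT u) = U t /\
  is_derive t (1:R) (pot : R -> R^o) <<DLE u, derive1 U t>>.
Proof.
have [_ [[UH HU C1H] _]] := AU; have [u uU _] := @sU t I; exists u; split=> //.
have [_ [_ [dEH [_ [_ [_ Dip]]]]]] := h2.
have uH : incT u = UH t by apply: (@incH_inj R S); rewrite uU HU.
have dUH : is_derive t (1:R) UH (derive1 UH t).
  by split; [exact: C1H.1|rewrite derive1E].
have -> : derive1 U t = incH (derive1 UH t).
  have := is_derive_diff_comp dUH (linear_differentiable (UH t) incH_continuous).
  rewrite diff_lin; last exact: incH_continuous.
  have -> : incH \o UH = U by apply/funext => s /=; exact: HU.
  by move=> [_ <-]; rewrite derive1E.
rewrite Dip uH.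
have -> : (pot : R -> R^o) = (@EH R S) \o UH.
  by apply/funext => s; rewrite /pot/= /EH HU.
exact: is_derive_diff_comp dUH (dEH (UH t)).
Qed.

Lemma pot_continuous : continuous pot.
Proof.
move=> t; have [u [_ [d _]]] := pot_derive t.
by apply/differentiable_continuous/derivable1_diffP.
Qed.

Lemma speed2_continuous : continuous speed2.
Proof. by apply: continuous_norm2; exact: curve_C1_derive1 solution_C1. Qed.

Lemma hamilton_continuous : continuous G.
Proof.
move=> t; apply: cvgB; first exact: pot_continuous.
by apply: cvgMr; exact: speed2_continuous.
Qed.

Lemma speed2_ge0 t : 0 <= n2 t.
Proof. exact: sqr_ge0. Qed.

Lemma hamilton_derive t : is_derive t (1:R) (G : R -> R) (c * n2 t).
Proof.
have [u [uU du]] := pot_derive t.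
have d2 := curve_C1_derive t solution_C1'.
have dn := is_derive_ip (@ipL_norm R S) d2 d2.
have -> : (G : R -> R^o) = pot - (2^-1 : R) *: (fun s => <<derive1 U s, derive1 U s>> : R^o).
  by apply/funext => s; rewrite /G fctE /speed2 -(@ipL_norm R S).
apply: is_derive_eq (is_deriveB du (is_deriveZ (2^-1 : R) dn)) _.
have [u' u'U ode] := @sU t I.
have -> : u = u' by apply: (@incT_inj R S); apply: (@incH_inj R S); rewrite uU u'U.
(* Pairing the equation with the velocity leaves only the damping term. *)
have := congr1 (fun v => <<v, derive1 U t>>) ode.
rewrite ipBl -scaleNr ipZl (@ipL_norm R S) -/(n2 t).
rewrite [derive1n 2 U t]/= [X in _ *: (_ + X)]ipC -[_ *: _]/(_ * _).
by move=> h; lra.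
Qed.

Lemma expR_hamilton_derive k t :
  is_derive t (1:R) (fun t => expR (k * t) * G t) (expR (k * t) * (k * G t + c * n2 t)).
Proof.
apply: is_derive_eq (is_deriveM (is_derive_expR_scaled k t) (hamilton_derive t)) _.
by rewrite /GRing.scale/=; ring.
Qed.

Lemma hamilton_mono x y : x <= y -> G x <= G y.
Proof.
move=> xy; apply: (is_derive_le xy _ hamilton_derive).
  by move=> t; apply: cvgMr; exact: speed2_continuous.
by move=> t _; rewrite mulr_ge0 ?speed2_ge0 ?ltW.
Qed.

Definition rdensity (c' t : R) : R := (2^-1 * n2 t + pot t) * expR (c' * t).

Lemma rdensity_continuous c' : continuous (rdensity c').
Proof.
move=> t; apply: cvgM; last exact: continuous_expR_scaled.
apply: cvgD; last exact: pot_continuous.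
by apply: cvgMr; exact: speed2_continuous.
Qed.

Lemma densityE c' : density c' U (derive1 U) = EFin \o rdensity c'.
Proof.
by apply/funext => t; rewrite /density solution_potE -EFinD -EFinM.
Qed.

(** Since [c * G + c * n2] is [c] times the sum of potential and kinetic energy, at the speed of the
    wave itself the weighted density is an exact derivative. *)
Lemma rdensity_primitive t :
  is_derive t (1:R) (fun t => c^-1 * (expR (c * t) * G t)) (rdensity c t).
Proof.
apply: is_derive_eq (is_deriveZ c^-1 (expR_hamilton_derive c t)) _.
by rewrite /GRing.scale/= /rdensity /G; field; rewrite gt_eqF.
Qed.

Lemma pot_ge t : a <= pot t.
Proof. by rewrite -lee_fin -solution_potE; exact: (spX_lower h1 XU).1. Qed.

Context (E0 : energy setT c U = 0%E).

Let dU := curve_C1_weak_derivative solution_C1.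
Let iU : smL2 (derive1 U).
Proof. by apply: continuous_smL2; exact: curve_C1_derive1 solution_C1. Qed.

Lemma solution_energy : exists M : R,
  [/\ (\int[mu]_t (density c U (derive1 U))^\+ t = M%:E)%E,
      (\int[mu]_t (density c U (derive1 U))^\- t = M%:E)%E & 0 <= M].
Proof.
apply: sube_eq0.
- by apply: integral_ge0 => t _; exact: funeneg_ge0.
- exact: (density_funeneg_integral h1 (derive1 U) c0 XU).
- by have := E0; rewrite (energyE c (spX_continuous XU) dU) integralE.
Qed.

Lemma solution_energy_bound : exists M : R, forall x y, x <= y ->
  expR (c * y) * G y - expR (c * x) * G x <= M.
Proof.
have [M [Mp Mn M0]] := solution_energy; exists (c * M) => x y xy.
have := FTC2_integral xy (@rdensity_continuous c) rdensity_primitive.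
rewrite -mulrBr => e.
have : ((c^-1 * (expR (c * y) * G y - expR (c * x) * G x))%:E <= M%:E)%E.
  rewrite -e -Mp densityE; apply: (le_trans (integral_le_funepos _ _)).
  rewrite [leLHS]integral_mkcond; apply: ge0_le_integral_nonmeas => t _.
    by rewrite patchE; case: ifP => // _; exact: funepos_ge0.
  by rewrite patchE; case: ifP => // _; exact: funepos_ge0.
by rewrite lee_fin ler_pdivrMl.
Qed.

(* K = e^{ct} (G - a) is nondecreasing, and K' >= - c K: were K negative
   somewhere, it would tend to -oo linearly at -oo, against the finite energy. *)
Lemma hamilton_ge t : a <= G t.
Proof.
have [M HM] := solution_energy_bound.
pose K t := expR (c * t) * G t - a * expR (c * t).
have KE s : K s = expR (c * s) * (G s - a) by rewrite /K; ring.
have dK s : is_derive s (1:R) K (c * (expR (c * s) * (2^-1 * n2 s + pot s - a))).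
  apply: is_derive_eq (is_deriveB (expR_hamilton_derive c s) (is_deriveZ a (is_derive_expR_scaled c s))) _.
  by rewrite -[a *: _]/(a * _) /G; field.
have cK' : continuous (fun s => c * (expR (c * s) * (2^-1 * n2 s + pot s - a))).
  move=> s; apply: cvgMr; apply: cvgM; first exact: continuous_expR_scaled.
  apply: cvgB; last exact: cvg_cst.
  apply: cvgD; last exact: pot_continuous.
  by apply: cvgMr; exact: speed2_continuous.
have Kmono x y : x <= y -> K x <= K y.
  move=> xy; apply: (is_derive_le xy cK' dK) => s _.
  apply: mulr_ge0; first exact: ltW.
  apply: mulr_ge0; first exact: expR_ge0.
  by have := pot_ge s; have := speed2_ge0 s; lra.
rewrite leNgt; apply/negP => Gt.
have Kt : K t < 0 by rewrite KE pmulr_rlt0 ?expR_gt0// subr_lt0.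
have lin x : x <= t -> - (c * K t) * (t - x) <= K t - K x.
  move=> xt; rewrite -(FTC2 xt cK' dK) -Rintegral_itv_cst//.
  apply: le_locRintegral.
  - by apply: continuous_locint => s; exact: cst_continuous.
  - exact: continuous_locint.
  - move=> s /andP[_ st]; rewrite -mulrN; apply: ler_wpM2l; first exact: ltW.
    apply: (@le_trans _ _ (- K s)); first by rewrite lerN2; exact: Kmono.
    rewrite KE -mulrN; apply: ler_wpM2l; first exact: expR_ge0.
    by have := pot_ge s; have := speed2_ge0 s; rewrite /G; lra.
have ub x : x <= t -> K t - K x <= M - a * expR (c * t).
  move=> xt; have := HM x t xt; rewrite /K.
  have : a * expR (c * x) <= 0 by rewrite mulr_le0_ge0 ?expR_ge0 ?ltW// (levA_lt0 h1).
  lra.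
have k0 : 0 < - (c * K t) by rewrite oppr_gt0 pmulr_rlt0.
set k := - (c * K t) in lin k0; set B := M - _ in ub.
have B0 : 0 <= B by have := ub t (lexx _); rewrite subrr.
pose x := t - (B + 1) / k.
have xt : x <= t by rewrite /x lerBlDr lerDl; apply: divr_ge0; [lra|exact: ltW].
have := le_trans (lin x xt) (ub x xt); rewrite /x opprB addrC subrK mulrC divfK ?gt_eqF//.
lra.
Qed.

(** If [G t > 0], monotonicity of [G] makes [expR (c * y) * G y] grow at least linearly in [y],
    against [solution_energy_bound]. *)
Lemma hamilton_le0 t : G t <= 0.
Proof.
have [M HM] := solution_energy_bound.
rewrite leNgt; apply/negP => Gt.
set k := c * G t.
have k0 : 0 < k by rewrite mulr_gt0.
set A := M + expR (c * t) * G t.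
have h y : t <= y -> 0 <= y -> G t + k * y <= A.
  move=> ty y0; apply: (@le_trans _ _ (expR (c * y) * G y)); last first.
    by have := HM t y ty; rewrite /A; lra.
  apply: (@le_trans _ _ (expR (c * y) * G t)); last first.
    by apply: ler_wpM2l; [exact: expR_ge0|exact: hamilton_mono].
  rewrite (_ : G t + k * y = (1 + c * y) * G t); last by rewrite /k; ring.
  by apply: ler_wpM2r; [exact: ltW|exact: expR_ge1Dx].
pose y := `|t| + `|A| / k + 1.
have Ak : 0 <= `|A| / k by rewrite (divr_ge0 (normr_ge0 _) (ltW k0)).
have := h y; rewrite /y !mulrDr mulrCA divff ?gt_eqF// mulr1 mulr1.
have t1 := ler_norm t; have t2 := normr_ge0 t; have A1 := ler_norm A.
have : 0 <= k * `|t| by apply: mulr_ge0 => //; exact: ltW.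
move=> kt /(_ _ _)H; have : G t + (k * `|t| + `|A| + k) <= A by apply: H; lra.
lra.
Qed.

(** Near [F Plus] the potential is nonnegative, so [expR (c * t) * G t] is eventually nondecreasing;
    it would tend to [-oo] if [G] stayed below [-e]. *)
Lemma hamilton_cvgy e : 0 < e -> exists t, - e < G t.
Proof.
move=> e0; apply: contrapT => h.
have Ge t : G t <= - e by rewrite leNgt; apply/negP => ?; apply: h; exists t.
have [_ [T T1 ET]] := spX_lower h1 XU.
have mono x y : T <= x -> x <= y -> expR (c * x) * G x <= expR (c * y) * G y.
  move=> Tx xy; apply: (is_derive_le xy _ (expR_hamilton_derive c)).
    move=> t; apply: cvgM; first exact: continuous_expR_scaled.
    by apply: cvgD; apply: cvgMr; [exact: hamilton_continuous|exact: speed2_continuous].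
  move=> t /andP[xt _]; rewrite mulr_ge0 ?expR_ge0//.
  have : 0 <= pot t by rewrite -lee_fin -solution_potE; apply: ET; exact: le_trans xt.
  have n0 := speed2_ge0 t; move=> p0; rewrite /G.
  rewrite (_ : _ + _ = c * (pot t + 2^-1 * n2 t)); last by field.
  by apply: mulr_ge0; [exact: ltW|apply: addr_ge0 => //; exact: mulr_ge0].
set A := expR (c * T) * G T.
have A0 : A <= - e.
  apply: le_trans (Ge T); rewrite /A -[leRHS]mul1r.
  apply: ler_wnM2r; first exact: hamilton_le0.
  by rewrite -expR0 ler_expR; apply: mulr_ge0; [exact: ltW|lra].
have hy y : T <= y -> A <= - e * (1 + c * y).
  move=> Ty; apply: (le_trans (mono T y (lexx _) Ty)).
  apply: (@le_trans _ _ (expR (c * y) * - e)).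
    by apply: ler_wpM2l; [exact: expR_ge0|exact: Ge].
  rewrite mulrC !mulNr lerN2; apply: ler_wpM2l; [exact: ltW|exact: expR_ge1Dx].
pose y := T - A / (e * c).
have ec : 0 < e * c by rewrite mulr_gt0.
have Ay : 0 <= - (A / (e * c)) by rewrite -mulNr; apply: divr_ge0; [lra|exact: ltW].
have := hy y; rewrite /y => /(_ ltac:(lra)).
rewrite (_ : - e * _ = - e - e * c * T + A); last by field; rewrite !gt_eqF.
have : 0 <= e * c * T by apply: mulr_ge0; [exact: ltW|lra].
lra.
Qed.

(** Here [t0] is the supremum of the times spent in the neighbourhood of [F Minus], bounded because
    the two neighbourhoods are disjoint. After [t0] the potential is nonnegative by (H7), and at
    [t0] itself by continuity. *)
Lemma last_exit : exists t0 t1, [/\ t0 <= t1, nbF Minus (r0 S Minus / 2) (U t0),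
  nbF Plus (r0 S Plus / 2) (U t1) & forall t, t0 <= t -> 0 <= pot t].
Proof.
have [_ [T T1 [TP TM]]] := XU.
pose A : set R := [set t | nbF Minus (r0 S Minus / 2) (U t)].
have AT t : A t -> t <= T.
  move=> At; rewrite leNgt; apply/negP => /ltW Tt.
  have [_ [_ [_ [_ [_ [_ [dj _]]]]]]] := h1.
  have : (nbF Plus (r0 S Plus) `&` nbF Minus (r0 S Minus)) (U t).
    by split; apply: (nbF_half h1); [exact: TP|exact: At].
  by rewrite dj.
have hA : has_sup A by split; [exists (- T); exact: TM|exists T].
have cA : closed A.
  apply: (@closed_comp _ _ U [set v | nbF Minus (r0 S Minus / 2) v]).
    by move=> t _; exact: spX_continuous.
  exact: dist_to_closed.
exists (sup A), T; split; [exact: ge_sup hA.1 _| | exact: TP |].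
  apply: cA => B [e /= e0 eB]; have [t At te] := sup_adherent e0 hA.
  exists t; split=> //; apply: eB; rewrite /ball/=.
  have ts : t <= sup A by apply: sup_ubound => //; exact: hA.2.
  by rewrite ger0_norm ?subr_ge0//; lra.
have pos t : sup A < t -> 0 <= pot t.
  move=> At; rewrite leNgt; apply/negP => pt.
  have : A t.
    have [_ [[UH HU _] _]] := AU; have [_ H7] := h7.
    by rewrite /A/= -(HU t)//; apply: H7; rewrite HU// solution_potE lte_fin.
  by move=> /(sup_ubound hA.2); rewrite leNgt At.
move=> t; rewrite le_eqVlt => /predU1P[<-|]; last exact: pos.
rewrite leNgt; apply/negP => pt.
have [e /= e0 He] := @cvgr_lt _ _ _ _ _ _ (@pot_continuous (sup A)) _ pt.
have e2 : 0 < e / 2 by rewrite divr_gt0.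
have := He (sup A + e / 2); rewrite /ball/= opprD addNKr normrN gtr0_norm// => /(_ ltac:(lra)).
by apply/negP; rewrite -leNgt; apply: pos; lra.
Qed.

(* With s = t - t0, q = sqrt (-2a) and G >= a e^{-2cs} (energy is nonnegative
   after t0), AM-GM bounds |U'| by the derivative of
   (e^{cs} G - (3/2) q^2 e^{-cs}) / (2qc), whose total increase is at most q/c. *)
Lemma solution_distance t0 t1 : t0 <= t1 -> (forall t, t0 <= t -> 0 <= pot t) ->
  `|U t1 - U t0| <= Num.sqrt (- 2 * a) / c.
Proof.
move=> t01 p0; have a0 := levA_lt0 h1.
set q := Num.sqrt _.
have q0 : 0 < q by rewrite sqrtr_gt0 mulNr oppr_gt0 pmulr_rlt0.
have qq : q ^+ 2 = - 2 * a by rewrite sqr_sqrtr// mulNr oppr_ge0 pmulr_rle0// ltW.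
have cn2 := speed2_continuous; have cG := hamilton_continuous.
have Glow t : t0 <= t -> a * expR (- (2 * c * (t - t0))) <= G t.
  move=> tt.
  (* At the exponent [2 * c] the kinetic terms cancel: the derivative is [2 * c] times the weighted
     potential. *)
  have : expR (2 * c * t0) * G t0 <= expR (2 * c * t) * G t.
    apply: (is_derive_le tt _ (expR_hamilton_derive (2 * c))).
      move=> s; apply: cvgM; first exact: continuous_expR_scaled.
      by apply: cvgD; apply: cvgMr; [exact: cG|exact: cn2].
    move=> s /andP[st _]; apply: mulr_ge0; first exact: expR_ge0.
    rewrite (_ : _ + _ = 2 * c * pot s); last by rewrite /G; field.
    by apply: mulr_ge0; [rewrite mulr_ge0// ltW|exact: p0].
  have : expR (2 * c * t0) * a <= expR (2 * c * t0) * G t0.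
    by apply: ler_wpM2l; [exact: expR_ge0|exact: hamilton_ge].
  move=> u v; rewrite -(@ler_pM2l _ (expR (2 * c * t))) ?expR_gt0//.
  apply: le_trans (le_trans u v); rewrite mulrCA -expRD [leRHS]mulrC.
  by rewrite (_ : _ + _ = 2 * c * t0)//; ring.
pose x t := expR (- (c * t0)) * expR (c * t).
pose y t := expR (c * t0) * expR (- c * t).
have xy t : x t * y t = 1.
  by rewrite /x /y mulrACA -!expRD (_ : _ + _ = 0) ?expR0//; ring.
have x0 t : 0 < x t by rewrite mulr_gt0 ?expR_gt0.
have y0 t : 0 < y t by rewrite mulr_gt0 ?expR_gt0.
pose N t := (2 * q * c)^-1 * expR (- (c * t0)) * (expR (c * t) * G t) -
  (3 * q / (4 * c) * expR (c * t0)) * expR (- c * t).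
pose N' t := (2 * q)^-1 * x t * (G t + n2 t) + 3 * q / 4 * y t.
have dN t : is_derive t (1:R) (N : R -> R) (N' t).
  apply: is_derive_eq (is_deriveB (is_deriveZ _ (expR_hamilton_derive c t))
    (is_deriveZ _ (is_derive_expR_scaled (- c) t))) _.
  by rewrite /GRing.scale/= /N' /x /y; field; rewrite !gt_eqF.
have cN : continuous N'.
  move=> t; apply: cvgD; apply: cvgM.
  - by apply: cvgMr; apply: cvgMr; exact: continuous_expR_scaled.
  - by apply: cvgD; [exact: cG|exact: cn2].
  - exact: cvg_cst.
  - by apply: cvgMr; exact: continuous_expR_scaled.
have UN t : t0 <= t <= t1 -> `|derive1 U t| <= N' t.
  move=> /andP[tt _]; have := Glow t tt.
  have -> : expR (- (2 * c * (t - t0))) = y t * y t.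
    by rewrite /y mulrACA -!expRD; congr expR; ring.
  move=> Gl; rewrite /N'; set n := `|_|; have -> : n2 t = n ^+ 2 by [].
  have xG : a * y t <= x t * G t.
    have := @ler_wpM2l _ (x t) (ltW (x0 t)) _ _ Gl.
    by rewrite mulrCA [x t * (_ * _)]mulrA xy mul1r.
  (* AM-GM, in the form of the square of [x t * n - q], since [y t] is the inverse of [x t]. *)
  have am : 2 * q * n <= x t * n ^+ 2 + q ^+ 2 * y t.
    rewrite -(@ler_pM2l _ (x t))// -subr_ge0.
    rewrite (_ : _ - _ = (x t * n - q) ^+ 2 + q ^+ 2 * (x t * y t - 1)); last ring.
    by rewrite xy subrr mulr0 addr0 sqr_ge0.
  rewrite -(@ler_pM2l _ (2 * q)) ?mulr_gt0//.
  rewrite [leRHS](_ : _ = x t * G t + x t * n ^+ 2 + 3 / 2 * q ^+ 2 * y t); last first.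
    by field; rewrite gt_eqF.
  have : a * y t = - (2^-1 * (q ^+ 2 * y t)) by rewrite qq; field.
  lra.
have := curve_increment_le t01 solution_C1 cN dN UN.
move=> /le_trans; apply.
have xN : N t0 = (2 * q * c)^-1 * G t0 - 3 * q / (4 * c).
  rewrite /N.
  have e1 : expR (- (c * t0)) * expR (c * t0) = 1 by rewrite -expRD addNr expR0.
  have e2 : expR (c * t0) * expR (- c * t0) = 1 by rewrite -expRD mulNr subrr expR0.
  by rewrite -[X in X - _]mulrA (mulrA (expR (- _))) e1 mul1r -[X in _ - X]mulrA e2 mulr1.
have yN : N t1 <= 0.
  rewrite /N subr_le0; apply: (@le_trans _ _ 0).
    apply: mulr_ge0_le0; first by rewrite mulr_ge0 ?expR_ge0// invr_ge0 !mulr_ge0// ltW.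
    by apply: mulr_ge0_le0; [exact: expR_ge0|exact: hamilton_le0].
  by rewrite !mulr_ge0 ?expR_ge0// ?invr_ge0 ?mulr_ge0// ltW.
(* As [a = - q ^+ 2 / 2], this term contributes at most [q / (4 * c)] to [- N t0], and the
   exponential term [3 * q / (4 * c)]: together [q / c]. *)
have gN : (2 * q * c)^-1 * a <= (2 * q * c)^-1 * G t0.
  by apply: ler_wpM2l; [rewrite invr_ge0 !mulr_ge0// ltW|exact: hamilton_ge].
have : (2 * q * c)^-1 * a = - (q / c / 4).
  have -> : a = - (2^-1 * q ^+ 2) by rewrite qq; field.
  by field; rewrite !gt_eqF.
have : 3 * q / (4 * c) = 3 * (q / c / 4) by field; rewrite gt_eqF.
rewrite xN; lra.
Qed.

Lemma solution_speed_le : 0 < d0 S -> c <= Num.sqrt (- 2 * a) / d0 S.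
Proof.
move=> d00; have [t0 [t1 [t01 tM tP p0]]] := last_exit.
rewrite ler_pdivlMr// mulrC -ler_pdivlMr//.
apply: le_trans (solution_distance t01 p0); apply: inf_lbound.
  by exists 0 => _ [v _ [w _ <-]].
by exists (U t1) => //; exists (U t0).
Qed.

Context (infc : inf_energy S c = 0%E) (cT : c * tail_cst S < 1).

(** Otherwise [G] would increase at a rate at least [2 * c * e] on a half-line, whereas it stays
    between [a] and 0. *)
Lemma slow_time (e : R) (T : R) : 0 < e -> exists2 t, t <= T & 2^-1 * n2 t <= e.
Proof.
move=> e0; apply: contrapT => h.
have ne t : t <= T -> e <= 2^-1 * n2 t.
  by move=> tT; rewrite leNgt; apply/negP => /ltW ?; apply: h; exists t.
have a0 := levA_lt0 h1.
have lin x : x <= T -> 2 * c * e * (T - x) <= G T - G x.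
  move=> xT.
  have cn : continuous (fun t => c * n2 t).
    by move=> t; apply: cvgMr; exact: speed2_continuous.
  rewrite -(FTC2 xT cn hamilton_derive) -Rintegral_itv_cst//; apply: le_locRintegral.
  - by apply: continuous_locint => s; exact: cst_continuous.
  - exact: continuous_locint.
  - move=> s /andP[_ /ne]; rewrite (mulrC 2) -mulrA => ns; apply: ler_wpM2l; first exact: ltW.
    lra.
have k0 : 0 < 2 * c * e by rewrite !mulr_gt0.
pose m := (- a + 1) / (2 * c * e).
have m0 : 0 <= m by apply: divr_ge0; [lra|exact: ltW].
have := lin (T - m); rewrite (_ : T - (T - m) = m); last ring.
rewrite mulrC divfK ?gt_eqF// => /(_ ltac:(lra)).
by have := hamilton_ge (T - m); have := hamilton_le0 T; lra.
Qed.

(** By [rdensity_primitive] and [G <= 0], the energy after [t] is at most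
    [- c^-1 * (expR (c * t) * G t)]; [tail_density] bounds the same tail from below, and its finite
    negative part cancels. *)
Lemma tail_hamilton t h : nbFH Minus (r0 S Minus) h -> incH h = U t ->
  c^-1 * G t <= a / c + tail_cst S * (pot t - a).
Proof.
move=> nh hU.
have := tail_density h1 h2 h5 c0 infc XU iU dU nh (esym hU) (solution_potE t).
set k := _ * (_ + _).
have mD : measurable (`]t, +oo[%classic : set (measurableTypeR R)).
  exact: measurable_itv.
have mf : measurable_fun setT (density c U (derive1 U)).
  by apply: density_measurable => //; [exact: spX_continuous|exact: iU.1].
have B : (\int[mu]_(s in `]t, +oo[) (density c U (derive1 U))^\+ s <=
  \int[mu]_(s in `]t, +oo[) (density c U (derive1 U))^\- s +
  (- (c^-1 * (expR (c * t) * G t)))%:E)%E.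
  rewrite [in leLHS]integral_itv_obnd_cbnd; last first.
    by apply: measurable_funTS; exact: measurable_funepos.
  rewrite [in leRHS]integral_itv_obnd_cbnd; last first.
    by apply: measurable_funTS; exact: measurable_funeneg.
  rewrite densityE; apply: (@integral_le_growing _ _ (fun=> t) (fun n => t + n%:R)) => //.
  - exact: rdensity_continuous.
  - by move=> n m nm; rewrite lerD2l ler_nat.
  - apply/seteqP; split=> [s /=|s [n _ /=]]; rewrite !in_itv/= ?andbT.
      move=> ts; exists (Num.truncn (s - t)).+1 => //=; rewrite in_itv/= ts/=.
      by have := truncnS_gt (s - t); lra.
    by case/andP.
  - move=> n; rewrite (FTC2 _ (@rdensity_continuous c) rdensity_primitive); last by rewrite lerDl.
    rewrite -[leRHS]add0r lerD2r; apply: mulr_ge0_le0; first by rewrite invr_ge0 ltW.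
    by apply: mulr_ge0_le0; [exact: expR_ge0|exact: hamilton_le0].
have Nfin : (\int[mu]_(s in `]t, +oo[) (density c U (derive1 U))^\- s < +oo)%E.
  apply: le_lt_trans (density_funeneg_integral h1 (derive1 U) c0 XU).
  rewrite [leLHS]integral_mkcond; apply: ge0_le_integral_nonmeas => s _.
    by rewrite patchE; case: ifP => // _; exact: funeneg_ge0.
  by rewrite patchE; case: ifP => // _; exact: funeneg_ge0.
have N0 : (0 <= \int[mu]_(s in `]t, +oo[) (density c U (derive1 U))^\- s)%E.
  by apply: integral_ge0 => s _; exact: funeneg_ge0.
move=> le1; have := le_trans le1 (leeD B (lexx k%:E)).
move: Nfin N0; case: (integral _ _ _) => [p| |]// _ _.
rewrite -!EFinD lee_fin /k => le2.
rewrite -(@ler_pM2l _ (expR (c * t))) ?expR_gt0// mulrCA; lra.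
Qed.

(* Where |U'| is small at the far left, tail_hamilton and c * tail_cst < 1 force
   G to be close to a. *)
Lemma hamilton_cvgNy e : 0 < e -> exists t, G t <= a + e.
Proof.
move=> e0; have [aE _] := h7.
have T0 := tail_cst_gt0 h1.
have k1 := cT; set k := c * tail_cst S in k1 *; have k0 : 0 < k by rewrite mulr_gt0.
(* As [G <= 0], the potential at a time with kinetic energy at most [eta] is at most [a + Emax S],
   so [low_energy_nbFH] applies there. The other bound absorbs the factor [1 - k] in
   [(1 - k) * (G - a) <= k * eta]. *)
pose eta := Num.min (a + Emax S) (e * (1 - k)).
have eta0 : 0 < eta by rewrite lt_min; apply/andP; split; [lra|rewrite mulr_gt0 ?subr_gt0].
have [_ [T T1 [_ TM]]] := XU.
have [t tT nt] := slow_time (- T) eta0.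
have G0 := hamilton_le0 t.
have pE : pot t = G t + 2^-1 * n2 t by rewrite /G subrK.
have [h hU nh] : exists2 h, incH h = U t & nbFH Minus (r0 S Minus) h.
  apply: (low_energy_nbFH h1 h5); first by apply: (nbF_half h1); exact: TM.
  rewrite solution_potE lee_fin pE.
  have : eta <= a + Emax S by rewrite ge_min lexx.
  lra.
exists t; have := tail_hamilton nh hU; rewrite pE.
rewrite -(@ler_pM2l _ c)// mulrA mulfV ?gt_eqF// mul1r mulrDr mulrCA mulfV ?gt_eqF// mulr1.
rewrite mulrA -/k => le.
have etae : eta <= e * (1 - k) by rewrite ge_min lexx orbT.
have kn : k * (2^-1 * n2 t) <= eta.
  apply: le_trans nt; apply: ler_piMl; last exact: ltW.
  by rewrite mulr_ge0 ?speed2_ge0.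
rewrite -lerBlDl -(@ler_pM2r _ (1 - k)) ?subr_gt0//.
lra.
Qed.

Lemma solution_speed2_integral : (\int[mu]_t (n2 t)%:E = (- a / c)%:E)%E.
Proof.
have cG (u : nat -> R) l : (forall n m, (n <= m)%N -> `|G (u m) - l| <= `|G (u n) - l|) ->
    (forall e, 0 < e -> exists n, `|G (u n) - l| < e) -> c^-1 * G (u n) @[n --> \oo] --> c^-1 * l.
  move=> mono ex; apply: cvgMr; apply/cvgrPdist_lt => e /ex[n ne].
  exists n => // m /= nm; rewrite distrC; exact: le_lt_trans (mono _ _ nm) ne.
have a0 := levA_lt0 h1.
rewrite (_ : - a / c = c^-1 * 0 - c^-1 * a); last by rewrite mulr0 sub0r mulNr mulrC.
apply: (@ge0_improper_FTC _ _ (fun t => c^-1 * G t)).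
- exact: speed2_ge0.
- exact: speed2_continuous.
- move=> t; apply: is_derive_eq (is_deriveZ c^-1 (hamilton_derive t)) _.
  by rewrite /GRing.scale/= mulKf// gt_eqF.
- apply: (cG (fun n => - n%:R)) => [n m nm|e e0].
    rewrite !ger0_norm ?subr_ge0 ?hamilton_ge// lerD2r; apply: hamilton_mono.
    by rewrite lerN2 ler_nat.
  have [t Gt] := hamilton_cvgNy (divr_gt0 e0 (ltr0n R 2)).
  exists (Num.truncn (- t)).+1; rewrite ger0_norm ?subr_ge0 ?hamilton_ge//.
  have : G (- (Num.truncn (- t)).+1%:R) <= G t.
    by apply: hamilton_mono; have := truncnS_gt (- t); lra.
  lra.
- apply: (cG (fun n => n%:R)) => [n m nm|e e0].
    rewrite !subr0 !ler0_norm ?hamilton_le0// lerN2; apply: hamilton_mono.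
    by rewrite ler_nat.
  have [t Gt] := hamilton_cvgy e0.
  exists (Num.truncn t).+1; rewrite subr0 ler0_norm ?hamilton_le0//.
  have : G t <= G (Num.truncn t).+1%:R.
    by apply: hamilton_mono; have := truncnS_gt t; lra.
  lra.
Qed.

Lemma shift_spX k : spX (fun t => U (t - k)).
Proof.
have [C1k _] := curve_C1_shift k solution_C1.
have [_ [T T1 [TP TM]]] := XU; split.
  split; first by apply/continuous_subspaceT; exact: curve_C1_continuous C1k.
  by eexists; exact: curve_C1_weak_derivative C1k.
have k1 := ler_norm k; have := ler_norm (- k); rewrite normrN => k2.
have k3 := normr_ge0 k.
exists (T + `|k|); first lra.
by split=> t tt; [apply: TP|apply: TM]; lra.
Qed.

(* c times the density at speed c' is (e^{c't} G)' + (c - c') e^{c't} G, where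
   G <= 0; shifting the profile to the right makes the last term dominate. *)
Lemma shift_energy_le c' k s m : 0 < c' -> c' < c -> G s <= a / 2 ->
  m = (c - c') * (- a / 2) / c' ->
  (energy setT c' (fun t => U (t - k)) <=
   (c^-1 * (- a + m - m * expR (c' * (s + k))))%:E)%E.
Proof.
move=> c'0 cc Gs mE; have a0 := levA_lt0 h1.
have m0 : 0 <= m.
  rewrite mE; apply: divr_ge0; last exact: ltW.
  by apply: mulr_ge0; [rewrite subr_ge0 ltW|lra].
have [C1k dk] := curve_C1_shift k solution_C1.
have Xk := shift_spX k.
rewrite (energyE c' (spX_continuous Xk) (curve_C1_weak_derivative C1k)) integralE.
rewrite leeBlDr//; last first.
  rewrite ge0_fin_numE; first exact: density_funeneg_integral.
  by apply: integral_ge0 => t _; exact: funeneg_ge0.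
rewrite addeC.
pose g t := (2^-1 * n2 (t - k) + pot (t - k)) * expR (c' * t).
have -> : density c' (fun t => U (t - k)) (derive1 (fun t => U (t - k))) = EFin \o g.
  by apply/funext => t; rewrite /density dk solution_potE -EFinD -EFinM.
have csh (f : R -> R) : continuous f -> continuous (fun t => f (t - k)).
  move=> cf t; apply: (@continuous_comp _ _ _ (fun t : R => t - k) f); last exact: cf.
  by apply: cvgB; [exact: cvg_id|exact: cvg_cst].
have cg : continuous g.
  move=> t; apply: cvgM; last exact: continuous_expR_scaled.
  apply: cvgD; last exact: csh pot_continuous _.
  by apply: cvgMr; exact: csh speed2_continuous _.
pose P t := expR (c' * t) * G (t - k).
pose P' t := expR (c' * t) * (c' * G (t - k) + c * n2 (t - k)).
have dP t : is_derive t (1:R) P (P' t).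
  have dk1 : is_derive t (1:R) (fun s : R => s - k) 1.
    by apply: is_derive_eq (is_deriveB (is_derive_id t (1:R)) (is_derive_cst k t (1:R))) _; rewrite subr0.
  have dG := @is_derive1_comp R G (fun s => s - k) t _ _ (hamilton_derive (t - k)) dk1.
  apply: is_derive_eq (is_deriveM (is_derive_expR_scaled c' t) dG) _.
  by rewrite /GRing.scale/= /P'; ring.
have cP' : continuous P'.
  move=> t; apply: cvgM; first exact: continuous_expR_scaled.
  by apply: cvgD; apply: cvgMr; [exact: csh hamilton_continuous _|exact: csh speed2_continuous _].
have gE t : g t = c^-1 * (P' t + (c - c') * expR (c' * t) * G (t - k)).
  by rewrite /g /P' /G; field; rewrite gt_eqF.
set z := s + k.
pose N := (Num.truncn `|z|).+1.
have zN : `|z| < N%:R by exact: truncnS_gt.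
apply: (@integral_le_growing _ _ (fun n => - (n + N)%:R) (fun n => (n + N)%:R)) => //.
- by move=> n p np; rewrite lerN2 ler_nat leq_add2r.
- by move=> n p np; rewrite ler_nat leq_add2r.
- apply/seteqP; split=> // t _; exists (Num.truncn `|t|).+1 => //=.
  rewrite in_itv/= -ler_norml natrD; have := truncnS_gt `|t|.
  by have := ler0n R N; lra.
move=> n; set v := (n + N)%:R.
have Nv : N%:R <= v by rewrite ler_nat leq_addl.
have z1 := ler_norm z; have := ler_norm (- z); rewrite normrN => z2.
have uz : - v <= z by lra.
have zv : z <= v by lra.
rewrite (Rintegral_chasles (continuous_locint cg) uz zv).
have ci0 : 0 <= c^-1 by rewrite invr_ge0 ltW.
have i2 : \int[mu]_(t in `[z, v]) g t <= c^-1 * (P v - P z).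
  rewrite -(FTC2 zv cP' dP) -locRintegralZ; last exact: continuous_locint.
  apply: le_locRintegral; [exact: continuous_locint|exact/locintZ/continuous_locint|].
  move=> t _; rewrite gE; apply: ler_wpM2l => //; rewrite gerDl.
  apply: mulr_ge0_le0; last exact: hamilton_le0.
  by apply: mulr_ge0; [rewrite subr_ge0 ltW|exact: expR_ge0].
(* To the left of [z] the shifted [G] is at most [a / 2], so the extra term is at most minus the
   derivative of [m * expR (c' * t)]: this is what fixes [m]. *)
pose Q t := P t - m * expR (c' * t).
pose Q' t := P' t - m * (c' * expR (c' * t)).
have dQ t : is_derive t (1:R) Q (Q' t).
  exact: is_derive_eq (is_deriveB (dP t) (is_deriveZ m (is_derive_expR_scaled c' t))) _.
have cQ' : continuous Q'.
  move=> t; apply: cvgB; first exact: cP'.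
  by apply: cvgMr; apply: cvgMr; exact: continuous_expR_scaled.
have i1 : \int[mu]_(t in `[- v, z]) g t <= c^-1 * (Q z - Q (- v)).
  rewrite -(FTC2 uz cQ' dQ) -locRintegralZ; last exact: continuous_locint.
  apply: le_locRintegral; [exact: continuous_locint|exact/locintZ/continuous_locint|].
  move=> t /andP[_ tz]; rewrite gE; apply: ler_wpM2l => //; rewrite lerD2l.
  have Gt : G (t - k) <= a / 2.
    by apply: le_trans Gs; apply: hamilton_mono; rewrite lerBlDr.
  rewrite [leRHS](_ : _ = (c - c') * expR (c' * t) * (a / 2)); last first.
    by rewrite mE; field; rewrite gt_eqF.
  apply: ler_wpM2l => //; apply: mulr_ge0; [by rewrite subr_ge0 ltW|exact: expR_ge0].
apply: le_trans (lerD i1 i2) _; rewrite -mulrDr; apply: ler_wpM2l => //.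
have Pv : P v <= 0 by apply: mulr_ge0_le0; [exact: expR_ge0|exact: hamilton_le0].
have e1 : expR (c' * - v) <= 1.
  rewrite -expR0 ler_expR mulrN oppr_le0; apply: mulr_ge0; [exact: ltW|exact: ler0n].
have Pu : a <= P (- v).
  apply: (@le_trans _ _ (1 * G (- v - k))); first by rewrite mul1r hamilton_ge.
  by apply: ler_wnM2r; first exact: hamilton_le0.
have : m * expR (c' * - v) <= m by apply: ler_piMr.
rewrite /Q; lra.
Qed.

Lemma inf_energy_slower c' : 0 < c' -> c' < c -> inf_energy S c' = -oo%E.
Proof.
move=> c'0 cc; have a0 := levA_lt0 h1.
have [s Gs] : exists s, G s <= a / 2.
  have [|s Gs] := @hamilton_cvgNy (- a / 2); first lra.
  by exists s; lra.
pose m := (c - c') * (- a / 2) / c'.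
have m0 : 0 < m.
  apply: divr_gt0 => //; apply: mulr_gt0; [by rewrite subr_gt0|lra].
apply/eqP; rewrite eq_le leNye andbT; apply/negPn/negP; rewrite -ltNge => infN.
have up k : (inf_energy S c' <= (c^-1 * (- a + m - m * expR (c' * (s + k))))%:E)%E.
  apply: le_trans (shift_energy_le k c'0 cc Gs (erefl m)).
  by apply: ereal_inf_lbound; exists (fun t => U (t - k)) => //; exact: shift_spX.
have [I IE] : exists I, inf_energy S c' = I%:E.
  move: infN (up 0); case: (inf_energy S c') => [I| |]// _ _; by exists I.
have {up infN} up k : m * (c' * (s + k)) <= - a - c * I.
  have := up k; rewrite IE lee_fin ler_pdivlMl// => h.
  have := @ler_wpM2l _ m (ltW m0) _ _ (expR_ge1Dx (c' * (s + k))).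
  lra.
pose B := - a - c * I.
(* The shift is chosen so that the left-hand side of [up] becomes [|B| + 1]. *)
have := up ((`|B| + 1) / (m * c') - s); rewrite addrC subrK -/B.
have mc : 0 < m * c' by apply: mulr_gt0.
rewrite mulrA mulrC (divfK (lt0r_neq0 mc)).
by have := ler_norm B; lra.
Qed.

End Solution.
Lemma continuous_ae_eq {R : realType} {V : normedModType R} (f g : R -> V) :
  continuous f -> continuous g ->
  {ae (@lebesgue_measure R), forall t, f t = g t} -> forall t, f t = g t.
Proof.
move=> cf cg [A [mA A0 subA]] t; apply: contrapT => /eqP fg.
have op : \forall s \near t, f s - g s != 0.
  have fgc : (fun s => f s - g s) @ t --> f t - g t.
    by apply: cvgB; [exact: cf|exact: cg].
  by apply: (cvgr_neq0 _ fgc); rewrite subr_eq0.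
have [e /= e0 He] := op.
have : (lebesgue_measure (ball t e : set R) <= 0)%E.
  rewrite -A0; apply: le_measure; rewrite ?inE//; first exact: measurable_ball.
  apply: (subset_trans _ subA) => s /He + /= fgs.
  by rewrite fgs subrr eqxx.
rewrite [X in (X <= _)%E](_ : _ = (e *+ 2)%:E); last first.
  exact: (lebesgue_measure_ball t (ltW e0)).
by rewrite lee_fin leNgt mulrn_wgt0.
Qed.

(** * Zero-energy curves are solutions *)

Section Minimizer.
Context {R : realType} (S : setting R).
Local Notation L := (spL S).
Local Notation E := (@potE R S).
Local Notation F := (@setF R S).
Local Notation incH := (incH S).
Local Notation proj := (@projE R S).
Local Notation mu := (@lebesgue_measure R).
Context (h1 : hypH1 S) (h2 : hypH2 S) (h6 : hypH6 S).
Context (c : R) (c0 : 0 < c) (infc : inf_energy S c = 0%E).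
Context (U : R -> L) (AU : classA setT U) (XU : spX U)
  (E0 : energy setT c U = 0%E).

Lemma proj_contraction s t : `|proj (U t) - proj (U s)| <= `|U t - U s|.
Proof. by have [_ [H _]] := h6. Qed.

Lemma proj_continuous : continuous (fun t => proj (U t)).
Proof.
move=> t; apply/cvgrPdist_lt => e e0.
have /cvgrPdist_lt /(_ e e0) := spX_continuous XU (x := t).
apply: filterS => s; apply: le_lt_trans; exact: proj_contraction.
Qed.

Lemma proj_dist s v : (dist_to (F s) (proj v) <= dist_to (F s) v)%E.
Proof.
have [_ [H [id _]]] := h6.
apply: le_ereal_inf_tmp => _ [f Ff <-].
apply: le_trans (dist_to_le (proj v) Ff) _.
by rewrite lee_fin -{1}(id _ _ Ff).
Qed.

Lemma proj_spX V : weak_derivative setT (fun t => proj (U t)) V ->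
  spX (fun t => proj (U t)).
Proof.
move=> dV; split.
  by split; [apply/continuous_subspaceT; exact: proj_continuous|exists V].
have [_ [T T1 [TP TM]]] := XU; exists T => //.
by split=> t /[dup] tT; [move/TP|move/TM]; apply: le_trans; exact: proj_dist.
Qed.

(* proj o U is again in X, with smaller speed and smaller potential; its energy
   cannot be below the infimum 0, so the two potentials agree. *)
Lemma minimizer_proj t : proj (U t) = U t.
Proof.
have C1U := solution_C1 AU.
have cU := spX_continuous XU.
have dU := curve_C1_weak_derivative C1U.
have iU : smL2 (derive1 U) by apply: continuous_smL2; exact: curve_C1_derive1.
have [V [dV iV VU]] := contraction_weak_derivative C1U proj_contraction.
have XW := proj_spX dV; set W := fun t => proj (U t) in dV XW.
have [H61 _] := h6.
pose w t := (2^-1 * `|V t| ^+ 2 + fine (E (W t))) * expR (c * t).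
pose u := rdensity U c.
have Wfin s : E (W s) = (fine (E (W s)))%:E.
  rewrite fineK// fin_numElt potE_gtNy/=.
  by rewrite (le_lt_trans (H61 (U s)).1)// (solution_potE h2 AU) ltry.
have wE : density c W V = EFin \o w.
  by apply/funext => s; rewrite /density Wfin -EFinD -EFinM.
have uE := densityE h2 AU c.
have gap s : (pot U s - fine (E (W s))) * expR (c * s) <= u s - w s.
  rewrite /u /rdensity /w -mulrBl; apply: ler_wpM2r; first exact: expR_ge0.
  have : `|V s| ^+ 2 <= speed2 U s by rewrite ler_sqr ?nnegrE.
  lra.
have potW s : fine (E (W s)) <= pot U s.
  by rewrite -lee_fin -Wfin -(solution_potE h2 AU); exact: (H61 (U s)).1.
have wu s : w s <= u s.
  rewrite -subr_ge0; apply: le_trans (gap s).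
  by apply: mulr_ge0; [rewrite subr_ge0|exact: expR_ge0].
have cW := proj_continuous.
have mw : measurable_fun setT (EFin \o w).
  by rewrite -wE; apply: density_measurable => //; exact: iV.1.
have mu' : measurable_fun setT (EFin \o u).
  by rewrite -uE; apply: density_measurable => //; exact: iU.1.
have [M [Mp Mn M0]] := solution_energy h1 c0 AU XU E0.
have := (energy_ge0P h1 c0 XW dV).1 (inf_energy_ge0 infc XW).
rewrite uE in Mp Mn; rewrite wE => le1.
have le2 : (\int[mu]_s (EFin \o w)^\+ s <= M%:E)%E.
  rewrite -Mp; apply: ge0_le_integral_nonmeas => s _; first exact: funepos_ge0.
  by rewrite !funeposE/= ge_max !le_max !lee_fin wu/= lexx orbT.
have intW : mu.-integrable setT (EFin \o w).
  apply/integrableP; split=> //.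
  have -> : (\int[mu]_s `|(EFin \o w) s| =
      \int[mu]_s (EFin \o w)^\+ s + \int[mu]_s (EFin \o w)^\- s)%E.
    rewrite -ge0_integralD//; [|exact: measurable_funepos|exact: measurable_funeneg].
    by apply: eq_integral => s _; rewrite -[RHS]/(((EFin \o _)^\+ \+ (EFin \o _)^\-)%E s) -fune_abse.
  by apply: lte_add_pinfty; [|apply: le_lt_trans le1 _]; rewrite (le_lt_trans le2)// ltry.
have intU : mu.-integrable setT (EFin \o u).
  apply/integrableP; split=> //.
  have -> : (\int[mu]_s `|(EFin \o u) s| =
      \int[mu]_s (EFin \o u)^\+ s + \int[mu]_s (EFin \o u)^\- s)%E.
    rewrite -ge0_integralD//; [|exact: measurable_funepos|exact: measurable_funeneg].
    by apply: eq_integral => s _; rewrite -[RHS]/(((EFin \o _)^\+ \+ (EFin \o _)^\-)%E s) -fune_abse.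
  by rewrite Mp Mn -EFinD ltry.
(* The integral of [u] is the zero energy of [U], that of [w] is nonnegative by minimality; since
   [u - w] is nonnegative it must vanish almost everywhere. *)
have int0 : (\int[mu]_s (u s - w s)%:E <= 0)%E.
  rewrite integralB_EFin// [X in (X - _)%E]integralE Mp Mn subee// sub0e leeNl oppe0.
  rewrite integralE sube_ge0 //; apply/orP; left.
  exact: integrable_neg_fin_num.
have ae0 : ae_eq mu setT (fun s => (u s - w s)%:E) (cst 0).
  apply/(ae_eq_integral_abs mu measurableT); first exact: (emeasurable_funB mu' mw).
  apply/eqP; rewrite eq_le integral_ge0 ?andbT//.
  apply: le_trans int0; rewrite le_eqVlt; apply/orP; left; apply/eqP.
  by apply: eq_integral => s _; rewrite gee0_abs// lee_fin subr_ge0.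
(* Where the densities agree so do the potentials, and the equality case of (H6) identifies the two
   curves; continuity removes the null set. *)
apply: (continuous_ae_eq cW cU); apply: (ae_imp ae0) => s /(_ I)/= [us].
have := gap s; rewrite us => g0; apply: (H61 (U s)).2.1.
rewrite -/(W s) Wfin (solution_potE h2 AU); congr (_%:E).
apply/eqP; rewrite eq_le potW/= -subr_le0.
by move: g0; rewrite pmulr_lle0 ?expR_gt0.
Qed.

Lemma perturbation_spX (phi : R -> spH S) : curve_C1 setT phi ->
  compact_support_in (interior setT) phi -> spX (fun t => U t + incH (phi t)).
Proof.
move=> C1p [K [cK _ K0]].
have C1U := solution_C1 AU.
have dp t : is_derive t (1:R) (fun t => incH (phi t)) (incH (derive1 phi t)).
  have d1 : is_derive t (1:R) phi (derive1 phi t).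
    by split; [exact: C1p.1|rewrite derive1E].
  have := is_derive_diff_comp d1 (linear_differentiable (phi t) (incH_continuous h2)).
  by rewrite diff_lin//; exact: incH_continuous.
have dUp t : is_derive t (1:R) (fun t => U t + incH (phi t)) (derive1 U t + incH (derive1 phi t)).
  by apply: is_deriveD; exact: curve_C1_derive.
have C1Up : curve_C1 setT (fun t => U t + incH (phi t)).
  split; first by move=> t _; case: (dUp t).
  have -> : derive1 (fun t => U t + incH (phi t)) = fun t => derive1 U t + incH (derive1 phi t).
    by apply/funext => t; rewrite derive1E; case: (dUp t).
  move=> t _; apply: cvgD; first exact: curve_C1_derive1.
  apply: (@continuous_comp _ _ _ (derive1 phi) incH); last exact: incH_continuous.
  exact: C1p.2.
have [_ [T T1 [TP TM]]] := XU; split.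
  split; first by apply/continuous_subspaceT; exact: curve_C1_continuous C1Up.
  by eexists; exact: curve_C1_weak_derivative C1Up.
have [M [_ HM]] := compact_bounded cK.
have p0 t : Num.max 0 M + 1 <= `|t| -> phi t = 0.
  move=> tM; apply: K0 => Kt.
  have M1 : M < Num.max 0 M + 1 by rewrite ltr_pwDr// le_max lexx orbT.
  have M2 : M < (M + (Num.max 0 M + 1)) / 2 by lra.
  by have h : `|t| <= (M + (Num.max 0 M + 1)) / 2 := HM _ M2 t Kt; lra.
set B := Num.max 0 M + 1 in p0.
have B0 : 0 <= Num.max 0 M by rewrite le_max lexx.
exists (T + B); first by rewrite /B; lra.
split=> t tt; rewrite p0 ?linear0 ?addr0.
- by apply: TP; rewrite /B in tt; lra.
- by apply: le_trans (ler_norm _); lra.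
- by apply: TM; rewrite /B in tt; lra.
- by rewrite -normrN; apply: le_trans (ler_norm _); lra.
Qed.

Lemma minimizer_solves : solves setT c U.
Proof.
have [_ [_ [_ H]]] := h6.
suff [] : classA setT U /\ solves setT c U by [].
apply: H => //.
- by exists 0.
- exact: openT.
- exact: XU.1.
- split; first exact: spX_energy_defined.
  split; first by rewrite E0.
  (* Any radius works: every compactly supported perturbation keeps the curve in X, where energies
     are nonnegative. *)
  exists 1; first exact: ltr01.
  move=> phi C1p supp _ Uphi; have Xp : spX Uphi by exact: perturbation_spX.
  split; first exact: spX_energy_defined.
  by rewrite E0; exact: inf_energy_ge0 infc Xp.
- by move=> t _; rewrite minimizer_proj.
Qed.

End Minimizer.

(** * The constants and the conclusion *)

Section Constants.
Context {R : realType} (S : setting R).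
Local Notation a := (levA S).
Context (h1 : hypH1 S) (h7 : hypH7 S) (ha : - a < (d0 S * gamma S) ^+ 2 / 2).

Lemma gamma_gt0 : 0 < gamma S.
Proof.
rewrite /gamma invr_gt0 /sfC; have := cstC_gt1 h1 Minus; set k := cstC S Minus => k1.
have : 0 <= 2^-1 * k ^+ 2 * (k ^+ 2 + (k + 1) ^+ 2).
  apply: mulr_ge0; last by apply: addr_ge0; exact: sqr_ge0.
  by apply: mulr_ge0; [rewrite invr_ge0|exact: sqr_ge0].
lra.
Qed.

(** Expanding [sfC] shows that the inverse of [gamma] is [C + tail_cst + C ^+ 3], which exceeds
    [tail_cst]. *)
Lemma gamma_tail_cst k : k < gamma S -> k * tail_cst S < 1.
Proof.
move=> kg; have T0 := tail_cst_gt0 h1.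
have g0 := gamma_gt0.
apply: (@lt_trans _ _ (gamma S * tail_cst S)); first by rewrite ltr_pM2r.
have D0 : 0 < cstC S Minus + sfC S by rewrite -invr_gt0.
rewrite /gamma mulrC ltr_pdivrMr// mul1r /tail_cst /sfC.
have := cstC_gt1 h1 Minus; set C := cstC S Minus => C1.
have : 0 <= C ^+ 3 by rewrite exprn_ge0//; lra.
rewrite [X in _ -> _ < X](_ : _ = C + C ^+ 2 * (2^-1 + C ^+ 2) + C ^+ 3); last by field.
lra.
Qed.

(** The value 0 is excluded by the bound on [- a], which is positive; this also rules out an empty
    set of distances, whose [inf] is 0 by convention. *)
Lemma d0_gt0 : 0 < d0 S.
Proof.
have a0 := levA_lt0 h1.
have dn : d0 S != 0.
  by apply/eqP => d00; move: ha; rewrite d00 mul0r expr0n/= mul0r; lra.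
rewrite lt_neqAle eq_sym dn/=; move: dn; rewrite /d0; set A := [set _ | _ in _ & _ in _].
have [->|/set0P A0] := eqVneq A set0; first by rewrite inf0 eqxx.
by move=> _; apply: lb_le_inf => // _ [v _ [w _ <-]].
Qed.

Lemma speed_bounds :
  Num.sqrt (- 2 * a) / d0 S < Num.min (Num.sqrt (2 * Emax S) / d0 S) (gamma S).
Proof.
have a0 := levA_lt0 h1; have d00 := d0_gt0; have g0 := gamma_gt0.
have [aE _] := h7.
rewrite lt_min; apply/andP; split.
  by rewrite ltr_pM2r ?invr_gt0// ltr_sqrt; lra.
rewrite ltr_pdivrMr// -ltr_sqr ?nnegrE ?sqrtr_ge0//; last first.
  by apply: mulr_ge0; exact: ltW.
rewrite sqr_sqrtr; last lra.
by move: ha; rewrite mulrC; lra.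
Qed.

End Constants.

Theorem theorem7 (R : realType) (S : setting R)
    (h1 : hypH1 S) (h2 : hypH2 S) (h3 : hypH3 S) (h4 : hypH4 S)
    (h5 : hypH5 S) (h6 : hypH6 S) (h7 : hypH7 S)
    (ha : - levA S < (d0 S * gamma S) ^+ 2 / 2)
    (cstar : R) (U : R -> spL S) (hU : minimizing_solution_pair cstar U) :
  (forall Ut : R -> spL S,
     classA [set: R] Ut -> spX Ut -> energy [set: R] cstar Ut = 0%E ->
     [/\ solves [set: R] cstar Ut,
         (\int[@lebesgue_measure R]_(t in [set: R])
            (`|derive1 Ut t| ^+ 2)%:E < +oo)%E
       & cstar = - levA S /
           \int[@lebesgue_measure R]_(t in [set: R]) (`|derive1 Ut t| ^+ 2)])
  /\ (cstar%:E = ereal_sup [set c%:E | c in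
        [set c : R | 0 < c /\ inf_energy S c = -oo%E]])
  /\ (cstar%:E = ereal_inf [set c%:E | c in
        [set c : R | 0 < c /\ inf_energy S c = 0%E]])
  /\ cstar <= Num.sqrt (- 2 * levA S) / d0 S
  /\ Num.sqrt (- 2 * levA S) / d0 S < Num.min (Num.sqrt (2 * Emax S) / d0 S) (gamma S).
Proof.
have [c0 [AU [XU [sU [E0 [infc _]]]]]] := hU.
have a0 := levA_lt0 h1.
have cd := solution_speed_le h1 h2 h7 c0 AU XU sU E0 (d0_gt0 h1 ha).
have bounds := speed_bounds h1 h7 ha.
have cT : cstar * tail_cst S < 1.
  apply: (gamma_tail_cst h1); apply: (le_lt_trans cd); apply: (lt_le_trans bounds).
  by rewrite ge_min lexx orbT.
have slower c' : 0 < c' -> c' < cstar -> inf_energy S c' = -oo%E.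
  exact: (inf_energy_slower h1 h2 h5 h7 c0 AU XU sU E0 infc cT).
have faster c' : cstar < c' -> (0 <= inf_energy S c')%E.
  by move=> cc; apply: (inf_energy_faster h1 h2 h5 h7 c0 cc (ltW cT) infc).
split.
  move=> Ut AUt XUt E0t.
  have sUt := minimizer_solves h1 h2 h6 c0 infc AUt XUt E0t.
  have int := solution_speed2_integral h1 h2 h5 h7 c0 AUt XUt sUt E0t infc cT.
  split=> //; first by rewrite int ltry.
  by rewrite /Rintegral int/= invf_div mulrCA mulfV ?mulr1// oppr_eq0 lt_eqF.
split.
  apply/eqP; rewrite eq_le; apply/andP; split; last first.
    apply: ge_ereal_sup => _ [c' [c'0 infc'] <-]; rewrite lee_fin leNgt; apply/negP => cc.
    by have := faster _ cc; rewrite infc'.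
  apply/lee_subgt0Pr => e e0.
  (* The term [cstar / 2] keeps the speed positive when [e] exceeds [cstar]. *)
  pose c' := Num.max (cstar / 2) (cstar - e).
  apply: (@le_trans _ _ c'%:E); first by rewrite -EFinB lee_fin le_max lexx orbT.
  apply: ereal_sup_ubound; exists c' => //; split.
    by rewrite lt_max divr_gt0.
  by apply: slower; rewrite ?lt_max ?divr_gt0// gt_max; apply/andP; split; lra.
split; last by [].
apply/eqP; rewrite eq_le; apply/andP; split.
  apply: le_ereal_inf_tmp => _ [c' [c'0 infc'] <-]; rewrite lee_fin leNgt; apply/negP => cc.
  by move: infc'; rewrite slower.
by apply: ereal_inf_lbound; exists cstar.
Qed.
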